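(* Let $p\ge1$ and $n\ge2$ be integers. Let $F\subset\mathbb{P}^n(\mathbb{C})$ be the Fermat hypersurface of degree $d$ defined by the homogeneous polynomial $Q(\omega)=\sum_{i=0}^n\omega_i^d$, where $[\omega_0:\omega_1:\dots:\omega_n]$ are homogeneous coordinates on $\mathbb{P}^n(\mathbb{C})$. If $d>(n+1)\,\kappa(p,n)$, then every holomorphic mapping $f\colon\mathbb{C}^p\to\mathbb{P}^n(\mathbb{C})$ of maximal rank omitting $F$ (that is, $f(\mathbb{C}^p)\cap F=\varnothing$) is algebraically degenerate.
   Context: For positive integers $p,n$, put $\kappa(p,n)=\max\{n+1-p,1\}$. A holomorphic mapping $f\colon\mathbb{C}^p\to\mathbb{P}^n(\mathbb{C})$ is of maximal rank if at some point $z\in\mathbb{C}^p$ one has $\operatorname{rank}(df_z)=\min\{p,n\}$. It is algebraically degenerate if its image is contained in some algebraic hypersurface of $\mathbb{P}^n(\mathbb{C})$. *)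

(* Defs.v *)
From HB Require Import structures.
From mathcomp Require Import all_boot all_order all_algebra complex.
From mathcomp Require Import all_classical all_reals all_analysis.
(* The notations of [mpoly] clash with those of the preceding libraries; in
   particular [mpolyX K (mnm1 i)] stands for 'X_i. *)
From mathcomp Require Import -(notations) mpoly.
Set Implicit Arguments.
Unset Strict Implicit.
Unset Printing Implicit Defensive.
Import Order.TTheory GRing.Theory Num.Theory.
Import numFieldNormedType.Exports.
Local Open Scope ring_scope.
Local Open Scope classical_set_scope.

(* [R[i]] carries its topology only through its [numFieldType] structure. The
   norm is the modulus, so that [differentiable] over [Cplx R] means complex
   differentiable. *)
Definition Cplx (R : realType) : numClosedFieldType := (R[i])%C.

(* P^n(K) is the set of lines through the origin of K^(n+1). *)
Definition projSpace (K : fieldType) (n : nat) : Type :=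
  {L : {vspace 'rV[K]_n.+1} | \dim L == 1%N}.

Fact dim_line_eq1 (K : fieldType) (n : nat) (v : 'rV[K]_n.+1) :
  v != 0 -> \dim <[v]> == 1%N.
Proof. by move=> v0; rewrite dim_vline v0. Qed.

(* The point [v_0 : ... : v_n]. *)
Definition projPt (K : fieldType) (n : nat) (v : 'rV[K]_n.+1) (v0 : v != 0) :
    projSpace K n :=
  exist _ <[v]>%VS (dim_line_eq1 v0).

(* A chosen system of homogeneous coordinates of a point. What is defined from
   it below does not depend on the choice: see [affChartE] and [zeroLocusE]. *)
Definition hcoord (K : fieldType) (n : nat) (x : projSpace K n) :
    'rV[K]_n.+1 :=
  vpick (sval x).

Lemma hcoordE (K : fieldType) (n : nat) (v : 'rV[K]_n.+1) (v0 : v != 0) :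
  exists2 c : K, c != 0 & hcoord (projPt v0) = c *: v.
Proof.
have /vlineP[c hc] : hcoord (projPt v0) \in <[v]>%VS by exact: memv_pick.
exists c => //; apply/eqP => c0.
move: hc; rewrite c0 scale0r => /eqP; rewrite vpick0 -dimv_eq0 /=.
by rewrite dim_vline v0.
Qed.

(* U_i = {w_i != 0} and the chart U_i -> K^n, [w] |-> (w_j / w_i) for j != i. *)
Definition affOpen (K : fieldType) (n : nat) (i : 'I_n.+1) :
    set (projSpace K n) :=
  [set x | hcoord x 0 i != 0].

Definition affChart (K : fieldType) (n : nat) (i : 'I_n.+1)
    (x : projSpace K n) : 'rV[K]_n :=
  \row_j (hcoord x 0 (lift i j) / hcoord x 0 i).

Lemma affOpenE (K : fieldType) (n : nat) (i : 'I_n.+1) (v : 'rV[K]_n.+1)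
    (v0 : v != 0) :
  affOpen i (projPt v0) <-> v 0 i != 0.
Proof.
by rewrite /affOpen /=; have [c c0 ->] := hcoordE v0; rewrite mxE mulf_eq0 negb_or c0.
Qed.

Lemma affChartE (K : fieldType) (n : nat) (i : 'I_n.+1) (v : 'rV[K]_n.+1)
    (v0 : v != 0) :
  affChart i (projPt v0) = \row_j (v 0 (lift i j) / v 0 i).
Proof.
apply/rowP => j; rewrite !mxE; have [c c0 ->] := hcoordE v0.
by rewrite !mxE -mulf_div divff // mul1r.
Qed.

(* The zero locus in P^n(K) of a homogeneous polynomial. *)
Definition zeroLocus (K : fieldType) (n : nat) (Q : mpoly n.+1 K) :
    set (projSpace K n) :=
  [set x | meval (fun i => hcoord x 0 i) Q = 0].

Lemma zeroLocusE (K : fieldType) (n k : nat) (Q : mpoly n.+1 K)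
    (v : 'rV[K]_n.+1) (v0 : v != 0) :
  Q \is ishomog1 k mdeg ->
  zeroLocus Q (projPt v0) <-> meval (fun i => v 0 i) Q = 0.
Proof.
move=> /dhomogP hQ; rewrite /zeroLocus /=; have [c c0 ->] := hcoordE v0.
have -> : meval (fun i => (c *: v) 0 i) Q =
          c ^+ k * meval (fun i => v 0 i) Q.
  rewrite !mevalE mulr_sumr; apply: eq_big_seq => m /hQ /= hm.
  rewrite mulrCA; congr (_ * _).
  rewrite -hm mdegE -prodrXr -big_split /=.
  by apply: eq_bigr => i _; rewrite mxE exprMn.
split=> [/eqP|->]; last by rewrite mulr0.
by rewrite mulf_eq0 expf_eq0 (negPf c0) andbF /= => /eqP.
Qed.

Definition algHypersurface (K : fieldType) (n : nat)
    (H : set (projSpace K n)) : Prop :=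
  exists (k : nat) (Q : mpoly n.+1 K),
    [/\ (0 < k)%N, Q != 0, Q \is ishomog1 k mdeg & H = zeroLocus Q].

Definition fermat (K : fieldType) (n d : nat) : set (projSpace K n) :=
  zeroLocus (\sum_(i < n.+1) mpolyX K (mnm1 i) ^+ d).
Arguments fermat : clear implicits.

(* Holomorphy of f : C^p -> P^n(C), read in the charts (U_i, affChart i). *)
Definition holoMap (R : realType) (p n : nat)
    (f : 'rV[Cplx R]_p -> projSpace (Cplx R) n) : Prop :=
  forall i : 'I_n.+1,
    open (f @^-1` affOpen i) /\
    forall z, affOpen i (f z) -> differentiable (affChart i \o f) z.

(* The rank of df_z is that of the Jacobian matrix in any chart around f z. *)
Definition maximalRank (R : realType) (p n : nat)
    (f : 'rV[Cplx R]_p -> projSpace (Cplx R) n) : Prop :=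
  exists (z : 'rV[Cplx R]_p) (i : 'I_n.+1),
    affOpen i (f z) /\ \rank (jacobian (affChart i \o f) z) = minn p n.

Definition algDegenerate (R : realType) (p n : nat)
    (f : 'rV[Cplx R]_p -> projSpace (Cplx R) n) : Prop :=
  exists2 H, algHypersurface H & range f `<=` H.

(* The subtraction is truncated, which the maximum with 1 absorbs. *)
Definition kappa (p n : nat) : nat := maxn (n + 1 - p) 1.

(* Main.v *)
Require Import Defs.
From HB Require Import structures.
From mathcomp Require Import all_boot all_order all_algebra complex.
From mathcomp Require Import all_classical all_reals all_analysis.
From mathcomp Require Import perm ring lra.
From mathcomp Require Import -(notations) mpoly.
Set Implicit Arguments.
Unset Strict Implicit.
Unset Printing Implicit Defensive.
Import Order.TTheory GRing.Theory Num.Theory.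
Import numFieldNormedType.Exports.
Local Open Scope ring_scope.
Local Open Scope classical_set_scope.

(* Write g_i = w_i^d / Q(w) for homogeneous coordinates w of f. As f omits the
   Fermat hypersurface, these are entire functions with sum 1, and locally
   g_i = a_i^d u with u nonvanishing. A linear relation between the g_i is a
   hypersurface containing the image of f. Otherwise the maximal rank of f
   provides a generalized Wronskian W of the g_i, with derivatives of order at
   most kappa(p, n), that does not vanish identically: the rank of the matrix of
   derivatives of order at most k is at least 1 + min(p, n) for k = 1, and grows with
   k until it reaches n + 1.

   No value distribution theory is needed to contradict this. For
   kappa/d < th < 1/(n+1) the function
     |W| prod_i |g_i|^(th-1) (1 + |g_i|^(2s)) prod_w (1 + |D^w g_i / g_i|^2)^eps
   is continuous. Multiply it by a power of the barrier prod_j (1 - |z_j|^2) on the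
   unit polydisc. At a maximum, the Laplacians of the logarithm in the coordinate
   directions are nonpositive, which bounds all logarithmic derivatives of the
   g_i there, and hence the maximum itself, by a constant that does not depend on
   the g_i. Applied to g(z + r y) with r large, this makes W vanish at z. *)

(** The window for [th] comes from the two ends of the metric. Since g_i = a^d u locally, a
    derivative of order at most kappa is O(|g_i|^(1 - kappa/d)), so the Wronskian absorbs |g_i|^(th
    - 1) at a zero of g_i once th > kappa/d. Where the g_i are large, sum g_i = 1 lets the column of
    the largest |g_j| be replaced by a bounded one; this gains a factor 1/|g_j|, which outweighs the
    remaining |g_i|^th as long as (n + 1) th < 1. Both are possible because d > (n + 1) kappa. The
    other two factors are there for their Laplacians, as ln|W| and ln|g_i| are harmonic. The one
    with s controls first logarithmic derivatives up to powers |g_i|^s and |g_i|^(-s); those with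
    eps bound derivatives of D^w g_i / g_i by its square, which reaches order kappa by induction on
    the length of w. The powers lost add up to an exponent k independent of s and eps, so these can
    be chosen small afterwards. Derivatives of holomorphic functions have to be differentiable
    again; this rests on the Cauchy formula on a square, applied along complex lines. *)

(* The norm of a [normedModType (Cplx R)] takes its values in [Cplx R]; [rn] is
   the same number seen in [R]. *)
Definition rn (R : realType) (V : normedModType (Cplx R)) (v : V) : R :=
  complex.Re (`|v| : Cplx R).

(** * The norm as a real number, and epsilon-delta forms of limits *)

Section RealNorm.
Variable R : realType.
Notation C := (Cplx R).
Implicit Types V W : normedModType C.

Lemma norm_rn V (v : V) : `|v| = ((rn v)%:C)%C :> C.
Proof. by rewrite /rn RRe_real// ger0_real. Qed.

Lemma rn_ge0 V (v : V) : 0 <= rn v.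
Proof. by rewrite -lecR -norm_rn normr_ge0. Qed.

Lemma rn0 V : rn (0 : V) = 0.
Proof. by rewrite /rn normr0. Qed.

Lemma rn_eq0 V (v : V) : (rn v == 0) = (v == 0).
Proof. by rewrite -[v == 0]normr_eq0 norm_rn eq_complex /= eqxx andbT. Qed.

Lemma rn_gt0 V (v : V) : (0 < rn v) = (v != 0).
Proof. by rewrite lt_neqAle rn_ge0 andbT eq_sym rn_eq0. Qed.

Lemma rnD V (v w : V) : rn (v + w) <= rn v + rn w.
Proof. by rewrite -lecR rmorphD /= -!norm_rn ler_normD. Qed.

Lemma rnN V (v : V) : rn (- v) = rn v.
Proof. by rewrite /rn normrN. Qed.

Lemma rnB V (v w : V) : rn (v - w) <= rn v + rn w.
Proof. by rewrite -(rnN w) rnD. Qed.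

Lemma rn_distC V (v w : V) : rn (v - w) = rn (w - v).
Proof. by rewrite -rnN opprB. Qed.

Lemma rn_dist V (u v w : V) : rn (u - w) <= rn (u - v) + rn (v - w).
Proof. by rewrite (le_trans _ (rnD _ _))// addrA subrK. Qed.

Lemma rnZ V (a : C) (v : V) : rn (a *: v) = rn (a : C) * rn v.
Proof. by apply: complexI; rewrite rmorphM /= -!norm_rn normrZ. Qed.

Lemma rnM (a b : C) : rn (a * b) = rn a * rn b.
Proof. by apply: complexI; rewrite rmorphM /= -!norm_rn normrM. Qed.

Lemma rn1 : rn (1 : C) = 1.
Proof. by rewrite /rn normr1. Qed.

Lemma rnX (a : C) k : rn (a ^+ k) = rn a ^+ k.
Proof. by elim: k => [|k IH]; rewrite ?expr0 ?rn1// !exprS rnM IH. Qed.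

Lemma rnV (a : C) : rn (a^-1) = (rn a)^-1.
Proof. by apply: complexI; rewrite fmorphV /= -!norm_rn normfV. Qed.

Lemma rn_real (x : R) : rn (x%:C%C : C) = `|x|.
Proof. by rewrite /rn normc_def /= expr0n /= addr0 sqrtr_sqr. Qed.

Lemma rn_i : rn ('i%C : C) = 1.
Proof. by rewrite /rn normc_def /= expr0n /= add0r expr1n sqrtr1. Qed.

Lemma rn_nat k : rn (k%:R : C) = k%:R.
Proof. by rewrite -(rmorph_nat (real_complex R)) rn_real ger0_norm. Qed.

Lemma rn_sum V I (r : seq I) (P : pred I) (F : I -> V) :
  rn (\sum_(i <- r | P i) F i) <= \sum_(i <- r | P i) rn (F i).
Proof.
elim/big_ind2 : _ => [|x1 x2 y1 y2 h1 h2|//]; first by rewrite rn0.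
by rewrite (le_trans (rnD _ _))// lerD.
Qed.

Lemma rn_prod I (r : seq I) (P : pred I) (F : I -> C) :
  rn (\prod_(i <- r | P i) F i) = \prod_(i <- r | P i) rn (F i).
Proof. by apply: (big_morph _ rnM rn1). Qed.

Lemma rn_sqr (a : C) : rn a ^+ 2 = complex.Re a ^+ 2 + complex.Im a ^+ 2.
Proof. by rewrite /rn normc_def /= sqr_sqrtr// addr_ge0 ?sqr_ge0. Qed.

Lemma mulJ_rn (a : C) : a * (a^*)%C = ((rn a ^+ 2)%:C)%C.
Proof.
apply/eqP; rewrite rn_sqr; case: a => x y; rewrite eq_complex /=.
by apply/andP; split; apply/eqP; ring.
Qed.

Lemma rnJ (a : C) : rn ((a^*)%C : C) = rn a.
Proof.
apply/eqP; rewrite -(@eqrXn2 _ 2)// ?rn_ge0// !rn_sqr.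
by case: a => x y /=; rewrite sqrrN.
Qed.

Lemma rn_ge_Re (a : C) : `|complex.Re a| <= rn a.
Proof.
by rewrite -(@ler_pXn2r _ 2)// ?nnegrE ?rn_ge0// rn_sqr real_normK ?num_real// lerDl sqr_ge0.
Qed.

Lemma rn_ge_Im (a : C) : `|complex.Im a| <= rn a.
Proof.
by rewrite -(@ler_pXn2r _ 2)// ?nnegrE ?rn_ge0// rn_sqr real_normK ?num_real// lerDr sqr_ge0.
Qed.

Lemma rn_le_ReIm (a : C) : rn a <= `|complex.Re a| + `|complex.Im a|.
Proof.
rewrite {1}(complexE a) (le_trans (rnD _ _))// rnM rn_i mul1r.
by rewrite !rn_real.
Qed.

Lemma nbhs_rnP V (x : V) (P : set V) :
  nbhs x P <-> exists2 e : R, 0 < e & forall y, rn (y - x) < e -> P y.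
Proof.
split=> [/nbhs_ballP[e e0 xP]|[e e0 xP]].
  have er : e = ((complex.Re e)%:C)%C by rewrite RRe_real ?gtr0_real.
  exists (complex.Re e); first by rewrite -ltcR -er.
  move=> y xy; apply: xP; rewrite -ball_normE /ball_ /= er distrC norm_rn ltcR//.
apply/nbhs_ballP; exists (e%:C%C); first by rewrite /= ltcR.
by move=> y; rewrite -ball_normE /ball_ /= distrC norm_rn ltcR; exact: xP.
Qed.

Lemma cvg_rnP V W (f : V -> W) (x : V) (l : W) :
  f y @[y --> x] --> l <->
  forall e : R, 0 < e -> exists2 d : R, 0 < d &
    forall y, rn (y - x) < d -> rn (f y - l) < e.
Proof.
split=> [fx e e0|H].
  have : nbhs (f x' @[x' --> x]) [set y | rn (y - l) < e].
    by apply: fx; apply/nbhs_rnP; exists e.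
  by move/nbhs_rnP.
move=> P /nbhs_rnP[e e0 eP]; apply/nbhs_rnP.
by have [d d0 dH] := H _ e0; exists d => // y /dH /eP.
Qed.

Lemma continuous_rnP V W (f : V -> W) (x : V) :
  {for x, continuous f} <->
  forall e : R, 0 < e -> exists2 d : R, 0 < d &
    forall y, rn (y - x) < d -> rn (f y - f x) < e.
Proof. exact: cvg_rnP. Qed.

Lemma continuous_rn_real V (f : V -> R) (x : V) :
  {for x, continuous f} <->
  forall e : R, 0 < e -> exists2 d : R, 0 < d &
    forall y, rn (y - x) < d -> `|f y - f x| < e.
Proof.
split=> [fx e e0|H].
  have : nbhs (f x' @[x' --> x]) [set y | `|y - f x| < e].
    by apply: fx; apply/nbhs_ballP; exists e => // y; rewrite /ball /= distrC.
  by move/nbhs_rnP.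
move=> P /nbhs_ballP[e e0 eP]; apply/nbhs_rnP.
have [d d0 dH] := H _ e0; exists d => // y /dH h; apply: eP.
by rewrite /ball /= distrC.
Qed.

Lemma rn_continuous V : continuous (@rn R V).
Proof.
move=> x; apply/continuous_rn_real => e e0; exists e => // y /le_lt_trans; apply.
have := rn_dist x y 0; have := rn_dist y x 0; rewrite !subr0 (rn_distC x y) => h1 h2.
by rewrite ler_norml; apply/andP; split; lra.
Qed.

End RealNorm.

(** * Path integrals and the theorem of Goursat *)

Section RealPath.
Variable R : realType.
Notation C := (Cplx R).
Implicit Types F h : R -> C.

Lemma is_derive_eps (f : R -> R) (x l : R) :
  (forall e : R, 0 < e -> exists2 d : R, 0 < d &
    forall t, `|t| < d -> `|f (x + t) - f x - t * l| <= e * `|t|) ->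
  is_derive x 1 f l.
Proof.
move=> H.
have cv : (t^-1 *: (f (t *: 1 + x) - f x)) @[t --> 0^'] --> (l : R).
  apply/cvgrPdist_le => /= e e0; have [d d0 dH] := H _ e0.
  apply/nbhs_ballP; exists d => //= t; rewrite /ball /= sub0r normrN => td t0.
  have t0' : 0 < `|t| by rewrite normr_gt0.
  rewrite -(ler_pM2l t0') -normrM.
  rewrite [t *: 1]mulr1 [t + x]addrC -normrN -mulrN opprB.
  have -> : t * (t^-1 *: (f (x + t) - f x) - l) = f (x + t) - f x - t * l.
    by rewrite mulrBr [t * (_ *: _)]mulrA divff// mul1r.
  by rewrite [leRHS]mulrC dH.
have dx : derivable f x 1 by apply: cvgP cv.
by apply: DeriveDef => //; apply: cvg_lim cv.
Qed.

(** [Cplx R] is used as a normed space over itself only, so derivatives in a real parameter are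
    taken componentwise. *)
Definition rder F (x : R) (l : C) : Prop :=
  is_derive x 1 (fun t => complex.Re (F t)) (complex.Re l) /\
  is_derive x 1 (fun t => complex.Im (F t)) (complex.Im l).

Lemma rder_eps F (x : R) (l : C) :
  (forall e : R, 0 < e -> exists2 d : R, 0 < d &
    forall t : R, `|t| < d ->
      rn (F (x + t) - F x - t%:C%C * l) <= e * `|t|) -> rder F x l.
Proof.
move=> H; split; apply: is_derive_eps => e /H[d d0 dH]; exists d => // t /dH.
- move/(le_trans (rn_ge_Re _)).
  by move: (F (x + t)) (F x) l {dH H} => [a1 a2] [b1 b2] [l1 l2] /=; rewrite mul0r subr0.
- move/(le_trans (rn_ge_Im _)).
  by move: (F (x + t)) (F x) l {dH H} => [a1 a2] [b1 b2] [l1 l2] /=; rewrite mul0r addr0.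
Qed.

Lemma rderD F1 F2 x l1 l2 :
  rder F1 x l1 -> rder F2 x l2 -> rder (fun t => F1 t + F2 t) x (l1 + l2).
Proof.
move=> [a1 b1] [a2 b2]; split.
- have -> : (fun t => complex.Re (F1 t + F2 t)) =
    (fun t => complex.Re (F1 t)) + (fun t => complex.Re (F2 t)).
    by apply/funext => t /=; rewrite fctE; case: (F1 t) (F2 t) => [? ?] [].
  have -> : complex.Re (l1 + l2) = complex.Re l1 + complex.Re l2 by case: l1 l2 {a1 b1 a2 b2} => ? ? [].
  exact: is_deriveD.
- have -> : (fun t => complex.Im (F1 t + F2 t)) =
    (fun t => complex.Im (F1 t)) + (fun t => complex.Im (F2 t)).
    by apply/funext => t /=; rewrite fctE; case: (F1 t) (F2 t) => [? ?] [].
  have -> : complex.Im (l1 + l2) = complex.Im l1 + complex.Im l2 by case: l1 l2 {a1 b1 a2 b2} => ? ? [].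
  exact: is_deriveD.
Qed.

Lemma rderZ F x (l c : C) : rder F x l -> rder (fun t => c * F t) x (c * l).
Proof.
case: c => c1 c2 [a b]; split.
- have -> : (fun t => complex.Re ((c1 +i* c2)%C * F t)) =
    c1 *: (fun t => complex.Re (F t)) - c2 *: (fun t => complex.Im (F t)).
    by apply/funext => t /=; rewrite !fctE; case: (F t).
  have -> : complex.Re ((c1 +i* c2)%C * l) = c1 *: complex.Re l - c2 *: complex.Im l.
    by case: l {a b}.
  by apply: is_deriveB.
- have -> : (fun t => complex.Im ((c1 +i* c2)%C * F t)) =
    c1 *: (fun t => complex.Im (F t)) + c2 *: (fun t => complex.Re (F t)).
    by apply/funext => t /=; rewrite !fctE; case: (F t).
  have -> : complex.Im ((c1 +i* c2)%C * l) = c1 *: complex.Im l + c2 *: complex.Re l.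
    by case: l {a b}.
  by apply: is_deriveD.
Qed.

(** The mean value theorem is false for complex-valued paths. Multiplying by the unimodular [u] that
    turns the increment into its modulus reduces the inequality to the real part of [u * F]. *)
Lemma rder_mvt F h (a b M : R) : a <= b ->
  (forall x, a <= x <= b -> rder F x (h x)) ->
  (forall x, a <= x <= b -> rn (h x) <= M) ->
  rn (F b - F a) <= M * (b - a).
Proof.
rewrite le_eqVlt => /predU1P[<-|ab] Fh hM; first by rewrite !subrr rn0 mulr0.
have [->|D0] := eqVneq (F b - F a) 0.
  rewrite rn0; apply: mulr_ge0; last by rewrite subr_ge0 ltW.
  by apply: le_trans (rn_ge0 (h a)) (hM a _); rewrite lexx ltW.
pose D := F b - F a; pose u : C := (rn D)%:C%C^-1 * (D^*)%C.
have rD : 0 < rn D by rewrite rn_gt0.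
have uD : u * D = ((rn D)%:C)%C.
  rewrite /u -mulrA [(D^*)%C * _]mulrC mulJ_rn expr2 rmorphM mulrA mulVf ?mul1r//.
  by rewrite eq_complex /= eqxx andbT gt_eqF.
have ru : rn u = 1.
  have := congr1 (@rn _ _) uD; rewrite rnM rn_real ger0_norm ?ltW// => /eqP.
  by rewrite -subr_eq0 -{2}[rn D]mul1r -mulrBl mulf_eq0 (gt_eqF rD) orbF subr_eq0 => /eqP.
pose G t := complex.Re (u * F t); pose g t := complex.Re (u * h t).
have Gg x : a <= x <= b -> is_derive x 1 G (g x).
  by move=> xab; have [] := rderZ u (Fh _ xab).
have [c cab cE] : exists2 c, c \in `[a, b]%R & G b - G a = g c * (b - a).
  have Gg' x : x \in `]a, b[%R -> is_derive x 1 G (g x).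
    by rewrite in_itv /= => /andP[x1 x2]; apply: Gg; rewrite !ltW.
  apply: (MVT_segment (ltW ab)) => //.
  apply: derivable_within_continuous => x; rewrite in_itv /= => xab.
  by have [] := Gg x xab.
have -> : rn (F b - F a) = G b - G a.
  have -> : G b - G a = complex.Re (u * D).
    rewrite /G /D; case: (F b) (F a) u {uD ru G g Gg cE} => ? ? [? ?] [? ?] /=; ring.
  by rewrite uD.
rewrite cE ler_wpM2r ?subr_ge0 ?(ltW ab)//.
rewrite in_itv /= in cab.
apply: le_trans (hM c cab); apply: le_trans (ler_norm _) _.
by apply: le_trans (rn_ge_Re _) _; rewrite rnM ru mul1r.
Qed.

(** Integrability holds on the compact segment from -10 to 10, and the fundamental theorem of
    calculus applies in its interior; this is the origin of the fixed window. *)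
Lemma antideriv_exists (h : R -> R) : continuous h ->
  exists F : R -> R, forall x : R, -10 < x < 10 -> is_derive x 1 F (h x).
Proof.
move=> hc; pose F x := (\int[@lebesgue_measure R]_(t in [set` `[(-10)%R, x]]) h t)%R.
exists F => x /andP[x1 x2].
have hi : (@lebesgue_measure R).-integrable `[(-10)%R, 10%R] (EFin \o h).
  apply: continuous_compact_integrable; first exact: segment_compact.
  exact: continuous_subspaceT.
have [dF FE] := continuous_FTC1_closed x2 hi x1 (hc x).
by apply: (DeriveDef dF); rewrite -derive1E.
Qed.

End RealPath.

Section Goursat.
Variable R : realType.
Notation C := (Cplx R).
Implicit Types (F h : R -> C) (phi : C -> C).

Definition rcont h : Prop :=
  continuous (fun t => complex.Re (h t)) /\ continuous (fun t => complex.Im (h t)).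

(* Path integrals are differences of a chosen antiderivative on ]-10, 10[ ([0] if
   there is none); all rectangles below lie in this window. *)
Definition antid h : R -> C :=
  if pselect (exists F, forall x : R, -10 < x < 10 -> rder F x (h x)) is left e
  then projT1 (cid e) else fun=> 0.

Definition seg h (a b : R) : C := antid h b - antid h a.

Lemma antidP h (x : R) : rcont h -> -10 < x < 10 -> rder (antid h) x (h x).
Proof.
move=> [c1 c2]; rewrite /antid; case: pselect => [e|]; first exact: (projT2 (cid e)).
have [F1 F1h] := antideriv_exists c1; have [F2 F2h] := antideriv_exists c2.
case; exists (fun t => (F1 t +i* F2 t)%C) => t tI.
by split; [exact: F1h|exact: F2h].
Qed.

Lemma rder_const F (a b : R) : a <= b ->
  (forall x, a <= x <= b -> rder F x 0) -> F b = F a.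
Proof.
move=> ab F0; apply/eqP; rewrite -subr_eq0 -rn_eq0 eq_le rn_ge0 andbT.
rewrite -[leRHS](mul0r (b - a)) (@rder_mvt _ F (fun=> 0))// => x _.
by rewrite rn0.
Qed.

(** Frees [seg] from the choice made in [antid]: two antiderivatives differ by a constant on the
    segment. *)
Lemma segE h F (a b : R) : rcont h -> -10 < a -> a <= b -> b < 10 ->
  (forall x, a <= x <= b -> rder F x (h x)) -> seg h a b = F b - F a.
Proof.
move=> hc a1 ab b1 Fh.
have H : antid h b + (-1) * F b = antid h a + (-1) * F a.
  apply: (rder_const (F := fun t => antid h t + (-1) * F t)) => // x /andP[x1 x2].
  have -> : (0 : C) = h x + (-1) * h x by ring.
  apply: rderD; last by apply: rderZ; apply: Fh; rewrite x1.
  by apply: antidP => //; rewrite (lt_le_trans a1 x1) (le_lt_trans x2 b1).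
by rewrite /seg -[antid h b](addrK ((-1) * F b)) H; ring.
Qed.

Lemma seg_bound h (a b M : R) : rcont h -> -10 < a -> a <= b -> b < 10 ->
  (forall x, a <= x <= b -> rn (h x) <= M) -> rn (seg h a b) <= M * (b - a).
Proof.
move=> hc a1 ab b1 hM; apply: (rder_mvt (h := h)) => // x /andP[x1 x2].
by apply: antidP => //; rewrite (lt_le_trans a1 x1) (le_lt_trans x2 b1).
Qed.

Lemma rcontD h1 h2 : rcont h1 -> rcont h2 -> rcont (fun t => h1 t + h2 t).
Proof.
move=> [a1 b1] [a2 b2]; split => x.
- rewrite (_ : (fun t => _) = fun t => complex.Re (h1 t) + complex.Re (h2 t)).
    by apply: cvgD; [exact: a1|exact: a2].
  by apply/funext => t; case: (h1 t) (h2 t) => [? ?] [].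
- rewrite (_ : (fun t => _) = fun t => complex.Im (h1 t) + complex.Im (h2 t)).
    by apply: cvgD; [exact: b1|exact: b2].
  by apply/funext => t; case: (h1 t) (h2 t) => [? ?] [].
Qed.

Lemma rcontM h1 h2 : rcont h1 -> rcont h2 -> rcont (fun t => h1 t * h2 t).
Proof.
move=> [a1 b1] [a2 b2]; split => x.
- rewrite (_ : (fun t => _) = fun t => complex.Re (h1 t) * complex.Re (h2 t)
     - complex.Im (h1 t) * complex.Im (h2 t)).
    by apply: cvgB; apply: cvgM; [exact: a1|exact: a2|exact: b1|exact: b2].
  by apply/funext => t; case: (h1 t) (h2 t) => [? ?] [].
- rewrite (_ : (fun t => _) = fun t => complex.Re (h1 t) * complex.Im (h2 t)
     + complex.Im (h1 t) * complex.Re (h2 t)).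
    by apply: cvgD; apply: cvgM; [exact: a1|exact: b2|exact: b1|exact: a2].
  by apply/funext => t; case: (h1 t) (h2 t) => [? ?] [].
Qed.

Lemma rcont_cst (c : C) : rcont (fun=> c).
Proof. by split=> x; exact: cst_continuous. Qed.

Lemma seg_lin h1 h2 (c : C) (a b : R) : rcont h1 -> rcont h2 ->
  -10 < a -> a <= b -> b < 10 ->
  seg (fun t => h1 t + c * h2 t) a b = seg h1 a b + c * seg h2 a b.
Proof.
move=> c1 c2 a1 ab b1.
rewrite (@segE _ (fun t => antid h1 t + c * antid h2 t)) //; first by rewrite /seg; ring.
  by apply: rcontD => //; apply: rcontM => //; exact: rcont_cst.
move=> x /andP[x1 x2].
have xI : -10 < x < 10 by rewrite (lt_le_trans a1 x1) (le_lt_trans x2 b1).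
by apply: rderD; [|apply: rderZ]; exact: antidP.
Qed.

Lemma seg_eq h1 h2 (a b : R) : rcont h1 -> rcont h2 ->
  -10 < a -> a <= b -> b < 10 -> (forall x, a <= x <= b -> h1 x = h2 x) ->
  seg h1 a b = seg h2 a b.
Proof.
move=> c1 c2 a1 ab b1 h12; apply: segE => // x /[dup] xI /andP[x1 x2].
rewrite h12//; apply: antidP => //.
by rewrite (lt_le_trans a1 x1) (le_lt_trans x2 b1).
Qed.

Definition cder phi (z l : C) : Prop :=
  forall e : R, 0 < e -> exists2 d : R, 0 < d & forall t : C, rn t < d ->
    rn (phi (z + t) - phi z - l * t) <= e * rn t.

Lemma cder_path phi (z v l : C) (x : R) : cder phi (z + x%:C%C * v) l ->
  rder (fun t => phi (z + t%:C%C * v)) x (v * l).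
Proof.
move=> H; apply: rder_eps => e e0.
(* The added 1 avoids a division by zero when [v = 0]; the same device recurs below. *)
have v1 : 0 < rn v + 1 by rewrite ltr_wpDl// rn_ge0.
have [d d0 dH] := H (e / (rn v + 1)) (divr_gt0 e0 v1).
exists (d / (rn v + 1)); first exact: divr_gt0.
move=> t td; have := dH (t%:C%C * v).
rewrite rnM rn_real => H1.
have td' : `|t| * rn v < d.
  apply: le_lt_trans (_ : `|t| * (rn v + 1) < d); last by rewrite -ltr_pdivlMr.
  by rewrite ler_wpM2l// lerDl.
have -> : z + ((x + t)%:C)%C * v = z + x%:C%C * v + t%:C%C * v :> C.
  by rewrite rmorphD /=; ring.
rewrite [t%:C%C * (v * l)]mulrCA mulrA [_ * l]mulrC [v * _]mulrC.
apply: le_trans (H1 td') _.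
have -> : e / (rn v + 1) * (`|t| * rn v) = e * `|t| * (rn v / (rn v + 1)) by ring.
by rewrite ler_piMr ?mulr_ge0// ?(ltW e0)// ler_pdivrMr// mul1r lerDl.
Qed.

Definition pt (x y : R) : C := (x +i* y)%C.

(** The integral over the boundary of a rectangle, counterclockwise; the factor i is dz = i dy on
    the vertical sides. *)
Definition rint phi (a b c d : R) : C :=
  seg (fun x => phi (pt x c)) a b + 'i%C * seg (fun y => phi (pt b y)) c d
  - seg (fun x => phi (pt x d)) a b - 'i%C * seg (fun y => phi (pt a y)) c d.

(** Continuity is asked only on the four lines that carry the sides, so that kernels with a pole
    inside the rectangle qualify. *)
Definition linecont phi (a b c d : R) :=
  [/\ rcont (fun x => phi (pt x c)), rcont (fun y => phi (pt b y)),
      rcont (fun x => phi (pt x d)) & rcont (fun y => phi (pt a y))].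

Lemma ptxE (x y : R) : pt x y = pt 0 y + x%:C%C * 1.
Proof. by apply/eqP; rewrite eq_complex /=; apply/andP; split; apply/eqP; ring. Qed.

Lemma ptyE (x y : R) : pt x y = pt x 0 + y%:C%C * 'i%C.
Proof. by apply/eqP; rewrite eq_complex /=; apply/andP; split; apply/eqP; ring. Qed.

(** The four increments of the primitive cancel at the corners. A primitive along the sides is
    enough, which covers the square of the Cauchy kernel in [oint_ker2]. *)
Lemma rint_prim phi Phi (a b c d : R) : -10 < a -> a <= b -> b < 10 ->
  -10 < c -> c <= d -> d < 10 -> linecont phi a b c d ->
  (forall x y, a <= x <= b -> c <= y <= d -> (x = a \/ x = b \/ y = c \/ y = d) ->
     cder Phi (pt x y) (phi (pt x y))) ->
  rint phi a b c d = 0.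
Proof.
move=> a1 ab b1 c1 cd d1 [r1 r2 r3 r4] H; rewrite /rint.
have hz y : rcont (fun x => phi (pt x y)) -> c <= y <= d -> (y = c \/ y = d) ->
    seg (fun x => phi (pt x y)) a b = Phi (pt b y) - Phi (pt a y).
  move=> rc cyd ycd; apply: (@segE _ (fun x => Phi (pt x y))) => // x xI.
  have -> : (fun t => Phi (pt t y)) = (fun t => Phi (pt 0 y + t%:C%C * 1)).
    by apply/funext => t; rewrite -ptxE.
  rewrite -[phi _]mul1r; apply: cder_path; rewrite -ptxE; apply: H => //.
  by right; right.
have vt x : rcont (fun y => phi (pt x y)) -> a <= x <= b -> (x = a \/ x = b) ->
    'i%C * seg (fun y => phi (pt x y)) c d = Phi (pt x d) - Phi (pt x c).
  move=> rc axb xab.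
  rewrite (@segE _ (fun y => - 'i%C * Phi (pt x y)))//.
    transitivity (- ('i%C ^+ 2) * (Phi (pt x d) - Phi (pt x c)) : C); first by ring.
    by rewrite sqr_i; ring.
  move=> y yI.
  have -> : phi (pt x y) = - 'i%C * ('i%C * phi (pt x y)).
    rewrite mulrA mulNr; transitivity (- ('i%C ^+ 2) * phi (pt x y) : C); last by ring.
    by rewrite sqr_i; ring.
  apply: rderZ.
  have -> : (fun t => Phi (pt x t)) = (fun t => Phi (pt x 0 + t%:C%C * 'i%C)).
    by apply/funext => t; rewrite -ptyE.
  apply: cder_path; rewrite -ptyE; apply: H => //.
  by case: xab; [left|right; left].
have cc : c <= c <= d by rewrite lexx.
have dd : c <= d <= d by rewrite lexx cd.
have aa : a <= a <= b by rewrite lexx.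
have bb : a <= b <= b by rewrite lexx ab.
rewrite (hz c r1 cc (or_introl erefl)) (hz d r3 dd (or_intror erefl)).
rewrite (vt b r2 bb (or_intror erefl)) (vt a r4 aa (or_introl erefl)).
by ring.
Qed.

Lemma rint_bound phi (a b c d M : R) : -10 < a -> a <= b -> b < 10 ->
  -10 < c -> c <= d -> d < 10 -> linecont phi a b c d ->
  (forall x y, a <= x <= b -> c <= y <= d -> (x = a \/ x = b \/ y = c \/ y = d) ->
     rn (phi (pt x y)) <= M) ->
  rn (rint phi a b c d) <= 2 * M * ((b - a) + (d - c)).
Proof.
move=> a1 ab b1 c1 cd d1 [r1 r2 r3 r4] H; rewrite /rint.
have h1 : rn (seg (fun x => phi (pt x c)) a b) <= M * (b - a).
  by apply: seg_bound => // x xI; apply: H; rewrite ?lexx ?cd//; right; right; left.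
have h2 : rn (seg (fun y => phi (pt b y)) c d) <= M * (d - c).
  by apply: seg_bound => // y yI; apply: H; rewrite ?lexx ?ab//; right; left.
have h3 : rn (seg (fun x => phi (pt x d)) a b) <= M * (b - a).
  by apply: seg_bound => // x xI; apply: H; rewrite ?lexx ?cd//; right; right; right.
have h4 : rn (seg (fun y => phi (pt a y)) c d) <= M * (d - c).
  by apply: seg_bound => // y yI; apply: H; rewrite ?lexx ?ab//; left.
have t1 := rnB (seg (fun x => phi (pt x c)) a b + 'i%C * seg (fun y => phi (pt b y)) c d
  - seg (fun x => phi (pt x d)) a b) ('i%C * seg (fun y => phi (pt a y)) c d).
have t2 := rnB (seg (fun x => phi (pt x c)) a b + 'i%C * seg (fun y => phi (pt b y)) c d)
  (seg (fun x => phi (pt x d)) a b).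
have t3 := rnD (seg (fun x => phi (pt x c)) a b) ('i%C * seg (fun y => phi (pt b y)) c d).
rewrite !rnM rn_i !mul1r in t1 t2 t3.
lra.
Qed.

End Goursat.

Section GoursatTheorem.
Variable R : realType.
Notation C := (Cplx R).
Implicit Types (phi : C -> C).

Lemma rcont_path phi (z v : C) :
  (forall x : R, {for z + x%:C%C * v, continuous phi}) ->
  rcont (fun x => phi (z + x%:C%C * v)).
Proof.
move=> H.
have key x e : 0 < e -> exists2 d : R, 0 < d & forall t : R, `|t - x| < d ->
    rn (phi (z + t%:C%C * v) - phi (z + x%:C%C * v)) < e.
  move=> e0; have [d d0 dH] := (continuous_rnP _ _).1 (H x) e e0.
  have v1 : 0 < rn v + 1 by rewrite ltr_wpDl// rn_ge0.
  exists (d / (rn v + 1)); first exact: divr_gt0.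
  move=> t td; apply: dH.
  have -> : z + t%:C%C * v - (z + x%:C%C * v) = (t - x)%:C%C * v :> C.
    by rewrite rmorphB /=; ring.
  rewrite rnM rn_real.
  apply: le_lt_trans (_ : `|t - x| * (rn v + 1) < d); last by rewrite -ltr_pdivlMr.
  by rewrite ler_wpM2l// lerDl.
split=> x; apply/cvgrPdist_lt => e e0; have [d d0 dH] := key x e e0;
  apply/nbhs_ballP; exists d => //= t; rewrite /ball /= distrC => /dH;
  apply: le_lt_trans; rewrite rn_distC.
- by apply: le_trans (rn_ge_Re _); case: (phi _) (phi _) => [? ?] [? ?].
- by apply: le_trans (rn_ge_Im _); case: (phi _) (phi _) => [? ?] [? ?].
Qed.

Lemma rcont_ptx phi (y : R) : (forall x, {for pt x y, continuous phi}) ->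
  rcont (fun x => phi (pt x y)).
Proof.
move=> H; have -> : (fun x => phi (pt x y)) = fun x => phi (pt 0 y + x%:C%C * 1).
  by apply/funext => x; rewrite -ptxE.
by apply: rcont_path => x; rewrite -ptxE.
Qed.

Lemma rcont_pty phi (x : R) : (forall y, {for pt x y, continuous phi}) ->
  rcont (fun y => phi (pt x y)).
Proof.
move=> H; have -> : (fun y => phi (pt x y)) = fun y => phi (pt x 0 + y%:C%C * 'i%C).
  by apply/funext => y; rewrite -ptyE.
by apply: rcont_path => y; rewrite -ptyE.
Qed.

Lemma continuous_linecont phi (a b c d : R) : continuous phi -> linecont phi a b c d.
Proof. by move=> H; split; do ?[apply: rcont_ptx|apply: rcont_pty] => ?; exact: H. Qed.

Lemma rint_lin phi1 phi2 (k : C) (a b c d : R) :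
  linecont phi1 a b c d -> linecont phi2 a b c d ->
  -10 < a -> a <= b -> b < 10 -> -10 < c -> c <= d -> d < 10 ->
  rint (fun z => phi1 z + k * phi2 z) a b c d =
  rint phi1 a b c d + k * rint phi2 a b c d.
Proof.
by move=> [? ? ? ?] [? ? ? ?] *; rewrite /rint !seg_lin//; ring.
Qed.

Lemma rint_splitx phi (m a b c d : R) :
  rint phi a b c d = rint phi a m c d + rint phi m b c d.
Proof. by rewrite /rint /seg; ring. Qed.

Lemma rint_splity phi (m a b c d : R) :
  rint phi a b c d = rint phi a b c m + rint phi a b m d.
Proof. by rewrite /rint /seg; ring. Qed.

Lemma cder_quad (k l z : C) : cder (fun w => k * w + l * w ^+ 2) z (k + 2 * l * z).
Proof.
move=> e e0.
have l1 : 0 < rn l + 1 by rewrite ltr_wpDl// rn_ge0.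
exists (e / (rn l + 1)); first exact: divr_gt0.
move=> t td; have -> : k * (z + t) + l * (z + t) ^+ 2 - (k * z + l * z ^+ 2) -
   (k + 2 * l * z) * t = (l * t) * t by ring.
rewrite !rnM ler_wpM2r ?rn_ge0//.
move: td; rewrite ltr_pdivlMr// => /ltW; apply: le_trans.
by rewrite mulrC ler_wpM2l ?rn_ge0// lerDl.
Qed.

Lemma affine_continuous (k l : C) : continuous (fun z : C => k + l * z).
Proof.
move=> z; apply/continuous_rnP => e e0.
have l1 : 0 < rn l + 1 by rewrite ltr_wpDl// rn_ge0.
exists (e / (rn l + 1)) => [|y]; first exact: divr_gt0.
have -> : k + l * y - (k + l * z) = l * (y - z) by ring.
rewrite ltr_pdivlMr// rnM; apply: le_lt_trans.
by rewrite mulrC ler_wpM2l ?rn_ge0// lerDl.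
Qed.

Lemma rint_affine (k l : C) (a b c d : R) :
  -10 < a -> a <= b -> b < 10 -> -10 < c -> c <= d -> d < 10 ->
  rint (fun z => k + l * z) a b c d = 0.
Proof.
move=> *; apply: (@rint_prim _ _ (fun z => k * z + l / 2 * z ^+ 2)) => //.
  exact/continuous_linecont/affine_continuous.
move=> x y _ _ _; have := cder_quad k (l / 2) (pt x y).
have -> // : k + 2 * (l / 2) * pt x y = k + l * pt x y.
by congr (_ + _ * _); field.
Qed.

Lemma nested_point (u v : nat -> R) :
  (forall k, u k <= u k.+1) -> (forall k, v k.+1 <= v k) -> (forall k, u k <= v k) ->
  exists x, forall k, u k <= x <= v k.
Proof.
move=> hu hv huv.
have um : nondecreasing_seq u by apply/nondecreasing_seqP.
have vm : nonincreasing_seq v by apply/nonincreasing_seqP.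
have uv i j : u i <= v j.
  apply: le_trans (um i (maxn i j) (leq_maxl _ _)) _.
  by apply: le_trans (huv _) (vm _ _ (leq_maxr _ _)).
exists (sup (range u)) => k; apply/andP; split.
  by apply: ub_le_sup; [exists (v 0%N) => _ [i _ <-]|exists k].
by apply: sup_le_ub; [exists (u 0%N); exists 0%N|move=> _ [i _ <-]].
Qed.

(** The affine approximation at the point has a primitive and integrates to 0. The remainder is at
    most a small multiple of the half perimeter, and one more factor of this size comes from the
    length of the path. *)
Lemma goursat_local phi (x y : R) (l : C) : continuous phi -> cder phi (pt x y) l ->
  forall e, 0 < e -> exists2 r : R, 0 < r & forall a b c d : R,
    -10 < a -> a <= x <= b -> b < 10 -> -10 < c -> c <= y <= d -> d < 10 ->
    (b - a) + (d - c) < r ->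
    rn (rint phi a b c d) <= e * ((b - a) + (d - c)) ^+ 2.
Proof.
move=> phic H e e0; have [r r0 rH] := H (e / 2) (divr_gt0 e0 (ltr0n _ 2)).
exists r => // a b c d a1 /andP[ax xb] b1 c1 /andP[cy yd] d1 abcd.
have ab := le_trans ax xb; have cd := le_trans cy yd.
pose k := phi (pt x y) - l * pt x y.
pose rho z := phi z + (-1) * (k + l * z).
have affc : continuous (fun z : C => k + l * z) by exact: affine_continuous.
have rhoc : continuous rho.
  have -> : rho = phi - (fun z => k + l * z).
    by apply/funext => z; rewrite /rho mulN1r.
  by move=> z; apply: continuousB; [exact: phic|exact: affc].
have -> : rint phi a b c d = rint rho a b c d.
  have -> : rint rho a b c d = rint phi a b c d + (-1) * rint (fun z => k + l * z) a b c d.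
    exact: (@rint_lin phi (fun z => k + l * z) (-1) a b c d
      (continuous_linecont a b c d phic) (continuous_linecont a b c d affc) a1 ab b1 c1 cd d1).
  by rewrite rint_affine// mulr0 addr0.
have -> : e * (b - a + (d - c)) ^+ 2 =
   2 * (e / 2 * (b - a + (d - c))) * (b - a + (d - c)) by field.
apply: rint_bound => //; first exact: continuous_linecont.
move=> u v /andP[au ub] /andP[cv vd] _.
pose t : C := pt u v - pt x y.
have tle : rn t <= b - a + (d - c).
  apply: le_trans (rn_le_ReIm _) _; rewrite /t /=.
  by apply: lerD; rewrite ler_norml; apply/andP; split; lra.
have -> : rho (pt u v) = phi (pt x y + t) - phi (pt x y) - l * t.
  by rewrite /rho /k /t addrC [pt x y + _]addrC subrK; ring.
apply: le_trans (rH _ (le_lt_trans tle abcd)) _.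
by rewrite ler_wpM2l// divr_ge0 ?(ltW e0).
Qed.

Definition rect_halves (q q' : R * R * R * R) :=
  let: (a, b, c, d) := q in let: (a', b', c', d') := q' in
  [/\ a <= a', b' <= b, c <= c', d' <= d &
      b' - a' = (b - a) / 2 /\ d' - c' = (d - c) / 2].

(** The integrals over the four quarters add up to the whole, so one of them carries at least a
    quarter of its modulus. *)
Lemma rint_halve phi (q : R * R * R * R) :
  let: (a, b, c, d) := q in a <= b -> c <= d ->
  exists q' : R * R * R * R, rect_halves q q' /\
    let: (a', b', c', d') := q' in
    rn (rint phi a b c d) <= 4 * rn (rint phi a' b' c' d').
Proof.
case: q => [[[a b] c] d] ab cd.
pose m := (a + b) / 2; pose k := (c + d) / 2.
have E : rint phi a b c d = rint phi a m c k + rint phi a m k d +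
   (rint phi m b c k + rint phi m b k d).
  by rewrite (rint_splitx _ m) (rint_splity _ k) [rint phi m b c d](rint_splity _ k).
have T : rn (rint phi a b c d) <= rn (rint phi a m c k) + rn (rint phi a m k d) +
   (rn (rint phi m b c k) + rn (rint phi m b k d)).
  by rewrite E; apply: le_trans (rnD _ _) _; apply: lerD; exact: rnD.
have [h1|h1] := leP (rn (rint phi a b c d)) (4 * rn (rint phi a m c k)).
  by exists (a, m, c, k); split => //; split; rewrite /m /k; do ?split; lra.
have [h2|h2] := leP (rn (rint phi a b c d)) (4 * rn (rint phi a m k d)).
  by exists (a, m, k, d); split => //; split; rewrite /m /k; do ?split; lra.
have [h3|h3] := leP (rn (rint phi a b c d)) (4 * rn (rint phi m b c k)).
  by exists (m, b, c, k); split => //; split; rewrite /m /k; do ?split; lra.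
exists (m, b, k, d); split; first by split; rewrite /m /k; do ?split; lra.
lra.
Qed.

(** Nested quarters have half perimeter [P / 2 ^+ k] and integrals of modulus at least 4^(-k) times
    the whole, whereas [goursat_local] at their common point makes the latter o(4^(-k)). *)
Theorem goursat phi (a b c d : R) : continuous phi ->
  -10 < a -> a <= b -> b < 10 -> -10 < c -> c <= d -> d < 10 ->
  (forall x y, a <= x <= b -> c <= y <= d -> exists l, cder phi (pt x y) l) ->
  rint phi a b c d = 0.
Proof.
move=> phic a1 ab b1 c1 cd d1 H; apply/eqP; apply: contraT => I0.
pose good (q : R * R * R * R) := let: (a, b, c, d) := q in a <= b /\ c <= d.
pose I (q : R * R * R * R) := let: (a, b, c, d) := q in rn (rint phi a b c d).
have /choice[f fH] : forall q, exists q', good q ->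
   [/\ good q', rect_halves q q' & I q <= 4 * I q'].
  case=> [[[u v] w] t]; have [[uv wt]|ng] := pselect (u <= v /\ w <= t); last first.
    by exists (0, 0, 0, 0).
  have [[[[u' v'] w'] t'] [[h1 h2 h3 h4 [h5 h6]] h7]] := rint_halve phi (u,v,w,t) uv wt.
  by exists (u', v', w', t'); split => //; split; lra.
pose s k := iter k f (a, b, c, d).
have gs k : good (s k) by elim: k => [//|k /fH[]].
have sS k : rect_halves (s k) (s k.+1) by have [] := fH _ (gs k).
have IS k : rn (rint phi a b c d) <= 4 ^+ k * I (s k).
  elim: k => [|k IH]; first by rewrite expr0 mul1r.
  apply: le_trans IH _; rewrite exprSr -mulrA ler_wpM2l ?exprn_ge0//.
  by have [] := fH _ (gs k).
pose A k := (s k).1.1.1; pose B k := (s k).1.1.2; pose D k := (s k).1.2; pose E k := (s k).2.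
have sE k : s k = (A k, B k, D k, E k) by rewrite /A /B /D /E; case: (s k) => [[[]]].
have [Am Bm Dm Em wd] : [/\ forall k, A k <= A k.+1, forall k, B k.+1 <= B k,
    forall k, D k <= D k.+1, forall k, E k.+1 <= E k &
    forall k, B k.+1 - A k.+1 = (B k - A k) / 2 /\ E k.+1 - D k.+1 = (E k - D k) / 2].
  by split=> k; have := sS k; rewrite (sE k) (sE k.+1) => -[].
have [AB DE] : (forall k, A k <= B k) /\ (forall k, D k <= E k).
  by split=> k; have := gs k; rewrite (sE k) => -[].
have [x xAB] := nested_point Am Bm AB; have [y yDE] := nested_point Dm Em DE.
have [l lH] := H x y (xAB 0%N) (yDE 0%N).
have wE k : B k - A k + (E k - D k) = (b - a + (d - c)) / 2 ^+ k.
  elim: k => [|k IH]; first by rewrite expr0 divr1.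
  have [-> ->] := wd k; rewrite exprSr invfM mulrA -IH; ring.
have in0 k : [/\ a <= A k, B k <= b, c <= D k & E k <= d].
  elim: k => [|k [h1 h2 h3 h4]]; first by split.
  split; [exact: le_trans (Am k)|exact: le_trans (Bm k) _|exact: le_trans (Dm k)|
    exact: le_trans (Em k) _].
pose P := b - a + (d - c).
have P0 : 0 <= P by rewrite /P; lra.
have I0' : 0 < rn (rint phi a b c d) by rewrite rn_gt0.
(* Chosen so that [e * P ^+ 2] is at most half of the integral; the 1 covers [P = 0]. *)
pose e := rn (rint phi a b c d) / (2 * (P ^+ 2 + 1)).
have P1 : 0 < P ^+ 2 + 1 by rewrite ltr_wpDl// sqr_ge0.
have e0 : 0 < e by rewrite divr_gt0// mulr_gt0.
have [r r0 rH] := goursat_local phic lH e0.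
have [k kr] : exists k, P / 2 ^+ k < r.
  exists (Num.bound (P / r)); rewrite ltr_pdivrMr ?exprn_gt0// mulrC -ltr_pdivrMr//.
  apply: lt_trans (archi_boundP (divr_ge0 P0 (ltW r0))) _.
  by rewrite -natrX ltr_nat ltn_expl.
have [h1 h2 h3 h4] := in0 k.
have := IS k; rewrite sE /I.
have := rH (A k) (B k) (D k) (E k) (lt_le_trans a1 h1) (xAB k) (le_lt_trans h2 b1)
  (lt_le_trans c1 h3) (yDE k) (le_lt_trans h4 d1).
rewrite wE => /(_ kr) i1 i2.
have p4 : (0 : R) < 4 ^+ k by rewrite exprn_gt0.
have i3 : rn (rint phi a b c d) <= e * P ^+ 2.
  apply: le_trans i2 _; rewrite -ler_pdivlMl//; apply: le_trans i1 _.
  rewrite -/P expr_div_n -exprM mulnC exprM (_ : 2 ^+ 2 = 4 :> R); last by ring.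
  by rewrite [leRHS]mulrC mulrA.
have i4 : e * P ^+ 2 <= rn (rint phi a b c d) / 2.
  rewrite /e; set q := P ^+ 2 in P1 *.
  have -> : rn (rint phi a b c d) / (2 * (q + 1)) * q =
     rn (rint phi a b c d) / 2 * (q / (q + 1)).
    by field; rewrite gt_eqF.
  by rewrite ler_piMr ?divr_ge0 ?(ltW I0')// ler_pdivrMr// mul1r lerDl.
by have := le_trans i3 i4; lra.
Qed.

End GoursatTheorem.

(** * The Cauchy formula on a square *)

Section GoursatPunctured.
Variable R : realType.
Notation C := (Cplx R).
Implicit Types (phi : C -> C).

Lemma is_derive_cder (V : normedModType C) (f : V -> C) (y v : V) (l : C) :
  is_derive y v f l <-> cder (fun t : C => f (t *: v + y)) 0 l.
Proof.
have E (t : C) : t != 0 -> t^-1 *: (f (t *: v + y) - f y) - l =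
   t^-1 * (f ((0 + t) *: v + y) - f (0 *: v + y) - l * t).
  by move=> t0; rewrite !add0r scale0r add0r mulrBr [l * t]mulrC mulKf.
have eqv : (t^-1 *: (f (t *: v + y) - f y) @[t --> (0 : C)^'] --> l) <->
   cder (fun t : C => f (t *: v + y)) 0 l.
  split=> [H e e0|H P /nbhs_rnP[e e0 eP]].
    have : nbhs (t^-1 *: (f (t *: v + y) - f y) @[t --> (0 : C)^']) [set z | rn (z - l) < e].
      by apply: H; apply/nbhs_rnP; exists e.
    move=> /nbhs_rnP[d d0 dH]; exists d => // t td.
    have [->|t0] := eqVneq t 0.
      by rewrite add0r subrr mulr0 subr0 rn0 mulr0.
    have := dH t; rewrite subr0 => /(_ td t0) /=; rewrite (E _ t0) rnM rnV.
    have t0' : 0 < rn t by rewrite rn_gt0.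
    by rewrite ltr_pdivrMl// => /ltW; rewrite [leRHS]mulrC.
  have e20 : 0 < e / 2 by rewrite divr_gt0.
  have [d d0 dH] := H _ e20.
  apply/nbhs_rnP; exists d => // t; rewrite subr0 => td t0.
  have t0' : 0 < rn t by rewrite rn_gt0.
  apply: eP; rewrite E// rnM rnV ltr_pdivrMl//.
  apply: le_lt_trans (dH _ td) _; rewrite [ltLHS]mulrC ltr_pM2l//; lra.
rewrite -eqv; split=> [[dx <-]|H]; first exact: dx.
have dx : derivable f y v by apply: cvgP H.
by apply: DeriveDef => //; apply: cvg_lim H.
Qed.

Lemma cder_shift phi (z l : C) : cder (fun t => phi (t *: 1 + z)) 0 l <-> cder phi z l.
Proof.
have E (t : C) : phi ((0 + t) *: 1 + z) = phi (z + t).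
  by rewrite add0r [t *: 1]mulr1 addrC.
by split=> H e /H[d d0 dH]; exists d => // t /dH; rewrite E scale0r add0r.
Qed.

Lemma cderP phi (z l : C) : cder phi z l <-> is_derive z 1 phi l.
Proof. by rewrite is_derive_cder cder_shift. Qed.

Lemma cder_local phi psi (z l : C) (r : R) : 0 < r ->
  (forall t, rn (t - z) < r -> phi t = psi t) -> cder phi z l -> cder psi z l.
Proof.
move=> r0 E H e /H[d d0 dH]; exists (Num.min d r); first by rewrite lt_min d0.
move=> t; rewrite lt_min => /andP[td tr]; rewrite -!E ?subrr ?rn0//; first exact: dH.
by rewrite addrAC subrr add0r.
Qed.

Lemma cder_continuous phi (z l : C) : cder phi z l -> {for z, continuous phi}.
Proof.
move=> /cderP [dx _]; apply: differentiable_continuous.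
exact/derivable1_diffP.
Qed.

Lemma rint_deg phi (a b c d : R) : a = b \/ c = d -> rint phi a b c d = 0.
Proof. by case=> ->; rewrite /rint /seg; ring. Qed.

(** One side of a small box around an exceptional point: the strip cut off is either degenerate or
    stays away from [x]. *)
Lemma clip_below (a x t : R) : a <= x -> 0 < t ->
  exists a', [/\ a <= a' <= x, x - t <= a' & a = a' \/ a' < x].
Proof.
move=> ax t0; have [h|h] := leP (x - t) a; first by exists a; rewrite lexx ax; split => //; left.
by exists (x - t); split; [lra|lra|right; lra].
Qed.

Lemma clip_above (b x t : R) : x <= b -> 0 < t ->
  exists b', [/\ x <= b' <= b, b' <= x + t & b' = b \/ x < b'].
Proof.
move=> xb t0; have [h|h] := leP b (x + t); first by exists b; rewrite lexx xb; split => //; left.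
by exists (x + t); split; [lra|lra|right; lra].
Qed.

(** Four strips around a small box at the exceptional point integrate to 0 by [goursat]; the
    integral over the box tends to 0 with its perimeter, as [phi] is bounded there. *)
Lemma goursat_except phi (x0 y0 a b c d : R) : continuous phi ->
  -10 < a -> a <= b -> b < 10 -> -10 < c -> c <= d -> d < 10 ->
  (forall x y, a <= x <= b -> c <= y <= d -> x != x0 \/ y != y0 ->
     exists l, cder phi (pt x y) l) ->
  rint phi a b c d = 0.
Proof.
move=> phic a1 ab b1 c1 cd d1 H.
have [xI|xI] := boolP (a <= x0 <= b); last first.
  apply: goursat => // x y xab ycd; apply: H => //; left.
  by apply: contraNneq xI => <-.
have [yI|yI] := boolP (c <= y0 <= d); last first.
  apply: goursat => // x y xab ycd; apply: H => //; right.
  by apply: contraNneq yI => <-.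
move: xI yI => /andP[ax xb] /andP[cy yd].
have [r r0 rH] := (continuous_rnP _ _).1 (phic (pt x0 y0)) 1 ltr01.
pose M := rn (phi (pt x0 y0)) + 1.
have M0 : 0 < M by rewrite ltr_wpDl// rn_ge0.
apply/eqP; rewrite -rn_eq0 eq_le rn_ge0 andbT; apply/ler_addgt0Pl => e e0.
rewrite addr0.
(* [r / 4] keeps the box where [phi] is bounded by [M]; [8 * M * t] is the bound of [rint_bound] for
   sides of length at most [2 * t]. *)
pose t := Num.min (r / 4) (e / (8 * M)).
have t0 : 0 < t by rewrite lt_min !divr_gt0// mulr_gt0.
have tr : t <= r / 4 by rewrite ge_min lexx.
have te : 8 * M * t <= e by rewrite mulrC -ler_pdivlMr ?mulr_gt0// ge_min lexx orbT.
have [a' [a'1 a'2 a'3]] := clip_below ax t0.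
have [b' [b'1 b'2 b'3]] := clip_above xb t0.
have [c' [c'1 c'2 c'3]] := clip_below cy t0.
have [d' [d'1 d'2 d'3]] := clip_above yd t0.
clearbody t; rewrite (rint_splitx _ a') (rint_splitx _ b' a') (rint_splity _ c' a' b').
rewrite (rint_splity _ d' a' b' c').
have -> : rint phi a a' c d = 0.
  case: a'3 => h; first by apply: rint_deg; left.
  apply: goursat => //; try lra.
  by move=> x y xI yI; apply: H; [lra|lra|left; rewrite lt_eqF//; lra].
have -> : rint phi b' b c d = 0.
  case: b'3 => h; first by apply: rint_deg; left.
  apply: goursat => //; try lra.
  by move=> x y xI yI; apply: H; [lra|lra|left; rewrite gt_eqF//; lra].
have -> : rint phi a' b' c c' = 0.
  case: c'3 => h; first by apply: rint_deg; right.
  apply: goursat => //; try lra.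
  by move=> x y xI yI; apply: H; [lra|lra|right; rewrite lt_eqF//; lra].
have -> : rint phi a' b' d' d = 0.
  case: d'3 => h; first by apply: rint_deg; right.
  apply: goursat => //; try lra.
  by move=> x y xI yI; apply: H; [lra|lra|right; rewrite gt_eqF//; lra].
rewrite !add0r !addr0; apply: le_trans te.
apply: le_trans (@rint_bound _ _ _ _ _ _ M _ _ _ _ _ _ _ _) _; try lra.
- exact: continuous_linecont.
- move=> x y xI yI _.
  have /rH : rn (pt x y - pt x0 y0) < r.
    apply: le_lt_trans (rn_le_ReIm _) _ => /=.
    have h1 : `|x - x0| <= t by rewrite ler_norml; lra.
    have h2 : `|y - y0| <= t by rewrite ler_norml; lra.
    by lra.
  have := rn_dist (phi (pt x y)) (phi (pt x0 y0)) 0; rewrite !subr0 /M; lra.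
- have -> : 8 * M * t = 2 * M * (2 * t + 2 * t) by ring.
  by rewrite ler_wpM2l ?mulr_ge0 ?(ltW M0)//; lra.
Qed.

End GoursatPunctured.

Section CauchyFormula.
Variable R : realType.
Notation C := (Cplx R).
Implicit Types (phi : C -> C).

Lemma ltN10_N1 : -10 < -1 :> R. Proof. lra. Qed.
Lemma leN1_1 : -1 <= 1 :> R. Proof. lra. Qed.
Lemma quarter_le2 : 1 / 4 <= 2 :> R. Proof. lra. Qed.
Lemma quarter_le_half : 1 / 4 <= 1 / 2 :> R. Proof. lra. Qed.
Lemma lt1_10 : 1 < 10 :> R. Proof. lra. Qed.

Definition oint phi : C := rint phi (-1) 1 (-1) 1.

(** The boundary of the square lies in this annulus, on which all later bounds are stated. *)
Lemma square_norm (x y : R) : -1 <= x <= 1 -> -1 <= y <= 1 ->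
  (x = -1 \/ x = 1 \/ y = -1 \/ y = 1) -> 1 <= rn (pt x y) <= 2.
Proof.
move=> xI yI xy; apply/andP; split.
  case: xy => [->|[->|[->|->]]];
    [have := rn_ge_Re (pt (-1) y)|have := rn_ge_Re (pt 1 y)|
     have := rn_ge_Im (pt x (-1))|have := rn_ge_Im (pt x 1)];
    by rewrite /= ?normrN normr1.
apply: le_trans (rn_le_ReIm _) _ => /=.
have h1 : `|x| <= 1 by rewrite ler_norml.
have h2 : `|y| <= 1 by rewrite ler_norml.
lra.
Qed.

Lemma square_norm_in (x y : R) : -1 <= x <= 1 -> -1 <= y <= 1 -> rn (pt x y) <= 2.
Proof.
move=> xI yI; apply: le_trans (rn_le_ReIm _) _ => /=.
have h1 : `|x| <= 1 by rewrite ler_norml.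
have h2 : `|y| <= 1 by rewrite ler_norml.
lra.
Qed.

Definition lcont phi := linecont phi (-1) 1 (-1) 1.

Lemma oint_lin phi1 phi2 k : lcont phi1 -> lcont phi2 ->
  oint (fun z => phi1 z + k * phi2 z) = oint phi1 + k * oint phi2.
Proof.
move=> h1 h2.
exact: (@rint_lin _ phi1 phi2 k (-1) 1 (-1) 1 h1 h2 ltN10_N1 leN1_1 lt1_10 ltN10_N1 leN1_1 lt1_10).
Qed.

Lemma oint_bound phi M : lcont phi ->
  (forall z, 1 <= rn z <= 2 -> rn (phi z) <= M) -> rn (oint phi) <= 8 * M.
Proof.
move=> lc H; have -> : 8 * M = 2 * M * (1 - - 1 + (1 - - 1)) by ring.
apply: (@rint_bound _ phi (-1) 1 (-1) 1 M ltN10_N1 leN1_1 lt1_10 ltN10_N1 leN1_1 lt1_10 lc).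
by move=> x y xI yI xy; apply/H/square_norm.
Qed.

Lemma oint_eq phi1 phi2 : lcont phi1 -> lcont phi2 ->
  (forall z, 1 <= rn z <= 2 -> phi1 z = phi2 z) -> oint phi1 = oint phi2.
Proof.
move=> [r1 r2 r3 r4] [s1 s2 s3 s4] H; rewrite /oint /rint.
have I1 : (-1 <= -1 :> R) && (-1 <= 1 :> R) by apply/andP; split; lra.
have I2 : (-1 <= 1 :> R) && (1 <= 1 :> R) by apply/andP; split; lra.
rewrite (seg_eq r1 s1 ltN10_N1 leN1_1 lt1_10); last by move=> x xI; apply/H/square_norm => //; tauto.
rewrite (seg_eq r2 s2 ltN10_N1 leN1_1 lt1_10); last by move=> x xI; apply/H/square_norm => //; tauto.
rewrite (seg_eq r3 s3 ltN10_N1 leN1_1 lt1_10); last by move=> x xI; apply/H/square_norm => //; tauto.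
by rewrite (seg_eq r4 s4 ltN10_N1 leN1_1 lt1_10)// => x xI; apply/H/square_norm => //; tauto.
Qed.

Lemma lcontM phi1 phi2 : lcont phi1 -> lcont phi2 -> lcont (fun z => phi1 z * phi2 z).
Proof. by move=> [? ? ? ?] [? ? ? ?]; split; exact: rcontM. Qed.

Lemma lcontD phi1 phi2 : lcont phi1 -> lcont phi2 -> lcont (fun z => phi1 z + phi2 z).
Proof. by move=> [? ? ? ?] [? ? ? ?]; split; exact: rcontD. Qed.

Lemma lcont_cst k : lcont (fun=> k).
Proof. by split; exact: rcont_cst. Qed.

Definition cauchy_ker (s z : C) : C := (z - s)^-1.

Lemma cauchy_ker_cder (s z : C) : z != s -> cder (cauchy_ker s) z (- (cauchy_ker s z ^+ 2)).
Proof.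
move=> zs; apply/cderP.
have zs' : (fun w : C => w - s) z != 0 by rewrite subr_eq0.
have d1 : is_derive z (1 : C) (fun w : C => w - s) 1.
  by apply: is_derive_eq; rewrite subr0.
apply: DeriveDef; first exact: derivableV.
have dv : 'D_1 (fun w : C => w - s) z = 1 by exact: derive_val.
rewrite deriveV// dv.
by rewrite [_ *: 1]mulr1 /cauchy_ker exprVn.
Qed.

Lemma cauchy_ker_lcont (s : C) : rn s < 1 -> lcont (cauchy_ker s).
Proof.
move=> s1.
have c z : z != s -> {for z, continuous (cauchy_ker s)}.
  by move=> /cauchy_ker_cder; exact: cder_continuous.
have h1 := le_lt_trans (rn_ge_Re s) s1; have h2 := le_lt_trans (rn_ge_Im s) s1.
rewrite !ltr_norml in h1 h2.
have := h1; have := h2; case: s c {s1 h1 h2} => s1 s2 c /= /andP[? ?] /andP[? ?].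
split; [apply: rcont_ptx|apply: rcont_pty|apply: rcont_ptx|apply: rcont_pty] => u;
  apply: c; rewrite eq_complex /= negb_and; apply/orP;
  [right|left|right|left]; apply/eqP; lra.
Qed.

Lemma cauchy_ker_bound (s z : C) : rn s <= 1 / 2 -> 1 <= rn z -> rn (cauchy_ker s z) <= 2.
Proof.
move=> hs hz; rewrite /cauchy_ker rnV -[2]invrK lef_pV2 ?posrE; last first.
- by rewrite invr_gt0.
- by have := rn_dist z s 0; rewrite !subr0; lra.
by have := rn_dist z s 0; rewrite !subr0; lra.
Qed.

Lemma cauchy_ker_neq0 (s z : C) : rn s <= 1 / 2 -> 1 <= rn z -> z - s != 0.
Proof.
move=> hs hz; rewrite -rn_eq0; apply/eqP => h.
by have := rn_dist z s 0; rewrite !subr0; lra.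
Qed.

Lemma oint_ker2 (s : C) : rn s <= 1 / 2 -> oint (fun z => cauchy_ker s z ^+ 2) = 0.
Proof.
move=> hs; have hs1 : rn s < 1 by lra.
have -> : (fun z => cauchy_ker s z ^+ 2) = (fun z => cauchy_ker s z * cauchy_ker s z).
  by apply/funext => z; rewrite expr2.
apply: (@rint_prim _ _ (fun z => - cauchy_ker s z) _ _ _ _ ltN10_N1 leN1_1 lt1_10 ltN10_N1 leN1_1 lt1_10
  (lcontM (cauchy_ker_lcont hs1) (cauchy_ker_lcont hs1))).
move=> x y xI yI xy; have /andP[z1 _] := square_norm xI yI xy.
have zs : pt x y != s by rewrite -subr_eq0 cauchy_ker_neq0.
have /cderP H := cauchy_ker_cder zs; apply/cderP.
by have := is_deriveN H; rewrite opprK expr2.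
Qed.

(** Along the segment from 0 to [s] the derivative of the integral is a multiple of the integral of
    the squared kernel, which vanishes by [oint_ker2]. *)
Lemma oint_ker_const (s : C) : rn s <= 1 / 4 -> oint (cauchy_ker s) = oint (cauchy_ker 0).
Proof.
move=> hs.
have := @rder_const _ (fun t => oint (cauchy_ker (t%:C%C * s))) 0 1 ler01.
rewrite mul1r mul0r; apply => x /andP[x0 x1]; apply: rder_eps => e e0.
(* The 1 keeps the shifted pole within radius 1/2; 64 is the bound [8 * 8] on the remainder integral
   below. *)
exists (Num.min 1 (e / 64)); first by rewrite lt_min ltr01 divr_gt0.
move=> t; rewrite lt_min => /andP[t1 te].
have small (u : R) : `|u| <= 2 -> rn (u%:C%C * s : C) <= 1 / 2.
  rewrite rnM rn_real => u2.
  apply: le_trans (ler_pM _ _ u2 hs) _; rewrite ?rn_ge0//; lra.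
have hx : rn (x%:C%C * s : C) <= 1 / 2 by apply: small; rewrite ger0_norm//; lra.
have hxt : rn ((x + t)%:C%C * s : C) <= 1 / 2.
  by apply: small; apply: le_trans (ler_normD _ _) _; rewrite ger0_norm//; lra.
set u : C := x%:C%C * s; set v : C := (x + t)%:C%C * s; rewrite -/u -/v in hx hxt.
have uv : v - u = t%:C%C * s :> C by rewrite /v /u rmorphD /=; ring.
have lu : lcont (cauchy_ker u) by apply: cauchy_ker_lcont; lra.
have lv : lcont (cauchy_ker v) by apply: cauchy_ker_lcont; lra.
have l2 : lcont (fun z => cauchy_ker u z ^+ 2).
  have -> : (fun z => cauchy_ker u z ^+ 2) = (fun z => cauchy_ker u z * cauchy_ker u z).
    by apply/funext => z; rewrite expr2.
  exact: lcontM.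
have l3 : lcont (fun z => cauchy_ker u z ^+ 2 * cauchy_ker v z) by exact: lcontM.
have E : oint (cauchy_ker v) = oint (fun z => (cauchy_ker u z + (v - u) * cauchy_ker u z ^+ 2) +
    (v - u) ^+ 2 * (cauchy_ker u z ^+ 2 * cauchy_ker v z)).
  apply: oint_eq => //.
    apply: lcontD; first by apply: lcontD => //; apply: lcontM => //; exact: lcont_cst.
    by apply: lcontM => //; exact: lcont_cst.
  move=> z /andP[z1 _]; have := cauchy_ker_neq0 hx z1; have := cauchy_ker_neq0 hxt z1; rewrite /cauchy_ker => n1 n2.
  by field; apply/andP; split.
rewrite E oint_lin//; last by apply: lcontD => //; apply: lcontM => //; exact: lcont_cst.
rewrite oint_lin// oint_ker2// mulr0 addr0 mulr0 subr0 addrAC subrr add0r.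
rewrite rnM uv rnX rnM rn_real.
have B : rn (oint (fun z => cauchy_ker u z ^+ 2 * cauchy_ker v z)) <= 8 * 8.
  apply: oint_bound => // z /andP[z1 _]; rewrite rnM rnX.
  have b1 := cauchy_ker_bound hx z1; have b2 := cauchy_ker_bound hxt z1.
  have -> : (8 : R) = 2 ^+ 2 * 2 by ring.
  by apply: ler_pM; rewrite ?exprn_ge0 ?rn_ge0// lerXn2r ?nnegrE ?rn_ge0.
have i1 : (`|t| * rn s) ^+ 2 <= `|t| ^+ 2.
  rewrite exprMn ler_piMr ?sqr_ge0// expr_le1// ?rn_ge0//; lra.
apply: le_trans (ler_pM _ _ i1 B) _; rewrite ?sqr_ge0 ?rn_ge0//.
rewrite expr2 mulrC mulrA ler_wpM2r//; lra.
Qed.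

(** The value is 2 pi i, but a crude estimate suffices. By symmetry the integral is 2i times that of
    2 / (1 + x^2) over [-1, 1], and this integrand stays within 1/2 of 3/2, which puts the real
    integral within 1 of 3. *)
Lemma oint_ker0 : oint (cauchy_ker 0) != 0.
Proof.
have l0 : lcont (cauchy_ker 0) by apply: cauchy_ker_lcont; rewrite rn0.
pose h (x : R) : C := ((2 / (1 + x ^+ 2))%:C)%C.
have q1 (x : R) : 1 + x ^+ 2 != 0 by rewrite gt_eqF// ltr_wpDr// sqr_ge0.
have [r1 r2 r3 r4] := l0.
have hE (x : R) : h x = -'i%C * (cauchy_ker 0 (pt x (-1)) + (-1) * cauchy_ker 0 (pt x 1)).
  rewrite /h /cauchy_ker !subr0; apply/eqP; rewrite eq_complex /=; apply/andP.
  by split; apply/eqP; field; rewrite ?sqrrN ?expr1n addrC q1.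
have vE (x : R) : h x = cauchy_ker 0 (pt 1 x) + (-1) * cauchy_ker 0 (pt (-1) x).
  rewrite /h /cauchy_ker !subr0; apply/eqP; rewrite eq_complex /=; apply/andP.
  by split; apply/eqP; field; rewrite ?sqrrN ?expr1n q1.
have hc : rcont h.
  have -> : h = fun x => cauchy_ker 0 (pt 1 x) + (-1) * cauchy_ker 0 (pt (-1) x).
    by apply/funext.
  by apply: rcontD => //; apply: rcontM => //; exact: rcont_cst.
have s1 : seg h (-1) 1 = seg (fun y => cauchy_ker 0 (pt 1 y)) (-1) 1 -
    seg (fun y => cauchy_ker 0 (pt (-1) y)) (-1) 1.
  have -> : h = fun x => cauchy_ker 0 (pt 1 x) + (-1) * cauchy_ker 0 (pt (-1) x) by apply/funext.
  by rewrite (seg_lin (-1) r2 r4 ltN10_N1 leN1_1 lt1_10) mulN1r.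
have rw : rcont (fun x => cauchy_ker 0 (pt x (-1)) + (-1) * cauchy_ker 0 (pt x 1)).
  by apply: rcontD r1 _; apply: rcontM r3; exact: rcont_cst.
have s2 : seg h (-1) 1 = - 'i%C * (seg (fun x => cauchy_ker 0 (pt x (-1))) (-1) 1 -
    seg (fun x => cauchy_ker 0 (pt x 1)) (-1) 1).
  have -> : h = fun x => 0 + - 'i%C * (cauchy_ker 0 (pt x (-1)) + (-1) * cauchy_ker 0 (pt x 1)).
    by apply/funext => x; rewrite add0r.
  rewrite (seg_lin (- 'i%C) (rcont_cst 0) rw ltN10_N1 leN1_1 lt1_10).
  rewrite (seg_lin (-1) r1 r3 ltN10_N1 leN1_1 lt1_10).
  have -> : seg (fun=> 0 : C) (-1) 1 = 0.
    rewrite (@segE _ _ (fun=> 0) _ _ (rcont_cst 0) ltN10_N1 leN1_1 lt1_10) ?subrr//.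
    by move=> x _; split; exact: is_derive_cst.
  by rewrite add0r mulN1r.
have E : oint (cauchy_ker 0) = 2 * 'i%C * seg h (-1) 1.
  rewrite /oint /rint mulr2n mulrDl mulrDl {1}s2 s1.
  set u := seg _ _ _; set v := seg _ _ _; set w := seg _ _ _; set y := seg _ _ _.
  transitivity (- ('i%C ^+ 2) * (u - w) + 'i%C * (v - y) : C); last by ring.
  by rewrite sqr_i; ring.
have S : rn (seg h (-1) 1 - 3) <= 1.
  have -> : seg h (-1) 1 - 3 = seg (fun x => h x + (-1) * (3 / 2)) (-1) 1.
    rewrite (seg_lin (-1) hc (rcont_cst (3 / 2)) ltN10_N1 leN1_1 lt1_10).
    rewrite (@segE _ (fun=> 3 / 2) (fun x => (3 / 2) * (0 + x%:C%C * 1)) _ _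
      (rcont_cst (3 / 2)) ltN10_N1 leN1_1 lt1_10).
      have -> : ((-1)%:C)%C = -1 :> C by rewrite rmorphN1.
      by have -> : (1%:C)%C = 1 :> C by []; congr (_ + _); field.
    move=> x _.
    have H : rder (fun x => 0 + x%:C%C * 1 : C) x (1 * 1).
      apply: (@cder_path _ id) => e e0; exists 1 => // t _.
      rewrite (_ : _ - _ - _ = 0 :> C); last by rewrite /=; ring.
      by rewrite rn0 mulr_ge0 ?rn_ge0// ltW.
    by have := rderZ (3 / 2) H; rewrite mulr1 mulr1.
  suff B : rn (seg (fun x => h x + -1 * (3 / 2)) (-1) 1) <= 1 / 2 * (1 - - 1).
    by apply: le_trans B _; lra.
  apply: (fun rc => seg_bound rc ltN10_N1 leN1_1 lt1_10); first by apply: rcontD hc _; exact: rcont_cst.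
  move=> x xI.
  have -> : h x + -1 * (3 / 2) = ((2 / (1 + x ^+ 2) - 3 / 2)%:C)%C.
    by rewrite /h rmorphB mulN1r; congr (_ - _); rewrite fmorph_div /= !rmorph_nat.
  rewrite rn_real ler_norml.
  have x2 : x ^+ 2 <= 1.
    have : 0 <= (1 - x) * (1 + x) by apply: mulr_ge0; lra.
    by rewrite expr2; lra.
  have p1 : 0 < 1 + x ^+ 2 by rewrite ltr_wpDr// sqr_ge0.
  apply/andP; split; rewrite ?lerBrDr ?lerBlDr.
    by rewrite ler_pdivlMr//; lra.
  by rewrite ler_pdivrMr//; have := sqr_ge0 x; lra.
rewrite E -rn_eq0 !rnM rn_i rn_nat; apply/eqP => h0.
have := rn_dist (3 : C) (seg h (-1) 1) 0.
by rewrite !subr0 (rn_distC (3 : C)) rn_nat; lra.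
Qed.

(** The difference quotient [q] of [phi] at [s], completed by the derivative, is continuous, and
    differentiable off [s]; so [goursat_except] applies to it. The constant [oint (cauchy_ker 0)]
    stands for 2 pi i. *)
Lemma cauchy_formula phi (s : C) : continuous phi ->
  (forall z, rn z <= 2 -> exists l, cder phi z l) -> rn s <= 1 / 4 ->
  oint (fun z => phi z * cauchy_ker s z) = phi s * oint (cauchy_ker 0).
Proof.
move=> phic H hs; have hs1 : rn s < 1 by lra.
have [l ls] := H s (le_trans hs quarter_le2).
pose q z := if z == s then l else (phi z - phi s) * cauchy_ker s z.
have qd z : z != s -> (exists l, cder phi z l) -> exists l', cder q z l'.
  move=> zs [l1 l1z].
  have zs0 : 0 < rn (z - s) by rewrite rn_gt0 subr_eq0.
  have /cderP [dk _] := cauchy_ker_cder zs; move/cderP : l1z => [dp _].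
  have dd : derivable ((fun w : C => phi w - phi s) * cauchy_ker s) z (1 : C).
    apply: derivableM; last exact: dk.
    by apply: derivableB; [exact: dp|exact: derivable_cst].
  exists ('D_1 ((fun w : C => phi w - phi s) * cauchy_ker s) z).
  apply: (cder_local zs0 _ ((cderP _ _ _).2 (derivableP dd))) => t tz.
  rewrite /q ifN//; apply: contraTneq tz => ->.
  by rewrite -leNgt rn_distC lexx.
have qc : continuous q.
  move=> z; have [->|zs] := eqVneq z s; last first.
    have zs0 : 0 < rn (z - s) by rewrite rn_gt0 subr_eq0.
    have /cder_continuous ck := cauchy_ker_cder zs.
    have c1 : {for z, continuous (fun w => (phi w - phi s) * cauchy_ker s w)}.
      apply: (@continuousM C C (fun w => phi w - phi s) (cauchy_ker s) z _ ck).
      by apply: (@continuousB C C C phi (fun=> phi s) z (phic z)); exact: cst_continuous.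
    apply/continuous_rnP => e e0; have [d d0 dH] := (continuous_rnP _ _).1 c1 e e0.
    exists (Num.min d (rn (z - s))) => [|y]; first by rewrite lt_min d0.
    rewrite lt_min => /andP[/dH yd ys]; rewrite /q ifN ?ifN//.
    by apply: contraTneq ys => ->; rewrite -leNgt rn_distC lexx.
  apply/continuous_rnP => e e0; have [d d0 dH] := ls _ (divr_gt0 e0 (ltr0n _ 2)).
  exists d => // y yd; rewrite /q eqxx; case: eqVneq => [_|ys]; first by rewrite subrr rn0.
  have ys0 : 0 < rn (y - s) by rewrite rn_gt0 subr_eq0.
  have := dH _ yd; rewrite [s + _]addrC subrK => h.
  have -> : (phi y - phi s) * cauchy_ker s y - l = (phi y - phi s - l * (y - s)) * cauchy_ker s y.
    by rewrite /cauchy_ker; field; rewrite subr_eq0.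
  rewrite rnM /cauchy_ker rnV ltr_pdivrMr//; apply: le_lt_trans h _.
  by rewrite ltr_pM2r//; lra.
have lk : lcont (cauchy_ker s) by exact: cauchy_ker_lcont.
have lp : lcont phi by exact: continuous_linecont.
have lq : lcont q by exact: continuous_linecont.
have q0 : oint q = 0.
  apply: (goursat_except (x0 := complex.Re s) (y0 := complex.Im s) qc ltN10_N1 leN1_1 lt1_10 ltN10_N1 leN1_1 lt1_10).
  move=> x y xI yI xy; apply: qd; last by apply: H; apply: square_norm_in.
  by apply: contraPneq xy => <- /= [] /eqP.
have lpk : lcont (fun z => phi z * cauchy_ker s z) by exact: lcontM.
have : oint q = oint (fun z => phi z * cauchy_ker s z + (- phi s) * cauchy_ker s z).
  apply: oint_eq => //.
    by apply: lcontD lpk _; apply: lcontM lk; exact: lcont_cst.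
  move=> z /andP[z1 _]; have := cauchy_ker_neq0 (le_trans hs quarter_le_half) z1.
  by rewrite subr_eq0 /q => /negbTE ->; ring.
rewrite q0 (oint_lin _ lpk lk) oint_ker_const// => /esym/eqP.
by rewrite mulNr subr_eq0 => /eqP.
Qed.

(* The Cauchy integral for the derivative at [0], on the square [-1, 1]^2; see
   [Lam_cder]. *)
Definition Lam phi : C := (oint (cauchy_ker 0))^-1 * oint (fun z => phi z * cauchy_ker 0 z ^+ 2).

(** A common constant for [Lam_bound], [cauchy_bound] and [cauchy_taylor], whose numerators are 8,
    16 and 16. *)
Definition cauchy_const : R := 128 / rn (oint (cauchy_ker 0)).

Lemma cauchy_const_gt0 : 0 < cauchy_const.
Proof. by rewrite divr_gt0// rn_gt0 oint_ker0. Qed.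

Lemma lcont_ker2 (s : C) : rn s < 1 -> lcont (fun z => cauchy_ker s z ^+ 2).
Proof.
move=> hs; have -> : (fun z => cauchy_ker s z ^+ 2) = (fun z => cauchy_ker s z * cauchy_ker s z).
  by apply/funext => z; rewrite expr2.
by apply: lcontM; exact: cauchy_ker_lcont.
Qed.

Lemma Lam_lin phi1 phi2 k : continuous phi1 -> continuous phi2 ->
  Lam (fun z => phi1 z + k * phi2 z) = Lam phi1 + k * Lam phi2.
Proof.
move=> c1 c2; rewrite /Lam.
have k2 : lcont (fun z => cauchy_ker 0 z ^+ 2) by apply: lcont_ker2; rewrite rn0.
have l1 := lcontM (continuous_linecont (-1) 1 (-1) 1 c1) k2.
have l2 := lcontM (continuous_linecont (-1) 1 (-1) 1 c2) k2.
have -> : (fun z => (phi1 z + k * phi2 z) * cauchy_ker 0 z ^+ 2) =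
  (fun z => phi1 z * cauchy_ker 0 z ^+ 2 + k * (phi2 z * cauchy_ker 0 z ^+ 2)).
  by apply/funext => z; ring.
by rewrite (oint_lin k l1 l2); ring.
Qed.

Lemma ker0_bound (z : C) : 1 <= rn z -> rn (cauchy_ker 0 z) <= 1.
Proof. by move=> z1; rewrite /cauchy_ker subr0 rnV invf_le1 ?(lt_le_trans ltr01). Qed.

Lemma Lam_bound phi M : continuous phi ->
  (forall z, 1 <= rn z <= 2 -> rn (phi z) <= M) -> rn (Lam phi) <= cauchy_const * M.
Proof.
move=> c1 H; rewrite /Lam rnM rnV.
have k2 : lcont (fun z => cauchy_ker 0 z ^+ 2) by apply: lcont_ker2; rewrite rn0.
have l1 := lcontM (continuous_linecont (-1) 1 (-1) 1 c1) k2.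
have c0 : 0 < rn (oint (cauchy_ker 0)) by rewrite rn_gt0 oint_ker0.
have B : rn (oint (fun z => phi z * cauchy_ker 0 z ^+ 2)) <= 8 * M.
  apply: oint_bound l1 _ => z /[dup] zI /andP[z1 _].
  rewrite rnM rnX; apply: le_trans (H z zI).
  by rewrite ler_piMr ?rn_ge0// expr_le1 ?rn_ge0// ker0_bound.
have M0 : 0 <= M.
  by apply: le_trans (rn_ge0 (phi 1)) (H _ _); rewrite rn1; apply/andP; split; lra.
rewrite mulrC ler_pdivrMr//; apply: le_trans B _.
have -> : cauchy_const * M * rn (oint (cauchy_ker 0)) = 128 * M by rewrite /cauchy_const; field; rewrite gt_eqF.
by rewrite ler_wpM2r//; lra.
Qed.

Lemma cauchy_bound phi M (s : C) : continuous phi ->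
  (forall z, rn z <= 2 -> exists l, cder phi z l) ->
  (forall z, 1 <= rn z <= 2 -> rn (phi z) <= M) -> rn s <= 1 / 4 ->
  rn (phi s) <= cauchy_const * M.
Proof.
move=> phic phid H hs.
have c0 : 0 < rn (oint (cauchy_ker 0)) by rewrite rn_gt0 oint_ker0.
have hs1 : rn s < 1 by lra.
have lpk := lcontM (continuous_linecont (-1) 1 (-1) 1 phic) (cauchy_ker_lcont hs1).
have B : rn (oint (fun z => phi z * cauchy_ker s z)) <= 8 * (M * 2).
  apply: oint_bound lpk _ => z /[dup] zI /andP[z1 _].
  by rewrite rnM ler_pM ?rn_ge0 ?H// cauchy_ker_bound//; lra.
have M0 : 0 <= M.
  by apply: le_trans (rn_ge0 (phi 1)) (H _ _); rewrite rn1; apply/andP; split; lra.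
move: B; rewrite cauchy_formula// rnM -ler_pdivlMr// => B; apply: le_trans B _.
rewrite /cauchy_const [leRHS]mulrAC ler_wpM2r ?invr_ge0 ?rn_ge0//; lra.
Qed.

(** Integrate 1/(z - s) = 1/z + s/z^2 + s^2/(z^2 (z - s)) against [phi]. *)
Lemma cauchy_taylor phi M (s : C) : continuous phi ->
  (forall z, rn z <= 2 -> exists l, cder phi z l) ->
  (forall z, 1 <= rn z <= 2 -> rn (phi z) <= M) -> rn s <= 1 / 4 ->
  rn (phi s - phi 0 - Lam phi * s) <= cauchy_const * M * rn s ^+ 2.
Proof.
move=> phic phid H hs.
have c0 : 0 < rn (oint (cauchy_ker 0)) by rewrite rn_gt0 oint_ker0.
have hs1 : rn s < 1 by lra.
have h0 : rn (0 : C) < 1 by rewrite rn0.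
have h04 : rn (0 : C) <= 1 / 4 by rewrite rn0; lra.
have lp := continuous_linecont (-1) 1 (-1) 1 phic.
have ls := lcontM lp (cauchy_ker_lcont hs1).
have l0 := lcontM lp (cauchy_ker_lcont h0).
have l2 := lcontM lp (lcont_ker2 h0).
have l3 := lcontM lp (lcontM (lcont_ker2 h0) (cauchy_ker_lcont hs1)).
have E : oint (fun z => phi z * cauchy_ker s z) =
   oint (fun z => (phi z * cauchy_ker 0 z + s * (phi z * cauchy_ker 0 z ^+ 2)) +
      s ^+ 2 * (phi z * (cauchy_ker 0 z ^+ 2 * cauchy_ker s z))).
  apply: oint_eq => //.
    apply: lcontD; first by apply: lcontD l0 _; apply: lcontM l2; exact: lcont_cst.
    by apply: lcontM l3; exact: lcont_cst.
  move=> z /andP[z1 _].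
  have := cauchy_ker_neq0 (le_trans hs quarter_le_half) z1; have := cauchy_ker_neq0 (le_trans h04 quarter_le_half) z1.
  by rewrite /cauchy_ker subr0 => n1 n2; field; apply/andP; split.
move: E; rewrite (oint_lin _ (lcontD l0 (lcontM (lcont_cst s) l2)) l3).
rewrite (oint_lin _ l0 l2) !cauchy_formula// => E.
have {}E : phi s - phi 0 - Lam phi * s = s ^+ 2 * (oint (cauchy_ker 0))^-1 *
   oint (fun z => phi z * (cauchy_ker 0 z ^+ 2 * cauchy_ker s z)).
  have nz := oint_ker0; apply: (mulIf nz); rewrite !mulrBl E /Lam.
  by field.
have B : rn (oint (fun z => phi z * (cauchy_ker 0 z ^+ 2 * cauchy_ker s z))) <= 8 * (M * 2).
  apply: oint_bound l3 _ => z /[dup] zI /andP[z1 _].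
  rewrite rnM ler_pM ?rn_ge0 ?H// rnM -[leRHS]mul1r ler_pM ?rn_ge0//.
    by rewrite rnX expr_le1 ?rn_ge0// ker0_bound.
  by rewrite cauchy_ker_bound//; lra.
have M0 : 0 <= M.
  by apply: le_trans (rn_ge0 (phi 1)) (H _ _); rewrite rn1; apply/andP; split; lra.
rewrite E rnM rnM rnX rnV /cauchy_const.
have -> : 128 / rn (oint (cauchy_ker 0)) * M * rn s ^+ 2 =
   rn s ^+ 2 / rn (oint (cauchy_ker 0)) * (128 * M) by ring.
rewrite ler_wpM2l ?divr_ge0 ?sqr_ge0 ?rn_ge0//; lra.
Qed.

Lemma Lam_cder phi (l : C) : continuous phi ->
  (forall z, rn z <= 2 -> exists l, cder phi z l) -> cder phi 0 l ->
  (exists M, forall z, rn z <= 2 -> rn (phi z) <= M) -> Lam phi = l.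
Proof.
move=> phic phid H [M HM].
have M0 : 0 <= M by apply: le_trans (rn_ge0 (phi 0)) (HM _ _); rewrite rn0.
have K0 := cauchy_const_gt0.
apply/eqP; rewrite -subr_eq0 -rn_eq0 eq_le rn_ge0 andbT.
apply/ler_addgt0Pl => e e0; rewrite addr0.
have [d d0 dH] := H (e / 2) (divr_gt0 e0 (ltr0n _ 2)).
pose t := Num.min (1 / 4) (Num.min (d / 2) (e / (2 * (cauchy_const * M + 1)))).
have KM : 0 < cauchy_const * M + 1 by rewrite ltr_wpDl// mulr_ge0// ltW.
have t0 : 0 < t by rewrite !lt_min !divr_gt0// mulr_gt0.
have [t1 t2 t3] : [/\ t <= 1 / 4, t <= d / 2 & t <= e / (2 * (cauchy_const * M + 1))].
  by split; rewrite !ge_min lexx ?orbT.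
pose s : C := (t%:C)%C.
have rs : rn s = t by rewrite rn_real ger0_norm// ltW.
have A1 := @cauchy_taylor phi M s phic phid (fun z zI => HM z (andP zI).2).
have A2 := dH s; rewrite rs in A1 A2; rewrite add0r in A2.
have {}A1 := A1 t1; have {}A2 : rn (phi s - phi 0 - l * s) <= e / 2 * t by apply: A2; lra.
have A3 : rn ((Lam phi - l) * s) <= cauchy_const * M * t ^+ 2 + e / 2 * t.
  have -> : (Lam phi - l) * s = (phi s - phi 0 - l * s) - (phi s - phi 0 - Lam phi * s) by ring.
  by apply: le_trans (rnB _ _) _; rewrite addrC lerD.
rewrite rnM rs -ler_pdivlMr// in A3; apply: le_trans A3 _.
rewrite ler_pdivrMr//.
have A4 : cauchy_const * M * t <= e / 2.
  apply: (@le_trans _ _ ((cauchy_const * M + 1) * t)); first by rewrite ler_pM2r//; lra.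
  move: t3; rewrite invfM mulrA ler_pdivlMr//; lra.
by rewrite expr2 mulrA -mulrDl ler_pM2r//; lra.
Qed.

End CauchyFormula.

(** * Holomorphic functions on normed spaces *)

Section Holomorphic.
Variable R : realType.
Notation C := (Cplx R).
Implicit Types V : normedModType C.

Lemma real_complex_divff (k : R) : k != 0 -> (k%:C)%C * (k^-1%:C)%C = 1 :> C.
Proof.
move=> k0; apply/eqP; rewrite eq_complex /=; apply/andP.
by split; apply/eqP; field.
Qed.

Lemma zeroC_lin (k a b c : C) : (0%:C)%C * a = (0%:C)%C * b + k * ((0%:C)%C * c).
Proof. by transitivity (0 * a : C) => //; rewrite -[RHS]/(0 * b + k * (0 * c)); ring. Qed.

Lemma lin_distr (b k u w : C) : b * (k * u + w) = b * w + k * (b * u).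
Proof. ring. Qed.

Lemma lin_distr' (b k u w : C) : b * (w + k * u) = b * w + k * (b * u).
Proof. ring. Qed.

Lemma difference_quotient_lin (i k a b c : C) : i * k = 1 ->
  b - a - i * c = i * ((k * b + -1 * (k * a)) + -1 * c).
Proof.
move=> ik; transitivity ((i * k) * (b - a) - i * c); last by ring.
by rewrite ik mul1r.
Qed.

Lemma differentiable_eps V (f : V -> C) (x : V) (L : {linear V -> C}) :
  continuous L ->
  (forall e : R, 0 < e -> exists2 d : R, 0 < d &
     forall w, rn w < d -> rn (f (x + w) - f x - L w) <= e * rn w) ->
  differentiable f x /\ 'd f x = L :> (V -> C).
Proof.
move=> Lc H.
have E : f \o shift x = cst (f x) + L +o_ (0 : V) id.
  apply/eqaddoP => e e0.
  have er : e = ((complex.Re e)%:C)%C by rewrite RRe_real ?gtr0_real.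
  have e0' : 0 < complex.Re e by rewrite -ltcR -er.
  have [d d0 dH] := H _ e0'; apply/nbhs_rnP; exists d => // w; rewrite subr0 => /dH.
  have -> : (f \o shift x - (cst (f x) + L)) w = f (x + w) - f x - L w.
    by rewrite -[LHS]/(f (w + x) - (f x + L w)) [w + x]addrC opprD addrA.
  by rewrite er !norm_rn -rmorphM /= lecR.
have dE := diff_unique Lc E.
split; last exact: dE.
by apply/diff_locallyP; rewrite dE; split; [exact: Lc|exact: E].
Qed.

Lemma differentiable_epsE V (f : V -> C) (x : V) : differentiable f x ->
  forall e : R, 0 < e -> exists2 d : R, 0 < d &
     forall w, rn w < d -> rn (f (x + w) - f x - 'd f x w) <= e * rn w.
Proof.
move=> /diff_locally /eqaddoP H e e0.
have e0' : 0 < (e%:C)%C :> C by rewrite ltcR.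
have /nbhs_rnP[d d0 dH] := H _ e0'; exists d => // w wd.
have := dH w; rewrite subr0 => /(_ wd).
have -> : (f \o shift x - (cst (f x) + 'd f x)) w = f (x + w) - f x - 'd f x w.
  by rewrite -[LHS]/(f (w + x) - (f x + 'd f x w)) [w + x]addrC opprD addrA.
by rewrite !norm_rn -rmorphM /= lecR.
Qed.

Lemma near_eq_differentiable V (f g : V -> C) (x : V) :
  (\forall y \near x, f y = g y) -> differentiable f x -> differentiable g x.
Proof.
move=> fg df; have E := nbhs_singleton fg; have /nbhs_rnP[r r0 rH] := fg.
suff [] : differentiable g x /\ 'd g x = 'd f x :> (V -> C) by [].
apply: differentiable_eps; first exact: diff_continuous.
move=> e /(differentiable_epsE df)[d d0 dH]; exists (Num.min d r).
  by rewrite lt_min d0.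
move=> w; rewrite lt_min => /andP[/dH h wr]; rewrite -E -rH//.
by rewrite addrAC subrr add0r.
Qed.

Lemma differentiable_cder V (f : V -> C) (y v : V) (t : C) :
  differentiable f (y + t *: v) ->
  cder (fun t => f (y + t *: v)) t ('D_v f (y + t *: v)).
Proof.
move=> df e e0.
have /is_derive_cder H : is_derive (y + t *: v) v f ('D_v f (y + t *: v)).
  by apply: derivableP; exact: diff_derivable.
have [d d0 dH] := H e e0; exists d => // h /dH.
by rewrite add0r scale0r add0r scalerDl [h *: v + _]addrC addrA.
Qed.

(* The Cauchy formula is only stated for globally continuous functions; cutting
   off with [bump] makes a function holomorphic near [z] eligible. *)
Definition bump V (z : V) (r : R) (y : V) : R :=
  Num.max 0 (Num.min 1 (2 - rn (y - z) / r)).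

Lemma bump1 V (z : V) r y : 0 < r -> rn (y - z) <= r -> bump z r y = 1.
Proof.
move=> r0 yz; rewrite /bump min_l; first by rewrite max_r.
have : rn (y - z) / r <= 1 by rewrite ler_pdivrMr// mul1r.
lra.
Qed.

Lemma bump0 V (z : V) r y : 0 < r -> 2 * r <= rn (y - z) -> bump z r y = 0.
Proof.
move=> r0 yz; rewrite /bump max_l// ge_min; apply/orP; right.
have : 2 <= rn (y - z) / r by rewrite ler_pdivlMr.
lra.
Qed.

Lemma bump_le1 V (z : V) r y : `|bump z r y| <= 1.
Proof.
rewrite /bump ger0_norm; last by rewrite le_max lexx.
by rewrite ge_max ler01 ge_min lexx.
Qed.

Lemma bump_continuous V (z : V) r : continuous (bump z r).
Proof.
move=> y.
have c1 : {for y, continuous (fun y => y - z)}.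
  by apply: (@continuousB C V V id (fun=> z)); [exact: cvg_id|exact: cst_continuous].
have c2 : {for y, continuous (fun y => rn (y - z))}.
  exact: (@continuous_comp _ _ _ (fun y => y - z) (@rn R V) y c1 (@rn_continuous R V _)).
have c3 : {for y, continuous (fun y => rn (y - z) / r)}.
  by apply: (@continuousM R V (fun y => rn (y - z)) (fun=> r^-1) y c2); exact: cst_continuous.
have c4 : {for y, continuous (fun y => 2 - rn (y - z) / r)}.
  by apply: (fun h => @continuousB R R V (fun=> 2) _ y h c3); exact: cst_continuous.
have c5 : {for y, continuous (fun y => Num.min 1 (2 - rn (y - z) / r))}.
  by apply: (fun h => @continuous_min R V (fun=> 1) _ y h c4); exact: cst_continuous.
by apply: (fun h => @continuous_max R V (fun=> 0) _ y h c5); exact: cst_continuous.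
Qed.

(** [bump] vanishes beyond [2 * r]; the margin up to [3 * r] ensures that every point without
    continuity of [f] has a neighbourhood where the product is 0. *)
Lemma bump_mul_continuous V (f : V -> C) (z : V) (r : R) : 0 < r ->
  (forall y, rn (y - z) < 3 * r -> {for y, continuous f}) ->
  continuous (fun y => ((bump z r y)%:C)%C * f y : C).
Proof.
move=> r0 fc y; have [yz|yz] := ltP (rn (y - z)) (3 * r); last first.
  apply/continuous_rnP => e e0; exists r => // w wy.
  rewrite !bump0 ?mul0r ?subrr ?rn0//; first lra.
  by have := rn_dist y w z; rewrite (rn_distC y w); lra.
apply: (@continuousM C V (fun y => ((bump z r y)%:C)%C) f y _ (fc y yz)).
apply/continuous_rnP => e e0.
have [d d0 dH] := (continuous_rn_real _ _).1 (@bump_continuous _ z r y) e e0.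
by exists d => // w /dH; rewrite -rmorphB rn_real.
Qed.

Lemma near_bounded V (f : V -> C) (z : V) :
  (\forall y \near z, differentiable f y) ->
  exists r M : R, [/\ 0 < r, 0 <= M &
    forall y, rn (y - z) < r -> differentiable f y /\ rn (f y) <= M].
Proof.
move=> df; have fz := differentiable_continuous (nbhs_singleton df).
have [r1 r10 r1H] := (nbhs_rnP _ _).1 df.
have [r2 r20 r2H] := (continuous_rnP _ _).1 fz 1 ltr01.
exists (Num.min r1 r2), (rn (f z) + 1).
split; [by rewrite lt_min r10|by rewrite addr_ge0// rn_ge0|].
move=> y; rewrite lt_min => /andP[/r1H ? /r2H h]; split => //.
by have := rn_dist (f y) (f z) 0; rewrite !subr0; lra.
Qed.

Section LineEstimates.
Variables (V : normedModType C) (F : V -> C) (z : V) (r M B : R).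
Hypotheses (r0 : 0 < r) (M0 : 0 <= M) (B1 : 1 <= B).
Hypothesis Fc : continuous F.
Hypothesis FM : forall y, rn (F y) <= M.
Hypothesis Fd : forall y, rn (y - z) < r -> differentiable F y.

(** The scale at which the square of [oint], contained in |t| <= 2, is mapped within distance
    [r / 4] of [y] by [phi y v], for any direction of norm at most [B]. *)
Let d := r / (8 * B).

Lemma line_d_gt0 : 0 < d.
Proof. by apply: divr_gt0 => //; apply: mulr_gt0 => //; exact: lt_le_trans ltr01 B1. Qed.

Let phi (y v : V) (t : C) := F (y + t *: ((d%:C)%C *: v)).

Lemma line_shift (v : V) (t : C) : rn v <= B -> rn t <= 2 ->
  rn (t *: ((d%:C)%C *: v)) <= r / 4.
Proof.
move=> vB t2; have d0 := line_d_gt0.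
rewrite !rnZ rn_real ger0_norm ?(ltW d0)//.
have -> : r / 4 = 2 * (d * B) by rewrite /d; field; rewrite gt_eqF// (lt_le_trans ltr01 B1).
apply: ler_pM; [exact: rn_ge0| |exact: t2|by rewrite ler_wpM2l// ltW].
by rewrite mulr_ge0 ?rn_ge0 ?(ltW d0).
Qed.

Lemma line_continuous (G : V -> C) (y v : V) : continuous G ->
  continuous (fun t : C => G (y + t *: v)).
Proof.
move=> Gc t.
have c1 : {for t, continuous (fun t : C => y + t *: v)}.
  apply: (fun h => @continuousD C V C (fun=> y) (fun t : C => t *: v) t h
    (@scalel_continuous C V v t)).
  exact: cst_continuous.
exact: (@continuous_comp _ _ _ _ G t c1 (Gc _)).
Qed.

Lemma line_cder (y v : V) : rn (y - z) < r / 2 -> rn v <= B ->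
  forall t, rn t <= 2 -> exists l, cder (phi y v) t l.
Proof.
move=> yz vB t t2; exists ('D_((d%:C)%C *: v) F (y + t *: ((d%:C)%C *: v))).
apply: differentiable_cder; apply: Fd.
have := line_shift vB t2; have := rnD (y - z) (t *: ((d%:C)%C *: v)).
rewrite addrAC; (have := r0; lra).
Qed.

Lemma line_Lam (y v : V) : rn (y - z) < r / 2 -> rn v <= B ->
  Lam (phi y v) = (d%:C)%C * 'D_v F y.
Proof.
move=> yz vB.
have dF : differentiable F y by apply: Fd; (have := r0; lra).
have -> : (d%:C)%C * 'D_v F y = 'D_((d%:C)%C *: v) F (y + 0 *: ((d%:C)%C *: v)).
  by rewrite scale0r addr0 !deriveE// linearZ.
apply: Lam_cder; first exact: line_continuous.
- exact: line_cder.
- by apply: differentiable_cder; rewrite scale0r addr0.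
- by exists M => t _; exact: FM.
Qed.

Lemma line_derive_bound (y v : V) : rn (y - z) < r / 2 -> rn v <= B ->
  rn ('D_v F y) <= cauchy_const R * M / d.
Proof.
move=> yz vB; have d0 := line_d_gt0.
rewrite ler_pdivlMr// mulrC.
have -> : d * rn ('D_v F y) = rn (Lam (phi y v)).
  by rewrite line_Lam// rnM rn_real ger0_norm// ltW.
by apply: Lam_bound => [|t _]; [exact: line_continuous|exact: FM].
Qed.

Lemma line_taylor (y w : V) : rn (y - z) < r / 2 -> rn w <= d / 4 ->
  rn (F (y + w) - F y - 'D_w F y) <= cauchy_const R * M / d ^+ 2 * rn w ^+ 2.
Proof.
move=> yz wd; have d0 := line_d_gt0.
have dF : differentiable F y by apply: Fd; (have := r0; lra).
have [->|w0] := eqVneq w 0.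
  by rewrite addr0 deriveE// linear0 subr0 subrr !rn0 expr0n /= mulr0.
have rw : 0 < rn w by rewrite rn_gt0.
pose v : V := ((rn w)^-1%:C)%C *: w.
have rv : rn v = 1 by rewrite rnZ rn_real ger0_norm ?invr_ge0 ?rn_ge0// mulVf ?gt_eqF.
pose s : C := ((rn w / d)%:C)%C.
have rs : rn s = rn w / d by rewrite rn_real ger0_norm// divr_ge0 ?rn_ge0 ?(ltW d0).
have sv : s *: ((d%:C)%C *: v) = w.
  rewrite /s /v !scalerA -!rmorphM -[RHS]scale1r; congr (_ *: _).
  by rewrite -(rmorph1 (real_complex R)); congr ((_)%:C)%C; field; rewrite !gt_eqF.
have vB : rn v <= B by rewrite rv.
have phic : continuous (phi y v) by exact: line_continuous.
have := @cauchy_taylor _ (phi y v) M s phic (line_cder yz vB) (fun t _ => FM _).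
rewrite rs line_Lam// /phi sv scale0r addr0 => H.
have E : (d%:C)%C * 'D_v F y * s = 'D_w F y.
  by rewrite -sv !deriveE// !linearZ mulrC.
rewrite -E; apply: le_trans (H _) _.
  by rewrite ler_pdivrMr//; (have := r0; lra).
rewrite le_eqVlt; apply/orP; left; apply/eqP.
by rewrite expr_div_n; field; rewrite gt_eqF.
Qed.

End LineEstimates.

Lemma derive_lin V (f : V -> C) y (w1 w2 : V) (k : C) : differentiable f y ->
  'D_(k *: w1 + w2) f y = k * 'D_w1 f y + 'D_w2 f y.
Proof. by move=> df; rewrite !deriveE// linearP. Qed.

(** The derivative ['D_v f] is a Cauchy integral of [f] along the line in direction [v]. Its
    increment under a shift by [w] is therefore the Cauchy integral of the increment of [f], which
    [line_taylor] replaces by ['D_w f] up to O(|w|^2). The Cauchy integral of ['D_w f] is linear and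
    continuous in [w]: it is the differential. *)
Theorem differentiable_derive V (f : V -> C) (z v : V) :
  (\forall y \near z, differentiable f y) -> differentiable ('D_v f) z.
Proof.
move=> /near_bounded[r1 [M [r10 M0 r1H]]].
pose r := r1 / 3; have r0 : 0 < r by rewrite divr_gt0.
pose F y : C := ((bump z r y)%:C)%C * f y.
have Fc : continuous F.
  apply: bump_mul_continuous => // y yz; apply: differentiable_continuous.
  by apply: (r1H y _).1; move: yz; rewrite /r; lra.
have FM y : rn (F y) <= M.
  rewrite /F rnM rn_real; have [yz|yz] := ltP (rn (y - z)) r1.
    by apply: le_trans (r1H _ yz).2; rewrite ler_piMl ?rn_ge0// bump_le1.
  by rewrite bump0 ?normr0 ?mul0r//; rewrite /r; lra.
have Ff y : rn (y - z) < r -> F y = f y.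
  by move=> yz; rewrite /F bump1 ?(ltW yz)// mul1r.
have nF y : rn (y - z) < r -> \forall x \near y, f x = F x.
  move=> yz; apply/nbhs_rnP; exists (r - rn (y - z)); first by rewrite subr_gt0.
  by move=> x xy; rewrite Ff//; have := rn_dist x y z; lra.
have Fd y : rn (y - z) < r -> differentiable F y.
  move=> yz; apply: (near_eq_differentiable (nF y yz)).
  by apply: (r1H y _).1; move: yz; rewrite /r; lra.
have DF y u : rn (y - z) < r -> 'D_u f y = 'D_u F y.
  by move=> yz; apply: near_eq_derive; exact: nF.
clearbody F; clear nF Ff.
pose B := 1 + rn v; have B1 : 1 <= B by rewrite lerDl rn_ge0.
have vB : rn v <= B by rewrite lerDr.
pose d := r / (8 * B); have d0 : 0 < d by exact: line_d_gt0.
have dr : d <= r / 8 by rewrite ler_pM2l// lef_pV2 ?posrE ?mulr_gt0//; lra.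
pose LF := 2 * (cauchy_const R * M / d).
have K0 : 0 <= cauchy_const R * M / d by apply: divr_ge0 (ltW d0); apply: mulr_ge0 M0; apply: ltW; exact: cauchy_const_gt0.
have Flip y w : rn (y - z) < r / 2 -> rn w <= d / 4 -> rn (F (y + w) - F y) <= LF * rn w.
  move=> yz wd; have [->|w0] := eqVneq w 0; first by rewrite addr0 subrr !rn0 mulr0.
  have rw : 0 < rn w by rewrite rn_gt0.
  have A1 := line_taylor r0 B1 Fc FM Fd yz wd.
  have [u [ru wu]] : exists u : V, rn u = 1 /\ w = ((rn w)%:C)%C *: u.
    exists (((rn w)^-1%:C)%C *: w); split.
      by rewrite rnZ rn_real ger0_norm ?invr_ge0 ?rn_ge0// mulVf ?gt_eqF.
    by rewrite scalerA -rmorphM mulfV ?gt_eqF// scale1r.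
  have dF : differentiable F y by apply: Fd; lra.
  have A2 : rn ('D_w F y) <= cauchy_const R * M / d * rn w.
    have -> : 'D_w F y = ((rn w)%:C)%C * 'D_u F y.
      by rewrite {1}wu !deriveE// linearZ.
    rewrite rnM rn_real ger0_norm ?(ltW rw)// [leLHS]mulrC.
    apply: ler_wpM2r; first exact: rn_ge0.
    by apply: (line_derive_bound r0 B1 Fc FM Fd) => //; rewrite ru.
  have A3 : cauchy_const R * M / d ^+ 2 * rn w ^+ 2 <= cauchy_const R * M / d * rn w.
    have -> : cauchy_const R * M / d ^+ 2 * rn w ^+ 2 = cauchy_const R * M / d * rn w * (rn w / d).
      by field; rewrite gt_eqF.
    have q : rn w / d <= 1 by rewrite ler_pdivrMr//; lra.
    by apply: ler_piMr => //; apply: mulr_ge0 => //; exact: rn_ge0.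
  apply: le_trans (_ : cauchy_const R * M / d * rn w + cauchy_const R * M / d * rn w <= _); last first.
    by rewrite /LF; lra.
  rewrite -[F (y + w) - F y](subrK ('D_w F y)).
  by apply: le_trans (rnD _ _) _; apply: lerD A2; exact: le_trans A1 A3.
have LF0 : 0 <= LF by rewrite mulr_ge0.
(* A difference of derivatives is the Cauchy integral of an increment of [F], so the Lipschitz bound
   on [F] passes to its derivatives. *)
have Dlip y y' u : rn (y - z) < r / 8 -> rn (y' - y) <= d / 4 -> rn u <= B ->
    rn ('D_u F y' - 'D_u F y) <= cauchy_const R / d * LF * rn (y' - y).
  move=> yz yy uB.
  have yz2 : rn (y - z) < r / 2 by lra.
  have yz2' : rn (y' - z) < r / 2 by have := rn_dist y' y z; lra.
  pose g x (t : C) := F (x + t *: ((d%:C)%C *: u)).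
  have gc x : continuous (g x) by exact: line_continuous.
  have E : (d%:C)%C * ('D_u F y' - 'D_u F y) = Lam (fun t => g y' t + (-1) * g y t).
    rewrite (Lam_lin (-1) (gc y') (gc y)).
    have e1 : Lam (g y) = (d%:C)%C * 'D_u F y := line_Lam r0 B1 Fc FM Fd yz2 uB.
    have e2 : Lam (g y') = (d%:C)%C * 'D_u F y' := line_Lam r0 B1 Fc FM Fd yz2' uB.
    by rewrite e1 e2 mulN1r mulrBr.
  have c2 : continuous (fun t => g y' t + (-1) * g y t).
    have -> : (fun t => g y' t + (-1) * g y t) = g y' - g y.
      by apply/funext => t; rewrite mulN1r.
    by move=> t; apply: continuousB; exact: gc.
  have := @Lam_bound _ _ (LF * rn (y' - y)) c2.
  rewrite -E rnM rn_real ger0_norm ?(ltW d0)// => H.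
  have -> : cauchy_const R / d * LF * rn (y' - y) = cauchy_const R * (LF * rn (y' - y)) / d by ring.
  rewrite ler_pdivlMr// mulrC; apply: H => t /andP[_ t2].
  rewrite mulN1r /g; have := line_shift r0 B1 uB t2; rewrite -/d.
  set w := t *: _ => hw.
  have -> : y' + w = (y + w) + (y' - y) by rewrite [RHS]addrC addrA subrK.
  have yw := rnD (y - z) w; rewrite addrAC in yw.
  by apply: Flip => //; lra.
have Dcont u y : rn (y - z) < r / 8 -> {for y, continuous ('D_u F)}.
  move=> yz; pose k : R := 1 + rn u; have k0 : 0 < k by rewrite ltr_pwDl// rn_ge0.
  (* [Dlip] requires norm at most [B]; arbitrary directions are scaled to norm at most 1. *)
  pose u' : V := (k^-1%:C)%C *: u.
  have u'B : rn u' <= B.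
    apply: le_trans B1; rewrite rnZ rn_real ger0_norm ?invr_ge0 ?(ltW k0)//.
    by rewrite ler_pdivrMl// mulr1 lerDr.
  have uE x : rn (x - z) < r -> 'D_u F x = (k%:C)%C * 'D_u' F x.
    move=> xz; have dF := Fd x xz.
    rewrite (deriveE u dF) (deriveE u' dF) /u' linearZ.
    rewrite -[RHS]/((k%:C)%C * ((k^-1%:C)%C * 'd F x u)) mulrA.
    by rewrite real_complex_divff ?gt_eqF// mul1r.
  pose c := k * (cauchy_const R / d * LF) + 1.
  have c0 : 0 < c.
    rewrite ltr_wpDl// mulr_ge0 ?(ltW k0)// mulr_ge0// divr_ge0 ?(ltW d0)//.
    by apply: ltW; exact: cauchy_const_gt0.
  apply/continuous_rnP => e e0; exists (Num.min (d / 4) (e / c)).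
    by rewrite lt_min (divr_gt0 d0)// (divr_gt0 e0 c0).
  move=> y'; rewrite lt_min => /andP[yd]; rewrite ltr_pdivlMr// => ye.
  have y'z : rn (y' - z) < r by have := rn_dist y' y z; lra.
  rewrite !uE//; last lra.
  rewrite -mulrBr rnM rn_real ger0_norm ?(ltW k0)//.
  have := Dlip y y' u' yz (ltW yd) u'B.
  rewrite -(ler_pM2l k0) => /le_lt_trans; apply; apply: le_lt_trans ye.
  have -> : k * (cauchy_const R / d * LF * rn (y' - y)) = rn (y' - y) * (k * (cauchy_const R / d * LF)) by ring.
  by apply: ler_wpM2l; [exact: rn_ge0|rewrite lerDl].
pose a := r / 32; have a0 : 0 < a by rewrite divr_gt0.
pose G w x : C := ((bump z a x)%:C)%C * 'D_w F x.
have Gc w : continuous (G w).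
  by apply: bump_mul_continuous => // y yz; apply: Dcont; move: yz; rewrite /a; lra.
have GE w x : rn (x - z) <= a -> G w x = 'D_w F x.
  by move=> xz; rewrite /G bump1// mul1r.
have GL k w1 w2 x : G (k *: w1 + w2) x = G w2 x + k * G w1 x.
  rewrite /G; have [xz|xz] := ltP (rn (x - z)) r; last first.
    have -> : bump z a x = 0 by apply: bump0 => //; rewrite /a; lra.
    exact: zeroC_lin.
  by rewrite (derive_lin w1 w2 k (Fd x xz)); exact: lin_distr.
clearbody G.
(* Using [8 * B] in place of [B] shrinks the square in direction [v], so that [x t] stays within [a]
   of [z], where [G w] agrees with ['D_w F]. *)
have B8 : 1 <= 8 * B by lra.
pose d8 := r / (8 * (8 * B)); have d80 : 0 < d8 by exact: line_d_gt0.
have d8E : d8 = d / 8 by rewrite /d8 /d; field; rewrite gt_eqF//; lra.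
pose x (t : C) := z + t *: ((d8%:C)%C *: v).
have xz (t : C) : rn t <= 2 -> rn (x t - z) <= a.
  move=> t2; rewrite /x addrAC subrr add0r !rnZ rn_real (ger0_norm (ltW d80)).
  have -> : a = 2 * (d8 * B) by rewrite /a /d8; field; rewrite gt_eqF//; lra.
  apply: ler_pM; [exact: rn_ge0| |exact: t2|by rewrite ler_wpM2l// ltW].
  by rewrite mulr_ge0 ?rn_ge0 ?(ltW d80).
have xc (H : V -> C) : continuous H -> continuous (fun t => H (x t)).
  by move=> Hc; exact: line_continuous.
pose L w : C := ((d8^-1)%:C)%C * Lam (fun t => G w (x t)).
have LL : linear (L : V -> C).
  move=> k w1 w2; rewrite /L.
  have -> : Lam (fun t => G (k *: w1 + w2) (x t)) =
      Lam (fun t => G w2 (x t) + k * G w1 (x t)).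
    by congr Lam; apply/funext => t; exact: GL.
  rewrite (Lam_lin k (xc _ (Gc w2)) (xc _ (Gc w1))).
  by rewrite lin_distr' addrC.
pose L' : {linear V -> C} := HB.pack L (@GRing.isLinear.Build C V C *:%R L LL).
have Lb w : rn (L w) <= d8^-1 * (cauchy_const R * (cauchy_const R * M / d * rn w)).
  rewrite /L rnM rn_real ger0_norm ?invr_ge0 ?(ltW d80)//.
  rewrite ler_wpM2l ?invr_ge0 ?(ltW d80)//.
  apply: (Lam_bound (xc _ (Gc w))) => t /andP[_ t2].
  have xt := xz t t2; rewrite (GE _ _ xt).
  have dF : differentiable F (x t) by apply: Fd; move: xt; rewrite /a; lra.
  have [->|w0] := eqVneq w 0; first by rewrite deriveE// linear0 !rn0 mulr0.
  have rw : 0 < rn w by rewrite rn_gt0.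
  pose u : V := ((rn w)^-1%:C)%C *: w.
  have ru : rn u = 1 by rewrite rnZ rn_real ger0_norm ?invr_ge0 ?rn_ge0// mulVf ?gt_eqF.
  have -> : 'D_w F (x t) = ((rn w)%:C)%C * 'D_u F (x t).
    rewrite (deriveE w dF) (deriveE u dF) /u linearZ.
    rewrite -[RHS]/(((rn w)%:C)%C * (((rn w)^-1%:C)%C * 'd F (x t) w)) mulrA.
    by rewrite real_complex_divff ?gt_eqF// mul1r.
  rewrite rnM rn_real ger0_norm ?(ltW rw)// [leLHS]mulrC.
  apply: ler_wpM2r; first exact: rn_ge0.
  apply: (line_derive_bound r0 B1 Fc FM Fd); last by rewrite ru.
  by move: xt; rewrite /a; lra.
have Lc : continuous L'.
  move=> y; apply/continuous_rnP => e e0.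
  pose c := d8^-1 * (cauchy_const R * (cauchy_const R * M / d)) + 1.
  have c0 : 0 < c.
    rewrite ltr_wpDl// mulr_ge0 ?invr_ge0 ?(ltW d80)// mulr_ge0//.
    by apply: ltW; exact: cauchy_const_gt0.
  exists (e / c) => [|y']; first exact: divr_gt0.
  rewrite ltr_pdivlMr// => ye; rewrite -linearB; apply: le_lt_trans (Lb _) _.
  apply: le_lt_trans ye; rewrite /c.
  have -> : d8^-1 * (cauchy_const R * (cauchy_const R * M / d * rn (y' - y))) =
    rn (y' - y) * (d8^-1 * (cauchy_const R * (cauchy_const R * M / d))) by ring.
  by apply: ler_wpM2l; [exact: rn_ge0|rewrite lerDl].
pose c := d8^-1 * (cauchy_const R * (cauchy_const R * M / d ^+ 2)) + 1.
have c0 : 0 < c.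
  rewrite ltr_wpDl// mulr_ge0 ?invr_ge0 ?(ltW d80)// mulr_ge0//.
    by apply: ltW; exact: cauchy_const_gt0.
  by apply: divr_ge0 (exprn_ge0 _ (ltW d0)); apply: mulr_ge0 M0; apply: ltW; exact: cauchy_const_gt0.
suff [] : differentiable ('D_v f) z /\ 'd ('D_v f) z = L' :> (V -> C) by [].
apply: (differentiable_eps Lc) => e e0.
exists (Num.min (d / 4) (e / c)); first by rewrite lt_min (divr_gt0 d0)// (divr_gt0 e0 c0).
move=> w; rewrite lt_min => /andP[wd]; rewrite ltr_pdivlMr// => we.
have zz : rn (z - z) < r / 2 by rewrite subrr rn0 divr_gt0.
have zw : rn (z + w - z) < r / 2 by rewrite addrAC subrr add0r; lra.
rewrite !DF; [|lra|lra].
have vB8 : rn v <= 8 * B by lra.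
have e1 : Lam (fun t => F (x t)) = (d8%:C)%C * 'D_v F z := line_Lam r0 B8 Fc FM Fd zz vB8.
pose xw (t : C) := z + w + t *: ((d8%:C)%C *: v).
have e2 : Lam (fun t => F (xw t)) = (d8%:C)%C * 'D_v F (z + w) :=
  line_Lam r0 B8 Fc FM Fd zw vB8.
have k1 : continuous (fun t => F (x t)) := xc _ Fc.
have k2 : continuous (fun t => F (xw t)) :=
  @line_continuous V F (z + w) ((d8%:C)%C *: v) Fc.
have k3 : continuous (fun t => G w (x t)) := xc _ (Gc w).
have k12 : continuous (fun t => F (xw t) + (-1) * F (x t)).
  have -> : (fun t => F (xw t) + (-1) * F (x t)) = (fun t => F (xw t)) - (fun t => F (x t)).
    by apply/funext => t; rewrite mulN1r.
  by move=> t; apply: continuousB; [exact: k2|exact: k1].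
have k123 : continuous (fun t => (F (xw t) + (-1) * F (x t)) + (-1) * G w (x t)).
  have -> : (fun t => (F (xw t) + (-1) * F (x t)) + (-1) * G w (x t)) =
    (fun t => F (xw t) + (-1) * F (x t)) - (fun t => G w (x t)).
    by apply/funext => t; congr (_ + _); exact: mulN1r.
  by move=> t; apply: continuousB; [exact: k12|exact: k3].
have e3 : 'D_v F (z + w) - 'D_v F z - L w = ((d8^-1)%:C)%C *
    Lam (fun t => (F (xw t) + (-1) * F (x t)) + (-1) * G w (x t)).
  rewrite (Lam_lin (-1) k12 k3) (Lam_lin (-1) k2 k1) e1 e2 /L.
  have dd : ((d8^-1)%:C)%C * (d8%:C)%C = 1 :> C.
    by rewrite mulrC real_complex_divff ?gt_eqF.
  exact: difference_quotient_lin.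
rewrite -[L' w]/(L w) e3 rnM rn_real ger0_norm ?invr_ge0 ?(ltW d80)//.
have S := @Lam_bound _ _ (cauchy_const R * M / d ^+ 2 * rn w ^+ 2) k123.
apply: (@le_trans _ _ (d8^-1 * (cauchy_const R * (cauchy_const R * M / d ^+ 2 * rn w ^+ 2)))).
  rewrite ler_wpM2l ?invr_ge0 ?(ltW d80)//; apply: S => t /andP[_ t2].
  have xt := xz t t2; rewrite GE// !mulN1r.
  have -> : xw t = x t + w by rewrite /xw /x addrAC.
  by apply: (line_taylor r0 B1 Fc FM Fd) (ltW wd); move: xt; rewrite /a; lra.
have -> : d8^-1 * (cauchy_const R * (cauchy_const R * M / d ^+ 2 * rn w ^+ 2)) =
  (rn w * (d8^-1 * (cauchy_const R * (cauchy_const R * M / d ^+ 2)))) * rn w by ring.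
apply: ler_wpM2r; first exact: rn_ge0.
by apply: le_trans (ltW we); apply: ler_wpM2l; [exact: rn_ge0|rewrite lerDl].
Qed.

End Holomorphic.

(** * The identity theorem and second order Taylor expansion along a line *)

Section IdentityTheorem.
Variable R : realType.
Notation C := (Cplx R).
Implicit Types V : normedModType C.

Lemma compact_disc (r : R) : compact [set z : C | rn z <= r].
Proof.
pose f (w : R * R) : C := pt w.1 w.2.
have fc : continuous f.
  move=> [x y]; move=> P /nbhs_rnP[e e0 eP].
  have e20 : 0 < e / 2 by rewrite divr_gt0.
  exists (ball x (e / 2), ball y (e / 2)); first by split; exact: nbhsx_ballx.
  move=> [x' y'] [/= xx yy]; apply: eP.
  apply: le_lt_trans (rn_le_ReIm _) _ => /=.
  rewrite /ball /= in xx yy; rewrite distrC in xx; rewrite distrC in yy; lra.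
have c1 : compact ([set` `[- r, r]%R] `*` [set` `[- r, r]%R] : set (R * R)).
  by apply: compact_setX; exact: segment_compact.
apply: (@subclosed_compact _ _ (f @` ([set` `[- r, r]%R] `*` [set` `[- r, r]%R]))).
- have -> : [set z : C | rn z <= r] = (@rn R C) @^-1` [set x | x <= r] by [].
  by apply: closed_comp; [move=> x _; exact: rn_continuous|exact: closed_le].
- by apply: continuous_compact c1; exact: continuous_subspaceT.
move=> [x y] /= h; exists (x, y) => //; split => /=; rewrite in_itv /= -ler_norml.
- exact: le_trans (rn_ge_Re _) h.
- exact: le_trans (rn_ge_Im _) h.
Qed.

Lemma continuous_bounded_compact (T : topologicalType) (f : T -> C) (A : set T) :
  compact A -> continuous f -> exists M : R, forall t, A t -> rn (f t) <= M.
Proof.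
move=> Ac fc; have [A0|/set0P A0] := eqVneq A set0.
  by exists 0 => t; rewrite A0.
have rc : continuous (fun t => rn (f t)).
  by move=> t; apply: (continuous_comp (fc t)); exact: rn_continuous.
have [c _ cM] := compact_EVT_max A0 Ac (continuous_subspaceT rc).
by exists (rn (f c)) => t /mem_set /cM.
Qed.

Lemma differentiable_ex_cder (f : C -> C) (z : C) :
  differentiable f z -> exists l, cder f z l.
Proof.
move=> df; exists ('D_1 f z); apply/cderP.
by apply: derivableP; exact: diff_derivable.
Qed.

Lemma line_differentiable V (f : V -> C) (y v : V) (t : C) :
  differentiable f (y + t *: v) -> differentiable (fun t : C => f (y + t *: v)) t.
Proof.
move=> df.
have d1 : differentiable (fun t : C => y + t *: v) t.
  have -> : (fun t : C => y + t *: v) = (fun=> y) + (fun t : C => t *: v) by [].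
  apply: differentiableD; first exact: differentiable_cst.
  by apply: (differentiableZl (k := id)); exact: ex_diff.
exact: (@differentiable_comp _ _ _ _ (fun t : C => y + t *: v) f t d1 df).
Qed.

Lemma differentiable_pow V (g : V -> C) (x : V) N :
  differentiable g x -> differentiable (fun y => g y ^+ N) x.
Proof.
move=> dg; elim: N => [|N IH].
  have -> : (fun y => g y ^+ 0) = fun=> 1 by apply/funext => y; rewrite expr0.
  exact: differentiable_cst.
have -> : (fun y => g y ^+ N.+1) = fun y => g y * g y ^+ N.
  by apply/funext => y; rewrite exprS.
exact: differentiableM dg IH.
Qed.

(** As [phi] vanishes near 0, every phi(t) / t^N is entire and is bounded by |phi| on the annulus
    around the square. [cauchy_bound] then gives |phi(t0)| <= K 4^(-N) for all N when |t0| <=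
    1/4. *)
Lemma identity_disc (phi : C -> C) (r : R) : 0 < r ->
  (forall t, differentiable phi t) -> (forall t, rn t < r -> phi t = 0) ->
  forall t, phi t = 0.
Proof.
move=> r0 dphi phi0 t0.
wlog t1 : phi r r0 dphi phi0 t0 / rn t0 <= 1 / 4.
  (* Rescaling by [k] brings any [t0] into the disc of radius 1/4. *)
  move=> W; pose k : C := ((4 * (rn t0 + 1))%:C)%C.
  have k1 : 0 < 4 * (rn t0 + 1) by rewrite mulr_gt0// ltr_wpDl// rn_ge0.
  have rk : rn k = 4 * (rn t0 + 1) by rewrite rn_real gtr0_norm.
  have k0 : k != 0 by rewrite -rn_eq0 rk gt_eqF.
  rewrite -[t0](mulVKf k0).
  have -> : phi (k * (k^-1 * t0)) = (fun t : C => phi (0 + t *: k)) (k^-1 * t0).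
    by rewrite add0r /= -[_ *: k]/(_ * k) mulrC.
  apply: (W (fun t : C => phi (0 + t *: k)) (r / rn k)).
  - by rewrite divr_gt0// rk.
  - by move=> t; exact: (@line_differentiable C phi 0 k t (dphi _)).
  - by move=> t; rewrite ltr_pdivlMr ?rk// -rk -rnM => h; apply: phi0; rewrite add0r.
  by rewrite rnM rnV rk ler_pdivrMl//; have := rn_ge0 t0; lra.
have c2 : compact [set z : C | rn z <= 2] by exact: compact_disc.
have phic : continuous phi by move=> t; exact: differentiable_continuous (dphi t).
have [M HM] := continuous_bounded_compact c2 phic.
apply/eqP; rewrite -rn_eq0 eq_le rn_ge0 andbT; apply/ler_addgt0Pl => e e0.
rewrite addr0.
(* Near 0 the factor [phi t] makes this 0, whatever the value of the inverse at 0. *)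
pose psi N (t : C) := phi t * (t^-1) ^+ N.
have psi0 N t : rn t < r -> psi N t = 0 by move=> /phi0 h; rewrite /psi h mul0r.
have dpsi N t : differentiable (psi N) t.
  have [->|t0'] := eqVneq t 0.
    apply: (@near_eq_differentiable _ _ (fun=> 0)); last exact: differentiable_cst.
    by apply/nbhs_rnP; exists r => // y; rewrite subr0 => /psi0 ->.
  have dV : differentiable (fun t : C => t^-1) t.
    by apply: (@differentiableV _ _ id) => //; exact: ex_diff.
  by apply: differentiableM; [exact: dphi|exact: differentiable_pow].
have B N : rn (phi t0) <= cauchy_const R * M * (1 / 4) ^+ N.
  have H := @cauchy_bound _ (psi N) M t0 (fun t => differentiable_continuous (dpsi N t))
    (fun t _ => differentiable_ex_cder (dpsi N t)).
  have {}H : rn (psi N t0) <= cauchy_const R * M.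
    apply: H t1 => z /andP[z1 z2]; rewrite /psi rnM rnX rnV.
    apply: le_trans (HM z z2); rewrite ler_piMr ?rn_ge0// exprn_ile1 ?invr_ge0 ?rn_ge0//.
    by rewrite invf_le1// (lt_le_trans ltr01).
  have [e1|t00] := eqVneq t0 0.
    rewrite (phi0 t0) ?rn0; last by rewrite e1 rn0.
    rewrite mulr_ge0 ?exprn_ge0//.
    by apply: le_trans (rn_ge0 _) H.
  have E : phi t0 = psi N t0 * t0 ^+ N by rewrite /psi exprVn mulfVK ?expf_neq0.
  rewrite E rnM rnX; apply: ler_pM => //; rewrite ?exprn_ge0 ?rn_ge0//.
  by rewrite lerXn2r ?nnegrE ?rn_ge0.
pose K := cauchy_const R * M; have K0 : 0 <= K.
  by have := B 0%N; rewrite expr0 mulr1; apply: le_trans; exact: rn_ge0.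
have q0 : 0 <= K / e by rewrite divr_ge0// ltW.
have h1 := archi_boundP q0; set N := Num.bound (K / e) in h1.
apply: le_trans (B N) _; rewrite -/K expr_div_n expr1n mul1r.
rewrite ler_pdivrMr ?exprn_gt0// mulrC -ler_pdivrMr//; apply: le_trans (ltW h1) _.
by rewrite -natrX ler_nat ltnW// ltn_expl.
Qed.

Theorem identity_theorem V (f : V -> C) (z0 : V) :
  (forall y, differentiable f y) -> (\forall y \near z0, f y = 0) -> forall y, f y = 0.
Proof.
move=> df /nbhs_rnP[r r0 rH] y.
pose v := y - z0.
have v1 : 0 < rn v + 1 by rewrite ltr_wpDl// rn_ge0.
have -> : f y = f (z0 + (1 : C) *: v) by rewrite scale1r /v addrC subrK.
apply: (@identity_disc (fun t => f (z0 + t *: v)) (r / (rn v + 1))).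
- exact: divr_gt0.
- by move=> t; exact: (@line_differentiable V f z0 v t (df _)).
move=> t; rewrite ltr_pdivlMr// => tr; apply: rH.
rewrite addrAC subrr add0r rnZ; apply: le_lt_trans tr.
by rewrite ler_wpM2l ?rn_ge0// lerDl.
Qed.

Lemma cderB (f g : C -> C) z k l :
  cder f z k -> cder g z l -> cder (fun t => f t - g t) z (k - l).
Proof.
by move=> /cderP hf /cderP hg; apply/cderP; exact: (@is_deriveB _ _ _ _ _ _ _ _ _ hf hg).
Qed.

(** The coefficient is half of the second derivative along [v]. After subtracting the quadratic
    polynomial, the derivative along the line is o(t), and the mean value inequality integrates this
    to o(t^2). *)
Lemma taylor2 V (f : V -> C) (z v : V) : (\forall y \near z, differentiable f y) ->
  exists b : C, forall e : R, 0 < e -> exists2 d : R, 0 < d & forall t : C, rn t < d ->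
    rn (f (z + t *: v) - f z - 'D_v f z * t - b * t ^+ 2) <= e * rn t ^+ 2.
Proof.
move=> /[dup] df /nbhs_rnP[r r0 rH].
have ddf := differentiable_derive v df.
have v1 : 0 < rn v + 1 by rewrite ltr_wpDl// rn_ge0.
pose l : C := 'D_v ('D_v f) z.
exists (l / 2) => e e0.
have H : cder (fun t : C => 'D_v f (z + t *: v)) 0 l.
  have -> : l = 'D_v ('D_v f) (z + (0 : C) *: v) by rewrite scale0r addr0.
  by apply: differentiable_cder; rewrite scale0r addr0.
have [d d0 dH] := H e e0; exists (Num.min d (r / (rn v + 1))).
  by rewrite lt_min d0 divr_gt0.
move=> t; rewrite lt_min => /andP[td tr].
pose phi (s : C) := f (z + s *: v) - ('D_v f z * s + l / 2 * s ^+ 2).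
have Phi (s : C) : rn s <= rn t ->
    cder phi s ('D_v f (z + s *: v) - ('D_v f z + 2 * (l / 2) * s)).
  move=> st; apply: cderB; last exact: cder_quad.
  apply: differentiable_cder; apply: rH; rewrite addrAC subrr add0r rnZ.
  move: tr; rewrite ltr_pdivlMr//; apply: le_lt_trans.
  by apply: ler_pM; rewrite ?rn_ge0// lerDl.
have xt (x : R) : 0 <= x <= 1 -> rn ((x%:C)%C * t : C) <= rn t.
  move=> /andP[x0 x1]; rewrite rnM rn_real ger0_norm//.
  by rewrite ler_piMl// rn_ge0.
have G (x : R) : 0 <= x <= 1 -> rder (fun x : R => phi (0 + (x%:C)%C * t)) x
    (t * ('D_v f (z + ((x%:C)%C * t) *: v) - ('D_v f z + 2 * (l / 2) * ((x%:C)%C * t)))).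
  move=> xI; have := @cder_path _ phi 0 t _ x; rewrite add0r; apply.
  by apply: Phi; exact: xt.
have := rder_mvt ler01 G (M := e * rn t ^+ 2).
rewrite subr0 mulr1 => B.
have -> : f (z + t *: v) - f z - 'D_v f z * t - l / 2 * t ^+ 2 =
   phi (0 + ((1 : R)%:C)%C * t) - phi (0 + ((0 : R)%:C)%C * t).
  have e1 : 0 + ((1 : R)%:C)%C * t = t by rewrite add0r mul1r.
  have e2 : 0 + ((0 : R)%:C)%C * t = 0 by rewrite add0r mul0r.
  by rewrite e1 e2 /phi scale0r addr0; ring.
apply: B => x xI; have h := xt x xI; set s : C := (x%:C)%C * t in h *.
have := dH s (le_lt_trans h td); rewrite add0r scale0r addr0 => h2.
rewrite rnM (_ : e * rn t ^+ 2 = rn t * (e * rn t)); last by ring.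
apply: ler_wpM2l; first exact: rn_ge0.
have l2 : 2 * (l / 2) = l :> C by rewrite mulrC divfK// pnatr_eq0.
rewrite l2 opprD addrA; apply: le_trans h2 _.
by apply: ler_wpM2l; [exact: ltW|exact: h].
Qed.

End IdentityTheorem.

(** * Second order jets along complex lines *)

Section Jets.
Variable R : realType.
Notation C := (Cplx R).

(* Only the sign of [c], a quarter of the Laplacian of [u] at [0], matters at a
   maximum; [a] and [b] are carried along to make jets compose. *)
Definition jet (u : C -> R) (u0 : R) (a b : C) (c : R) : Prop :=
  forall e : R, 0 < e -> exists2 d : R, 0 < d &
  forall t : C, rn t < d ->
    `|u t - (u0 + complex.Re (a * t) + complex.Re (b * t ^+ 2) + c * rn t ^+ 2)|
      <= e * rn t ^+ 2.

Lemma jet_local u v u0 a b c r : 0 < r ->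
  (forall t, rn t < r -> u t = v t) -> jet u u0 a b c -> jet v u0 a b c.
Proof.
move=> r0 uv H e /H[d d0 dH]; exists (Num.min d r); first by rewrite lt_min d0.
by move=> t; rewrite lt_min => /andP[/dH h /uv <-].
Qed.

Lemma ReZ (k : R) (z : C) : complex.Re ((k%:C)%C * z) = k * complex.Re z.
Proof. by case: z => z1 z2 /=; rewrite mul0r subr0. Qed.

Lemma ReD (z w : C) : complex.Re (z + w) = complex.Re z + complex.Re w.
Proof. by case: z w => ? ? []. Qed.

Lemma jet_cst k : jet (fun=> k) k 0 0 0.
Proof.
move=> e e0; exists 1 => // t _; rewrite !mul0r !addr0 subrr normr0.
by rewrite mulr_ge0 ?sqr_ge0 ?ltW.
Qed.

Lemma jetD u v u0 a b c v0 a' b' c' : jet u u0 a b c -> jet v v0 a' b' c' ->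
  jet (fun t => u t + v t) (u0 + v0) (a + a') (b + b') (c + c').
Proof.
move=> Hu Hv e e0; have e20 : 0 < e / 2 by rewrite divr_gt0.
have [d1 d10 H1] := Hu _ e20; have [d2 d20 H2] := Hv _ e20.
exists (Num.min d1 d2) => [|t]; first by rewrite lt_min d10.
rewrite lt_min => /andP[/H1 h1 /H2 h2].
rewrite !mulrDl !raddfD /=.
set x1 := complex.Re _ in h1 *; set x2 := complex.Re _ in h1 *.
set y1 := complex.Re _ in h2 *; set y2 := complex.Re _ in h2 *.
have -> : e * rn t ^+ 2 = e / 2 * rn t ^+ 2 + e / 2 * rn t ^+ 2 by field.
apply: le_trans (lerD h1 h2); apply: le_trans (ler_normD _ _).
by rewrite le_eqVlt; apply/orP; left; apply/eqP; congr (`|_|); ring.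
Qed.

Lemma jetZ k u u0 a b c : jet u u0 a b c ->
  jet (fun t => k * u t) (k * u0) ((k%:C)%C * a) ((k%:C)%C * b) (k * c).
Proof.
move=> Hu e e0; have k1 : 0 < `|k| + 1 by rewrite ltr_wpDl.
have [d d0 dH] := Hu _ (divr_gt0 e0 k1).
exists d => // t /dH h.
rewrite -!mulrA !ReZ -!mulrDr -mulrBr normrM.
apply: le_trans (ler_wpM2l (normr_ge0 k) h) _.
have -> : `|k| * (e / (`|k| + 1) * rn t ^+ 2) = (`|k| / (`|k| + 1)) * (e * rn t ^+ 2) by ring.
apply: ler_piMl; last by rewrite ler_pdivrMr// mul1r lerDl.
by rewrite mulr_ge0 ?sqr_ge0 ?(ltW e0).
Qed.

Lemma jet_sum (I : Type) (r : seq I) (u : I -> C -> R) u0 (a b : I -> C) (c : I -> R) :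
  (forall i, jet (u i) (u0 i) (a i) (b i) (c i)) ->
  jet (fun t => \sum_(i <- r) u i t) (\sum_(i <- r) u0 i) (\sum_(i <- r) a i)
    (\sum_(i <- r) b i) (\sum_(i <- r) c i).
Proof.
move=> H; elim: r => [|i r IH].
  rewrite !big_nil; apply: (jet_local (r := 1)) (jet_cst 0) => // t _.
  by rewrite big_nil.
rewrite !big_cons; apply: (jet_local (r := 1)) (jetD (H i) IH) => // t _.
by rewrite big_cons.
Qed.

(** Averaging over t, -t, it and -it cancels the terms in t and in t^2 and leaves
    [c * rn t ^+ 2]. *)
Lemma jet_max u u0 a b c r : 0 < r -> u 0 = u0 ->
  (forall t, rn t < r -> u t <= u 0) -> jet u u0 a b c -> c <= 0.
Proof.
move=> r0 u0E um H; rewrite leNgt; apply/negP => c0.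
have [d d0 dH] := H (c / 2) (divr_gt0 c0 (ltr0n _ 2)).
pose s := Num.min d r / 2.
have s0 : 0 < s by rewrite divr_gt0// lt_min d0.
have [sd sr] : s < d /\ s < r.
  have m1 : Num.min d r <= d by rewrite ge_min lexx.
  have m2 : Num.min d r <= r by rewrite ge_min lexx orbT.
  by move: s0; rewrite /s; split; lra.
pose t : C := (s%:C)%C.
have rt : rn t = s by rewrite rn_real gtr0_norm.
have Q (z : C) : rn z = s -> complex.Re (a * z) + complex.Re (b * z ^+ 2) + c / 2 * s ^+ 2 <= 0.
  move=> zs; have := dH z; have := um z; rewrite u0E zs => /(_ sr) h1 /(_ sd).
  by rewrite ler_norml => /andP[h2 _]; lra.
have q1 := Q t rt.
have q2 := Q (- t) ltac:(by rewrite rnN).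
have q3 := Q ('i%C * t) ltac:(by rewrite rnM rn_i mul1r).
have q4 := Q (- ('i%C * t)) ltac:(by rewrite rnN rnM rn_i mul1r).
have cs : 0 < c / 2 * s ^+ 2 by apply: mulr_gt0; [exact: divr_gt0|exact: exprn_gt0].
have iE : ('i%C * t) ^+ 2 = - t ^+ 2 :> C by rewrite exprMn sqr_i mulN1r.
have ReN (z : C) : complex.Re (- z) = - complex.Re z by case: z.
rewrite !mulrN !sqrrN !ReN in q2; rewrite iE mulrN !ReN in q3.
rewrite !mulrN !sqrrN iE mulrN !ReN in q4.
lra.
Qed.

Lemma Re_sqr (w : C) : complex.Re w ^+ 2 = (rn w ^+ 2 + complex.Re (w ^+ 2)) / 2.
Proof. by rewrite rn_sqr; case: w => x y /=; field. Qed.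

Definition peano (f : R -> R) (x0 p1 p2 : R) : Prop := forall e : R, 0 < e ->
  exists2 d : R, 0 < d & forall x : R, `|x| < d ->
    `|f (x0 + x) - f x0 - p1 * x - p2 * x ^+ 2| <= e * x ^+ 2.

(** The second order term of [f] meets the square of the linear part, and Re(at)^2 = (|at|^2 +
    Re((at)^2)) / 2 splits it between the last two coefficients. *)
Lemma jet_comp f u u0 a b c p1 p2 : jet u u0 a b c -> peano f u0 p1 p2 ->
  jet (fun t => f (u t)) (f u0) ((p1%:C)%C * a)
    ((p1%:C)%C * b + ((p2 / 2)%:C)%C * a ^+ 2) (p1 * c + p2 / 2 * rn a ^+ 2).
Proof.
move=> Hu Hf e e0.
(* With [x] the increment of [u] and T = |t|, these give |x - Re(at)| <= A T^2 and |x| <= B T. The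
   error [e] is split into three thirds. *)
pose A := rn b + `|c| + 1; pose B := rn a + A.
have A1 : 1 <= A by rewrite /A; have := rn_ge0 b; have := normr_ge0 c; lra.
have B1 : 1 <= B by rewrite /B; have := rn_ge0 a; lra.
pose e1 := Num.min 1 (e / (3 * (`|p1| + 1))).
have p10 : 0 < `|p1| + 1 by rewrite ltr_wpDl.
have e10 : 0 < e1 by rewrite lt_min ltr01 divr_gt0// mulr_gt0.
have [e11 e12] : e1 <= 1 /\ e1 * (3 * (`|p1| + 1)) <= e.
  split; first by rewrite ge_min lexx.
  by rewrite -ler_pdivlMr ?mulr_gt0// ge_min lexx orbT.
have e30 : 0 < e / (3 * B ^+ 2).
  by rewrite divr_gt0// mulr_gt0// exprn_gt0//; lra.
have [d2 d20 H2] := Hf _ e30; have [d1 d10 H1] := Hu _ e10.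
have p20 : 0 < `|p2| + 1 by rewrite ltr_wpDl.
pose q := 3 * (2 * A * B * (`|p2| + 1)).
have q0 : 0 < q by rewrite !mulr_gt0//; lra.
pose d := Num.min (Num.min 1 d1) (Num.min (d2 / B) (e / q)).
exists d; first by rewrite !lt_min ltr01 d10 !divr_gt0//; lra.
move=> t; rewrite !lt_min => /andP[/andP[t1 td1] /andP[]].
rewrite !ltr_pdivlMr//; last lra; move=> td2 tq.
have T0 := rn_ge0 t; set T := rn t in t1 td1 td2 tq T0 *.
pose x := u t - u0; pose l := complex.Re (a * t); pose m := complex.Re (b * t ^+ 2).
have h1 : `|x - (l + m + c * T ^+ 2)| <= e1 * T ^+ 2.
  have := H1 t td1; rewrite -/T -/l -/m.
  have -> : u t - (u0 + l + m + c * T ^+ 2) = x - (l + m + c * T ^+ 2) by rewrite /x; ring.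
  by [].
have lT : `|l| <= rn a * T by rewrite /T -rnM; exact: rn_ge_Re.
have mT : `|m| <= rn b * T ^+ 2 by rewrite /T -rnX -rnM; exact: rn_ge_Re.
have T2 : 0 <= T ^+ 2 by exact: sqr_ge0.
have xl : `|x - l| <= A * T ^+ 2.
  have -> : x - l = (x - (l + m + c * T ^+ 2)) + (m + c * T ^+ 2) by ring.
  apply: le_trans (ler_normD _ _) _.
  have := ler_normD m (c * T ^+ 2); rewrite normrM (ger0_norm T2).
  have : e1 * T ^+ 2 <= T ^+ 2 by rewrite ler_piMl.
  rewrite /A; lra.
have TT : T ^+ 2 <= T by rewrite expr2 ler_piMl// ltW.
have xB : `|x| <= B * T.
  have -> : x = (x - l) + l by ring.
  apply: le_trans (ler_normD _ _) _.
  have : A * T ^+ 2 <= A * T by rewrite ler_wpM2l//; lra.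
  rewrite /B; lra.
have h2 : `|x ^+ 2 - l ^+ 2| <= 2 * A * B * T * T ^+ 2.
  rewrite subr_sqr normrM.
  have -> : 2 * A * B * T * T ^+ 2 = (A * T ^+ 2) * (2 * B * T) by ring.
  apply: ler_pM => //; apply: le_trans (ler_normD _ _) _.
  have : rn a * T <= B * T by rewrite ler_wpM2r// /B; lra.
  lra.
have xd2 : `|x| < d2 by apply: le_lt_trans xB _; rewrite [ltLHS]mulrC.
have h3 := H2 x xd2.
have x2 : x ^+ 2 <= B ^+ 2 * T ^+ 2.
  by rewrite -exprMn -real_normK ?num_real// lerXn2r ?nnegrE// mulr_ge0//; lra.
have E : complex.Re (((p1%:C)%C * b + ((p2 / 2)%:C)%C * a ^+ 2) * t ^+ 2) =
   p1 * m + p2 / 2 * complex.Re ((a * t) ^+ 2).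
  rewrite mulrDl ReD -[(p1%:C)%C * b * _]mulrA -[((p2 / 2)%:C)%C * a ^+ 2 * _]mulrA.
  by rewrite !ReZ -exprMn.
have E1 : complex.Re ((p1%:C)%C * a * t) = p1 * l.
  by rewrite -mulrA ReZ.
have E2 : l ^+ 2 = ((rn a * T) ^+ 2 + complex.Re ((a * t) ^+ 2)) / 2.
  by rewrite /l Re_sqr rnM.
rewrite E E1 -/T.
have -> : f (u t) - (f u0 + p1 * l + (p1 * m + p2 / 2 * complex.Re ((a * t) ^+ 2)) +
   (p1 * c + p2 / 2 * rn a ^+ 2) * T ^+ 2) =
  (f (u0 + x) - f u0 - p1 * x - p2 * x ^+ 2) + p1 * (x - (l + m + c * T ^+ 2))
   + p2 * (x ^+ 2 - l ^+ 2).
  by rewrite E2 /x [u0 + _]addrC subrK; field.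
apply: le_trans (ler_normD _ _) _.
have b1 : `|p2 * (x ^+ 2 - l ^+ 2)| <= e / 3 * T ^+ 2.
  rewrite normrM; apply: le_trans (ler_wpM2l (normr_ge0 p2) h2) _.
  have -> : `|p2| * (2 * A * B * T * T ^+ 2) = (`|p2| * (2 * A * B * T)) * T ^+ 2 by ring.
  rewrite ler_wpM2r//; apply: le_trans (_ : (`|p2| + 1) * (2 * A * B * T) <= _).
    by rewrite ler_wpM2r ?lerDl// !mulr_ge0//; lra.
  by move: tq; rewrite /q; lra.
have b2 : `|p1 * (x - (l + m + c * T ^+ 2))| <= e / 3 * T ^+ 2.
  rewrite normrM; apply: le_trans (ler_wpM2l (normr_ge0 p1) h1) _.
  rewrite mulrA ler_wpM2r//; apply: le_trans (_ : (`|p1| + 1) * e1 <= _).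
    by rewrite ler_wpM2r ?lerDl// ltW.
  by lra.
have b3 : `|f (u0 + x) - f u0 - p1 * x - p2 * x ^+ 2| <= e / 3 * T ^+ 2.
  apply: le_trans h3 _; apply: le_trans (ler_wpM2l (ltW e30) x2) _.
  have B0 : B != 0 by rewrite gt_eqF//; lra.
  by rewrite le_eqVlt; apply/orP; left; apply/eqP; field.
have := ler_normD (f (u0 + x) - f u0 - p1 * x - p2 * x ^+ 2) (p1 * (x - (l + m + c * T ^+ 2))).
lra.
Qed.

Lemma is_derive_epsE (f : R -> R) (x l : R) : is_derive x 1 f l ->
  forall e : R, 0 < e -> exists2 d : R, 0 < d &
    forall t, `|t| < d -> `|f (x + t) - f x - t * l| <= e * `|t|.
Proof.
move=> [dx <-] e e0.
have /cvgrPdist_le /(_ _ e0) /nbhs_ballP[d /= d0 dH] :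
  (t^-1 *: (f (t *: 1 + x) - f x)) @[t --> (0 : R)^'] --> 'D_1 f x by exact: dx.
exists d => // t td; have [->|t0] := eqVneq t 0.
  by rewrite addr0 subrr mul0r subr0 !normr0 mulr0.
have := dH t; rewrite /ball /= sub0r normrN => /(_ td t0) h.
have -> : f (x + t) - f x - t * 'D_1 f x =
   - (t * ('D_1 f x - t^-1 * (f (x + t) - f x))) by field.
rewrite normrN normrM mulrC; apply: ler_wpM2r => //.
by move: h; rewrite [t *: 1]mulr1 [t + x]addrC.
Qed.

Lemma peano_derive (f f' : R -> R) (x0 p2 r : R) : 0 < r ->
  (forall x : R, `|x - x0| < r -> is_derive x 1 f (f' x)) ->
  is_derive x0 1 f' (2 * p2) -> peano f x0 (f' x0) p2.
Proof.
move=> r0 Hf /is_derive_epsE Hf' e e0.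
have [d d0 dH] := Hf' _ e0; exists (Num.min d r); first by rewrite lt_min d0.
move=> x; rewrite lt_min => /andP[xd xr].
pose phi (s : R) := f (x0 + s * x) - (f' x0 * x) * s - (p2 * x ^+ 2) * s ^+ 2.
pose phi' (s : R) := x * (f' (x0 + s * x) - f' x0 - (s * x) * (2 * p2)).
have small (s : R) : 0 <= s <= 1 -> `|s * x| <= `|x|.
  by move=> /andP[s0 s1]; rewrite normrM ger0_norm// ler_piMl.
have Dphi (s : R) : 0 <= s <= 1 -> is_derive s 1 phi (phi' s).
  move=> sI.
  have H1 : is_derive s 1 (fun s => f (x0 + s * x)) (x * f' (x0 + s * x)).
    have g1 : is_derive s 1 (fun s => x0 + s * x) x.
      have -> : (fun s => x0 + s * x) = (fun=> x0) + (fun s => s * x) by [].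
      have g2 : is_derive s 1 (fun s : R => s * x) x.
        have -> : (fun s : R => s * x) = x \*: id.
          by apply/funext => y; rewrite /= mulrC.
        by apply: is_derive_eq; rewrite [_ *: _]mulr1.
      by apply: is_derive_eq; rewrite add0r.
    have g3 : is_derive (x0 + s * x) 1 f (f' (x0 + s * x)).
      by apply: Hf; rewrite addrAC subrr add0r; apply: le_lt_trans xr; exact: small.
    have := @is_derive1_comp _ f (fun s => x0 + s * x) s _ _ g3 g1.
    by rewrite mulrC.
  have H2 : is_derive s 1 (fun s : R => (f' x0 * x) * s) (f' x0 * x).
    have -> : (fun s : R => (f' x0 * x) * s) = (f' x0 * x) \*: id by [].
    by apply: is_derive_eq; rewrite [_ *: _]mulr1.
  have H3 : is_derive s 1 (fun s : R => (p2 * x ^+ 2) * s ^+ 2) (p2 * x ^+ 2 * (2 * s)).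
    have -> : (fun s : R => (p2 * x ^+ 2) * s ^+ 2) = (p2 * x ^+ 2) \*: (id ^+ 2).
      by apply/funext => y /=; rewrite fctE.
    by apply: is_derive_eq; rewrite expr1 [_ *: 1]mulr1.
  have -> : phi = (fun s => f (x0 + s * x)) - (fun s => (f' x0 * x) * s)
     - (fun s => (p2 * x ^+ 2) * s ^+ 2) by [].
  by apply: is_derive_eq; rewrite /phi'; ring.
have cphi : {within `[0, 1], continuous phi}.
  apply: derivable_within_continuous => s; rewrite in_itv /= => sI.
  by have [] := Dphi s sI.
have [|c] := MVT_segment ler01 _ cphi (df := phi').
  by move=> s; rewrite in_itv /= => /andP[s0 s1]; apply: Dphi; rewrite !ltW.
rewrite in_itv /= => cI; rewrite subr0 mulr1 => E.
have -> : f (x0 + x) - f x0 - f' x0 * x - p2 * x ^+ 2 = phi 1 - phi 0.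
  rewrite /phi mul1r mulr1 expr1n mulr1 mul0r addr0 mulr0 expr0n /= mulr0; ring.
rewrite E /phi' normrM.
have -> : e * x ^+ 2 = `|x| * (e * `|x|).
  by rewrite [RHS]mulrCA -expr2 real_normK ?num_real.
apply: ler_wpM2l => //; apply: le_trans (dH _ (le_lt_trans (small c cI) xd)) _.
by apply: ler_wpM2l; [exact: ltW|exact: small].
Qed.

Lemma peano_ln (x0 : R) : 0 < x0 -> peano (@ln R) x0 x0^-1 (- (x0 ^+ 2)^-1 / 2).
Proof.
move=> x00; apply: (@peano_derive (@ln R) (fun x => x^-1) x0 _ x0) => //.
  move=> x xx; apply: is_derive1_ln.
  by move: xx; rewrite ltr_norml => /andP[]; lra.
have x0n : x0 != 0 by rewrite gt_eqF.
have -> : 2 * (- (x0 ^+ 2)^-1 / 2) = - (x0 ^- 2) *: 1.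
  by rewrite [_ *: 1]mulr1; field.
apply: DeriveDef; first by apply: derivableV => //; exact: derivable_id.
by rewrite deriveV// ?derive_id//; exact: derivable_id.
Qed.

Lemma peano_exp (x0 : R) : peano (@expR R) x0 (expR x0) (expR x0 / 2).
Proof.
apply: (@peano_derive (@expR R) (@expR R) x0 _ 1) => //.
by rewrite mulrC divfK ?pnatr_eq0//; exact: is_derive_expR.
Qed.

Definition cjet (h : C -> C) (h0 h1 h2 : C) : Prop := forall e : R, 0 < e ->
  exists2 d : R, 0 < d & forall t : C, rn t < d ->
    rn (h t - h0 - h1 * t - h2 * t ^+ 2) <= e * rn t ^+ 2.

(** In |h0 + h1 t + h2 t^2|^2 the only multiple of |t|^2 is |h1 t|^2; the cross term of [h0] and
    [h2] is the real part of a multiple of t^2. *)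
Lemma jet_norm2 h h0 h1 h2 : cjet h h0 h1 h2 -> exists b : C,
  jet (fun t => rn (h t) ^+ 2) (rn h0 ^+ 2) (2 * (h0^*)%C * h1) b (rn h1 ^+ 2).
Proof.
move=> H; exists (2 * (h0^*)%C * h2) => e e0.
have n0 := rn_ge0 h0; have n1 := rn_ge0 h1; have n2 := rn_ge0 h2.
pose A := rn h0 + rn h1 + rn h2 + 1.
have A1 : 1 <= A by rewrite /A; lra.
pose e1 := Num.min 1 (e / (6 * A)).
have e10 : 0 < e1 by rewrite lt_min ltr01 divr_gt0// mulr_gt0//; lra.
have [e11 e12] : e1 <= 1 /\ e1 * (6 * A) <= e.
  split; first by rewrite ge_min lexx.
  by rewrite -ler_pdivlMr ?mulr_gt0//; [rewrite ge_min lexx orbT|lra].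
have [d d0 dH] := H _ e10.
have A20 : 0 < 6 * A ^+ 2 by rewrite mulr_gt0// exprn_gt0//; lra.
exists (Num.min (Num.min 1 d) (e / (6 * A ^+ 2))).
  by rewrite !lt_min ltr01 d0 divr_gt0.
move=> t; rewrite !lt_min => /andP[/andP[t1 /dH]] h3; rewrite ltr_pdivlMr// => tA.
have T0 := rn_ge0 t.
have [r [hr lr]] : exists r, r = h t - h0 - h1 * t - h2 * t ^+ 2 /\ rn r <= e1 * rn t ^+ 2.
  by eexists; split; first reflexivity; exact: h3.
pose l := h1 * t; pose m := h2 * t ^+ 2 + r.
have hE : h t = h0 + l + m by rewrite /l /m hr; ring.
have K : rn (h t) ^+ 2 - (rn h0 ^+ 2 + complex.Re (2 * (h0^*)%C * h1 * t) +
   complex.Re (2 * (h0^*)%C * h2 * t ^+ 2) + rn h1 ^+ 2 * rn t ^+ 2) =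
   2 * complex.Re ((h0^*)%C * r) + 2 * complex.Re ((l^*)%C * m) + rn m ^+ 2.
  have e1' : rn h1 ^+ 2 * rn t ^+ 2 = rn l ^+ 2 by rewrite /l rnM exprMn.
  have e2' : 2 * (h0^*)%C * h1 * t = 2 * ((h0^*)%C * l) by rewrite /l; ring.
  have e3' : 2 * (h0^*)%C * h2 * t ^+ 2 = 2 * ((h0^*)%C * (m - r)) by rewrite /m; ring.
  rewrite hE e1' e2' e3' !rn_sqr; move: (l) (m) => [l1 l2] [m1 m2].
  by case: (h0) (r) => [? ?] [? ?] /=; ring.
rewrite K; have T2 : 0 <= rn t ^+ 2 by exact: sqr_ge0.
have TT : rn t ^+ 2 <= rn t by rewrite expr2 ler_piMl// ltW.
have lm : rn l <= A * rn t.
  by rewrite /l rnM ler_wpM2r// /A; lra.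
have mm : rn m <= A * rn t ^+ 2.
  rewrite /m; apply: le_trans (rnD _ _) _; rewrite rnM rnX.
  have : e1 * rn t ^+ 2 <= rn t ^+ 2 by rewrite ler_piMl.
  have : 0 <= (rn h0 + rn h1) * rn t ^+ 2 by rewrite mulr_ge0// addr_ge0.
  rewrite /A; lra.
have i1 : `|complex.Re ((h0^*)%C * r)| <= e / 6 * rn t ^+ 2.
  apply: le_trans (rn_ge_Re _) _; rewrite rnM rnJ.
  apply: le_trans (_ : A * (e1 * rn t ^+ 2) <= _).
    by apply: ler_pM => //; rewrite ?rn_ge0// /A; lra.
  by rewrite mulrA ler_wpM2r//; lra.
have i2 : `|complex.Re ((l^*)%C * m)| <= e / 6 * rn t ^+ 2.
  apply: le_trans (rn_ge_Re _) _; rewrite rnM rnJ.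
  apply: le_trans (ler_pM _ _ lm mm) _; rewrite ?rn_ge0//.
  by rewrite mulrA ler_wpM2r//; lra.
have i3 : rn m ^+ 2 <= e / 6 * rn t ^+ 2.
  apply: le_trans (_ : (A * rn t ^+ 2) ^+ 2 <= _).
    by rewrite lerXn2r ?nnegrE ?rn_ge0// mulr_ge0//; lra.
  have -> : (A * rn t ^+ 2) ^+ 2 = (A ^+ 2 * rn t ^+ 2) * rn t ^+ 2 by ring.
  rewrite ler_wpM2r//; apply: le_trans (_ : A ^+ 2 * rn t <= _); last lra.
  by rewrite ler_wpM2l// sqr_ge0.
have := ler_normD (2 * complex.Re ((h0^*)%C * r) + 2 * complex.Re ((l^*)%C * m)) (rn m ^+ 2).
have := ler_normD (2 * complex.Re ((h0^*)%C * r)) (2 * complex.Re ((l^*)%C * m)).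
rewrite (ger0_norm (sqr_ge0 (rn m))) !normrM (ger0_norm (ler0n _ 2)).
have := mulr_ge0 (ltW e0) T2; lra.
Qed.

End Jets.

(** * The jet metric *)

Section CoreInequality.
Variables (R : realType) (n p kap : nat).
Implicit Types (lam : 'I_n.+1 -> R) (Q : seq 'I_p -> 'I_n.+1 -> R).

(** A product of factors 2 cosh(s lam_i), each at least 1, hence a common bound for all |g_i|^s and
    |g_i|^(-s). *)
Definition tame (s : R) lam := \prod_i (expR (s * lam i) + expR (- (s * lam i))).

Lemma cosh_ge1 (x : R) : 1 <= expR x + expR (- x).
Proof.
have [x0|x0] := leP 0 x.
  by have := expR_ge1Dx x; have := expR_ge0 (- x); lra.
by have := expR_ge1Dx (- x); have := expR_ge0 x; lra.
Qed.

Lemma prod_ge1 (I : finType) (F : I -> R) : (forall i, 1 <= F i) -> 1 <= \prod_i F i.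
Proof.
move=> F1; elim/big_ind : _ => // x y x1 y1.
by rewrite -[1]mulr1 ler_pM.
Qed.

Lemma prod_ge_factor (I : finType) (F : I -> R) i : (forall i, 1 <= F i) ->
  F i <= \prod_i F i.
Proof.
move=> F1; rewrite (bigD1 i)//= ler_peMr//; first exact: le_trans ler01 (F1 i).
by elim/big_ind : _ => // x y x1 y1; rewrite -[1]mulr1 ler_pM.
Qed.

Lemma tame_ge1 s lam : 1 <= tame s lam.
Proof. by apply: prod_ge1 => i; exact: cosh_ge1. Qed.

Lemma tame_ge s lam i : expR (s * lam i) + expR (- (s * lam i)) <= tame s lam.
Proof. exact: (prod_ge_factor i (fun i => cosh_ge1 (s * lam i))). Qed.

(** Each further derivative roughly squares the bound: the exponent of [E] goes from m to 2m + 1, so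
    it is 2^|w| - 1. The 3 in [E] pays for the three terms of the recursion. *)
Lemma Q_bound (s H : R) lam Q : 1 <= H ->
  (forall i, Q [::] i = 1) -> (forall w i, 0 <= Q w i) ->
  (forall i j, Q [:: j] i * expR (s * lam i) <= H * (1 + expR (2 * s * lam i))) ->
  (forall i j w, (size w < kap)%N ->
     Q (j :: w) i <= H * (1 + Q w i ^+ 2) + Q w i * Q [:: j] i) ->
  forall w i, (size w <= kap)%N -> Q w i <= (3 * H * tame s lam) ^+ (2 ^ kap).
Proof.
move=> H1 Q0 Qp h1 h2 w i wk.
set E := 3 * H * tame s lam.
have t1 := tame_ge1 s lam.
have E3 : 3 * H <= E by rewrite /E ler_peMr//; lra.
have E1 : 1 <= E by lra.
suff B : Q w i <= E ^+ (2 ^ size w - 1).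
  apply: le_trans B _; apply: ler_weXn2l => //.
  by apply: leq_trans (leq_subr _ _) _; rewrite leq_pexp2l.
have hj j : Q [:: j] i <= E / 3.
  have e0 : 0 < expR (s * lam i) by exact: expR_gt0.
  have := h1 i j; rewrite -ler_pdivlMr// => h; apply: le_trans h _.
  have -> : H * (1 + expR (2 * s * lam i)) / expR (s * lam i) =
     H * (expR (s * lam i) + expR (- (s * lam i))).
    rewrite expRN (_ : 2 * s * lam i = s * lam i + s * lam i); last by ring.
    by rewrite expRD; field; rewrite gt_eqF.
  have -> : E / 3 = H * tame s lam by rewrite /E; field.
  by rewrite ler_wpM2l ?tame_ge//; lra.
elim: w wk => [|j w IH] wk; first by rewrite Q0.
have {}IH := IH (ltnW wk); rewrite /= expnS.
set m := (2 ^ size w - 1)%N in IH.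
have -> : (2 * 2 ^ size w - 1 = (m + m).+1)%N.
  by rewrite /m mul2n -addnn -addnBA ?expn_gt0// -{1}(subnK (expn_gt0 2 (size w))) addn1 addSn.
have Em : 1 <= E ^+ m by rewrite exprn_ege1.
apply: le_trans (h2 i j w wk) _.
rewrite [E ^+ _.+1]exprS [E ^+ (m + m)]exprD; set e := E ^+ m in IH Em *.
have q0 := Qp w i.
have i1 : Q w i ^+ 2 <= e * e by rewrite expr2 ler_pM.
have i2 : Q w i * Q [:: j] i <= e * (E / 3) by rewrite ler_pM.
have i3 : H * (1 + Q w i ^+ 2) <= E / 3 * (1 + e * e).
  by rewrite ler_pM//; [lra|have := sqr_ge0 (Q w i); lra|lra|lra].
have i4 : e <= e * e by rewrite ler_peMr//; lra.
have i5 : e * (E / 3) <= e * e * (E / 3) by rewrite ler_wpM2r//; lra.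
have i6 : E / 3 * 1 <= E / 3 * (e * e) by rewrite ler_wpM2l//; lra.
lra.
Qed.

Lemma cosh_pow (x : R) (k : nat) (s th : R) :
  0 <= s -> s * k%:R <= th ->
  (expR (s * x) + expR (- (s * x))) ^+ k * expR (th * x) <=
  2 ^+ k * expR ((th + s * k%:R) * Num.max 0 x).
Proof.
move=> s0 sk.
have [x0|x0] := leP 0 x.
  apply: le_trans (_ : (2 * expR (s * x)) ^+ k * expR (th * x) <= _).
    rewrite ler_wpM2r ?expR_ge0// lerXn2r ?nnegrE ?addr_ge0 ?mulr_ge0 ?expR_ge0//.
    have : expR (- (s * x)) <= expR (s * x).
      by rewrite ler_expR; have := mulr_ge0 s0 x0; lra.
    lra.
  rewrite exprMn -expRM_natl -mulrA -expRD.
  by rewrite ler_wpM2l ?exprn_ge0// ler_expR; lra.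
apply: le_trans (_ : (2 * expR (- (s * x))) ^+ k * expR (th * x) <= _).
  rewrite ler_wpM2r ?expR_ge0// lerXn2r ?nnegrE ?addr_ge0 ?mulr_ge0 ?expR_ge0//.
  have : expR (s * x) <= expR (- (s * x)).
    by rewrite ler_expR; have := mulr_ge0 s0 (ltW (_ : 0 < - x)); rewrite oppr_gt0 => /(_ x0); lra.
  lra.
rewrite exprMn -expRM_natl -mulrA -expRD.
rewrite ler_wpM2l ?exprn_ge0// ler_expR mulr0.
have -> : k%:R * - (s * x) + th * x = - ((th - s * k%:R) * (- x)) by ring.
by rewrite oppr_le0 mulr_ge0//; lra.
Qed.

(** This is where (n + 1) th < 1 enters. By [cosh_pow] the product is at most a constant times exp
    of (n + 1)(th + s k) max(0, lam_j), hence of max(0, lam_j). Division by exp(lam_j) absorbs this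
    if lam_j >= 0, and costs at most n + 1 otherwise. *)
Lemma tame_prod (s th : R) lam (k : nat) (j : 'I_n.+1) :
  0 <= s -> s * k%:R <= th -> n.+1%:R * (th + s * k%:R) <= 1 ->
  (forall i, lam i <= lam j) -> n.+1%:R^-1 <= expR (lam j) ->
  tame s lam ^+ k * expR (\sum_i th * lam i) / expR (lam j) <= 2 ^+ (k * n.+1) * n.+1%:R.
Proof.
move=> s0 sk nth jm jn.
have -> : tame s lam ^+ k * expR (\sum_i th * lam i) =
  \prod_i ((expR (s * lam i) + expR (- (s * lam i))) ^+ k * expR (th * lam i)).
  by rewrite expR_sum /tame big_split /= prodrXl.
have th0 : 0 <= th by apply: le_trans sk; rewrite mulr_ge0.
pose c := th + s * k%:R; have c0 : 0 <= c by rewrite addr_ge0// mulr_ge0.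
pose m := Num.max 0 (lam j).
have B : \prod_i ((expR (s * lam i) + expR (- (s * lam i))) ^+ k * expR (th * lam i)) <=
   \prod_(i < n.+1) (2 ^+ k * expR (c * m)).
  apply: ler_prod => i _; apply/andP; split.
    by rewrite mulr_ge0 ?expR_ge0// exprn_ge0// addr_ge0 ?expR_ge0.
  apply: le_trans (cosh_pow _ s0 sk) _.
  rewrite ler_wpM2l ?exprn_ge0// ler_expR ler_wpM2l//.
  by rewrite /m ge_max !le_max lexx jm orbT.
rewrite ler_pdivrMr ?expR_gt0//; apply: le_trans B _.
rewrite prodr_const card_ord exprMn -exprM -mulrA ler_wpM2l ?exprn_ge0//.
have m0 : 0 <= m by rewrite /m le_max lexx.
rewrite -expRM_natl mulrA -/c.
apply: le_trans (_ : expR m <= _).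
  by rewrite ler_expR ler_piMl.
rewrite /m; have [l0|l0] := leP 0 (lam j).
  by rewrite ler_peMl ?expR_ge0// ler1n.
by rewrite expR0 -ler_pdivrMl ?ltr0n// mulr1.
Qed.

(* The pointwise form of the Ahlfors-Schwarz estimate: [lam i] stands for
   [ln |g_i|], [Q w i] for [|D^w g_i / g_i|], [P] for the modulus of the Wronskian,
   and [H] for the reciprocal of the barrier. The exponent of [H] does not depend
   on [s] or [eps]. *)
Lemma core_ineq (s th eps H P : R) lam Q (T : finType) (wd : T -> seq 'I_p) (k : nat)
    (j : 'I_n.+1) :
  k = (2 ^ kap * n.+1 + 2 * n.+1 + (2 * 2 ^ kap + 1) * (#|T| * n.+1))%N ->
  0 <= s -> s * k%:R <= th -> n.+1%:R * (th + s * k%:R) <= 1 ->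
  0 <= eps <= 1 -> 1 <= H ->
  (forall i, Q [::] i = 1) -> (forall w i, 0 <= Q w i) ->
  (forall i j, Q [:: j] i * expR (s * lam i) <= H * (1 + expR (2 * s * lam i))) ->
  (forall i j w, (size w < kap)%N ->
     Q (j :: w) i <= H * (1 + Q w i ^+ 2) + Q w i * Q [:: j] i) ->
  (forall t, (size (wd t) <= kap)%N) ->
  (forall i, lam i <= lam j) -> n.+1%:R^-1 <= expR (lam j) ->
  0 <= P ->
  (forall M, 1 <= M -> (forall w i, (size w <= kap)%N -> Q w i <= M) ->
     P <= (n.+1)`!%:R * (M ^+ n.+1 * (expR (\sum_i lam i) / expR (lam j)))) ->
  P * expR (\sum_i ((th - 1) * lam i + ln (1 + expR (2 * s * lam i)) +
     \sum_t eps * ln (1 + Q (wd t) i ^+ 2))) <=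
  (n.+1)`!%:R * 3 ^+ k * (2 ^+ (k * n.+1) * n.+1%:R) * H ^+ k.
Proof.
move=> kE s0 sk nth /andP[eps0 eps1] H1 Q0 Qp h1 h2 wdk jm jn P0 PM.
have QB := Q_bound H1 Q0 Qp h1 h2.
set E := 3 * H * tame s lam in QB.
have t1 := tame_ge1 s lam.
have E3 : 3 * H <= E by rewrite /E ler_peMr//; lra.
have E1 : 1 <= E by lra.
have EX m : 1 <= E ^+ m by rewrite exprn_ege1.
have {}PM := PM _ (EX (2 ^ kap)%N) QB.
rewrite !big_split /= !expRD.
have b1 : expR (\sum_i ln (1 + expR (2 * s * lam i))) <= E ^+ (2 * n.+1).
  rewrite expR_sum.
  have -> : E ^+ (2 * n.+1) = \prod_(i < n.+1) E ^+ 2 by rewrite prodr_const card_ord exprM.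
  apply: ler_prod => i _; rewrite expR_ge0 /= lnK; last first.
    by rewrite posrE addr_gt0// expR_gt0.
  have -> : 1 + expR (2 * s * lam i) =
     (expR (s * lam i) + expR (- (s * lam i))) * expR (s * lam i).
    rewrite [RHS]mulrDl -!expRD addNr expR0 addrC; congr (expR _ + _); ring.
  have tg := tame_ge s lam i.
  have e1 := expR_ge0 (s * lam i); have e2 := expR_ge0 (- (s * lam i)).
  have tE : tame s lam <= E by rewrite /E ler_peMl//; lra.
  by rewrite expr2 ler_pM//; lra.
have b2 : expR (\sum_i \sum_t eps * ln (1 + Q (wd t) i ^+ 2)) <=
    E ^+ ((2 * 2 ^ kap + 1) * (#|T| * n.+1)).
  rewrite expR_sum mulnA.
  have -> : E ^+ ((2 * 2 ^ kap + 1) * #|T| * n.+1) =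
    \prod_(i < n.+1) E ^+ ((2 * 2 ^ kap + 1) * #|T|).
    by rewrite prodr_const card_ord exprM.
  apply: ler_prod => i _; rewrite expR_ge0 /= expR_sum.
  have -> : E ^+ ((2 * 2 ^ kap + 1) * #|T|) = \prod_(t : T) E ^+ (2 * 2 ^ kap + 1).
    by rewrite prodr_const exprM.
  apply: ler_prod => t _; rewrite expR_ge0 /=.
  have q0 := sqr_ge0 (Q (wd t) i).
  apply: le_trans (_ : expR (ln (1 + Q (wd t) i ^+ 2)) <= _).
    by rewrite ler_expR ler_piMl// ln_ge0//; lra.
  rewrite lnK ?posrE; last lra.
  have -> : E ^+ (2 * 2 ^ kap + 1) = E * (E ^+ (2 ^ kap)) ^+ 2 by rewrite addn1 exprS mulnC exprM.
  have : Q (wd t) i ^+ 2 <= (E ^+ (2 ^ kap)) ^+ 2.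
    by rewrite lerXn2r ?nnegrE// ?QB//; have := EX (2 ^ kap)%N; lra.
  have : 1 <= (E ^+ (2 ^ kap)) ^+ 2 by rewrite exprn_ege1.
  set u := _ ^+ 2 => u1 qu.
  apply: le_trans (_ : 2 * u <= _); first lra.
  by rewrite ler_wpM2r//; lra.
have c1 : expR (\sum_i (th - 1) * lam i) * expR (\sum_i lam i) = expR (\sum_i th * lam i).
  by rewrite -expRD -big_split /=; congr expR; apply: eq_bigr => i _; ring.
(* The three summands of [k] are the powers of [E] spent on the Wronskian, on the factors with [s]
   and on the factors with [eps]. *)
have Ek : E ^+ k = E ^+ (2 ^ kap) ^+ n.+1 * E ^+ (2 * n.+1) *
    E ^+ ((2 * 2 ^ kap + 1) * (#|T| * n.+1)).
  by rewrite kE !exprD exprM.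
set x1 := expR (\sum_i (th - 1) * lam i) in c1 *.
set x2 := expR (\sum_i ln _) in b1 *.
set x3 := expR (\sum_i \sum_t _) in b2 *.
have [x10 x20 x30] : [/\ 0 <= x1, 0 <= x2 & 0 <= x3] by split; exact: expR_ge0.
set M := E ^+ (2 ^ kap) in PM Ek *.
have M1 : 1 <= M by exact: EX.
apply: le_trans (_ : (n.+1)`!%:R * (M ^+ n.+1 * (expR (\sum_i lam i) / expR (lam j))) *
   (x1 * E ^+ (2 * n.+1) * E ^+ ((2 * 2 ^ kap + 1) * (#|T| * n.+1))) <= _).
  apply: ler_pM => //; first by rewrite !mulr_ge0.
  by rewrite ler_pM ?mulr_ge0// ler_wpM2l.
have -> : (n.+1)`!%:R * (M ^+ n.+1 * (expR (\sum_i lam i) / expR (lam j))) *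
   (x1 * E ^+ (2 * n.+1) * E ^+ ((2 * 2 ^ kap + 1) * (#|T| * n.+1))) =
   (n.+1)`!%:R * E ^+ k * ((x1 * expR (\sum_i lam i)) / expR (lam j)).
  by rewrite Ek; ring.
rewrite c1 /E.
have -> : (3 * H * tame s lam) ^+ k = 3 ^+ k * H ^+ k * tame s lam ^+ k by rewrite !exprMn.
have T1 := tame_prod s0 sk nth jm jn.
have -> : (n.+1)`!%:R * (3 ^+ k * H ^+ k * tame s lam ^+ k) *
    (expR (\sum_i th * lam i) / expR (lam j)) =
  (n.+1)`!%:R * 3 ^+ k * H ^+ k * (tame s lam ^+ k * expR (\sum_i th * lam i) / expR (lam j)).
  by ring.
rewrite [leRHS]mulrAC; apply: ler_wpM2l => //.
by rewrite !mulr_ge0 ?exprn_ge0//; lra.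
Qed.

End CoreInequality.

(** * Jets of the logarithms that make up the metric, and column bounds for determinants *)

Section LogJets.
Variable R : realType.
Notation C := (Cplx R).

(** The last coefficient is 0 because ln|h| is harmonic; |a| is kept because it is the logarithmic
    derivative that [jet_softplus] turns into a positive term. *)
Lemma jet_ln_norm (h : C -> C) (h0 h1 h2 : C) : cjet h h0 h1 h2 -> h0 != 0 ->
  exists a b : C, rn a = rn h1 / rn h0 /\ jet (fun t => ln (rn (h t))) (ln (rn h0)) a b 0.
Proof.
move=> H h00; have n0 : 0 < rn h0 by rewrite rn_gt0.
have [b Hb] := jet_norm2 H.
have n2 : 0 < rn h0 ^+ 2 by rewrite exprn_gt0.
have /(jetZ (1 / 2)) J := jet_comp Hb (peano_ln n2).
have lnE (x : R) : 0 <= x -> 1 / 2 * ln (x ^+ 2) = ln x.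
  rewrite le_eqVlt => /predU1P[<-|x0].
    by rewrite expr0n /= ln0 ?mulr0.
  by rewrite lnXn// mulr2n; field.
set a : C := ((1 / 2)%:C)%C * _ in J; set b' : C := ((1 / 2)%:C)%C * _ in J.
exists a, b'; split.
  rewrite /a !rnM !rn_real rnJ rn_nat ger0_norm ?divr_ge0// ger0_norm ?invr_ge0 ?sqr_ge0//.
  by field; rewrite gt_eqF.
have -> : 0 = 1 / 2 * ((rn h0 ^+ 2)^-1 * rn h1 ^+ 2 +
  - ((rn h0 ^+ 2) ^+ 2)^-1 / 2 / 2 * rn (2 * h0^*%C * h1 : C) ^+ 2) :> R.
  by rewrite !rnM rnJ rn_nat; field; rewrite gt_eqF.
rewrite -(lnE (rn h0)) ?rn_ge0//.
by apply: (jet_local (r := 1)) J => // t _; rewrite lnE ?rn_ge0.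
Qed.

(** For L = ln|g| the last coefficient is the square of s |g'/g| |g|^s / (1 + |g|^(2s)). *)
Lemma jet_softplus (L : C -> R) (L0 s : R) (a b : C) : jet L L0 a b 0 ->
  exists a' b' : C, jet (fun t => ln (1 + expR (2 * s * L t))) (ln (1 + expR (2 * s * L0)))
    a' b' (s ^+ 2 * rn a ^+ 2 * expR (2 * s * L0) / (1 + expR (2 * s * L0)) ^+ 2).
Proof.
move=> /(jetZ (2 * s)) J1; have J2 := jet_comp J1 (peano_exp _).
have J3 := jetD (jet_cst 1) J2; set e := expR (2 * s * L0) in J3 *.
have e0 : 0 < e by exact: expR_gt0.
have p1 : 0 < 1 + e by lra.
have J4 := jet_comp J3 (peano_ln p1).
rewrite (_ : s ^+ 2 * rn a ^+ 2 * e / (1 + e) ^+ 2 = (1 + e)^-1 *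
  (0 + (e * (2 * s * 0) + e / 2 / 2 * rn (((2 * s)%:C)%C * a : C) ^+ 2)) +
  - ((1 + e) ^+ 2)^-1 / 2 / 2 * rn (0 + (e%:C)%C * (((2 * s)%:C)%C * a) : C) ^+ 2).
  by do 2 eexists; exact: J4.
rewrite !add0r !rnM !rn_real !exprMn !real_normK ?num_real//.
by field; rewrite gt_eqF.
Qed.

Lemma jet_ln1p_norm2 (q : C -> C) (q0 q1 q2 : C) : cjet q q0 q1 q2 ->
  exists a b : C, jet (fun t => ln (1 + rn (q t) ^+ 2)) (ln (1 + rn q0 ^+ 2))
    a b (rn q1 ^+ 2 / (1 + rn q0 ^+ 2) ^+ 2).
Proof.
move=> /jet_norm2[b J]; have J3 := jetD (jet_cst 1) J.
have p1 : 0 < 1 + rn q0 ^+ 2 by rewrite ltr_wpDr// sqr_ge0.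
have J4 := jet_comp J3 (peano_ln p1).
rewrite (_ : rn q1 ^+ 2 / (1 + rn q0 ^+ 2) ^+ 2 = (1 + rn q0 ^+ 2)^-1 * (0 + rn q1 ^+ 2) +
  - ((1 + rn q0 ^+ 2) ^+ 2)^-1 / 2 / 2 * rn (0 + 2 * q0^*%C * q1 : C) ^+ 2).
  by do 2 eexists; exact: J4.
rewrite !add0r !rnM rnJ rn_nat.
by field; rewrite gt_eqF.
Qed.

(** The last coefficient is minus the square of the Poincare density 1 / (1 - |z|^2): what the
    barrier costs at a maximum. *)
Lemma jet_ln_disc (z : C) : rn z < 1 -> exists a b : C,
  jet (fun t => ln (1 - rn (z + t) ^+ 2)) (ln (1 - rn z ^+ 2)) a b
    (- (1 - rn z ^+ 2) ^- 2).
Proof.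
move=> z1; have n0 := rn_ge0 z.
have J0 : cjet (fun t => z + t) z 1 0.
  move=> e e0; exists 1 => // t _.
  rewrite (_ : _ - _ = 0 :> C); last by ring.
  by rewrite rn0 mulr_ge0 ?sqr_ge0// ltW.
have [b J] := jet_norm2 J0; have J3 := jetD (jet_cst 1) (jetZ (-1) J).
have p1 : 0 < 1 + -1 * rn z ^+ 2.
  by rewrite mulN1r subr_gt0 expr_lt1.
have J4 := jet_comp J3 (peano_ln p1).
have E x : 1 - x = 1 + -1 * x :> R by rewrite mulN1r.
rewrite (_ : - (1 - rn z ^+ 2) ^- 2 = (1 + -1 * rn z ^+ 2)^-1 *
  (0 + -1 * rn (1 : C) ^+ 2) +
  - ((1 + -1 * rn z ^+ 2) ^+ 2)^-1 / 2 / 2 * rn (0 + ((-1)%:C)%C * (2 * z^*%C * 1) : C) ^+ 2).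
  rewrite (E (rn z ^+ 2)); do 2 eexists.
  by apply: (jet_local (r := 1)) J4 => // t _; rewrite E.
rewrite !add0r !rnM rnJ !rn1 rn_nat rn_real normrN1 E.
by field; rewrite gt_eqF.
Qed.

Lemma cjet_line (V : normedModType C) (f : V -> C) (z v : V) :
  (\forall y \near z, differentiable f y) ->
  exists b, cjet (fun t => f (z + t *: v)) (f z) ('D_v f z) b.
Proof. by move=> /taylor2 -/(_ v)[b H]; exists b. Qed.

Lemma det_bound n (M : 'M[C]_n) (c : 'I_n -> R) :
  (forall a i, rn (M a i) <= c i) -> rn (\det M) <= n`!%:R * \prod_i c i.
Proof.
move=> H; apply: le_trans (rn_sum _ _ _) _.
apply: le_trans (_ : \sum_(s : {perm 'I_n}) \prod_i c i <= _); last first.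
  by rewrite sumr_const card_Sn mulr_natl.
apply: ler_sum => s _; rewrite rnM rnX rnN rn1 expr1n mul1r rn_prod.
rewrite [leRHS](reindex_inj (@perm_inj _ s)) /=.
by apply: ler_prod => i _; rewrite rn_ge0 /=.
Qed.

Lemma det_col_sum n (M : 'M[C]_n) (j : 'I_n) :
  \det M = \det (\matrix_(a, i) (if i == j then \sum_k M a k else M a i)).
Proof.
pose T : 'M[C]_n := \matrix_(a, i) (if i == j then 1 else (a == i)%:R).
have -> : \matrix_(a, i) (if i == j then \sum_k M a k else M a i) = M *m T.
  apply/matrixP => a i; rewrite !mxE; case: ifP => [/eqP ij|ij].
    by apply: eq_bigr => k _; rewrite mxE ij eqxx mulr1.
  rewrite (bigD1 i)//= !mxE ij eqxx mulr1 big1 ?addr0// => k ki.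
  by rewrite mxE ij (negbTE ki) mulr0.
rewrite det_mulmx [\det T](expand_det_row _ j) (bigD1 j)//= mxE eqxx mul1r.
rewrite big1 ?addr0 => [|i ij].
  rewrite /cofactor (_ : row' j (col' j T) = 1%:M) ?det1 ?mulr1.
    by rewrite -signr_odd addnn odd_double expr0 mulr1.
  apply/matrixP => a i; rewrite !mxE eq_sym (negbTE (neq_lift _ _)).
  by rewrite (inj_eq lift_inj).
by rewrite mxE (negbTE ij) eq_sym (negbTE ij) mul0r.
Qed.

(** Replacing column [j] by the sum of all columns keeps the determinant and saves the factor [c j].
    For Wronskians the row sums are derivatives of sum g_i = 1. *)
Lemma det_col_bound n (M : 'M[C]_n) (c : 'I_n -> R) (j : 'I_n) :
  (forall a i, rn (M a i) <= c i) -> (forall a, rn (\sum_k M a k) <= 1) ->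
  rn (\det M) <= n`!%:R * \prod_(i | i != j) c i.
Proof.
move=> H Hj; rewrite (det_col_sum M j).
have := @det_bound _ (\matrix_(a, i) (if i == j then \sum_k M a k else M a i))
  (fun i => if i == j then 1 else c i).
rewrite (bigD1 j)//= eqxx mul1r => h; apply: le_trans (h _) _.
  by move=> a i; rewrite mxE; case: ifP.
rewrite ler_wpM2l// le_eqVlt; apply/orP; left; apply/eqP.
by apply: eq_bigr => i /negbTE ->.
Qed.

End LogJets.

(** * Iterated partial derivatives *)

Section Partials.
Variables (R : realType) (p : nat).
Notation C := (Cplx R).
Notation V := 'rV[C]_p.

Definition dir (j : 'I_p) : V := delta_mx 0 j.

Definition Dw (w : seq 'I_p) (f : V -> C) : V -> C :=
  foldr (fun j h => 'D_(dir j) h) f w.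

Lemma Dw_differentiable w (f : V -> C) (U : set V) : open U ->
  (forall y, U y -> differentiable f y) -> forall y, U y -> differentiable (Dw w f) y.
Proof.
move=> Uo Hf; elim: w => [//|j w IH] y Uy /=.
apply: differentiable_derive.
have : \forall x \near y, U x by apply: open_nbhs_nbhs; split.
by apply: filterS => x; exact: IH.
Qed.

Lemma Dw_entire w (f : V -> C) : (forall y, differentiable f y) ->
  forall y, differentiable (Dw w f) y.
Proof.
by move=> Hf y; apply: (@Dw_differentiable _ _ setT) => //; exact: openT.
Qed.

Lemma Dw_sum w (I : Type) (r : seq I) (f : I -> V -> C) :
  (forall i y, differentiable (f i) y) ->
  Dw w (fun y => \sum_(i <- r) f i y) = fun y => \sum_(i <- r) Dw w (f i) y.
Proof.
move=> Hf; elim: w => [//|j w IH] /=; rewrite IH; apply/funext => y.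
elim: r {IH} => [|i r IHr].
  have -> : (fun y => \sum_(i <- [::]) Dw w (f i) y) = fun=> 0.
    by apply/funext => x; rewrite big_nil.
  by rewrite derive_cst big_nil.
have -> : (fun y => \sum_(i <- i :: r) Dw w (f i) y) =
  Dw w (f i) + (fun y => \sum_(i <- r) Dw w (f i) y).
  by apply/funext => x; rewrite big_cons.
rewrite deriveD; first by rewrite IHr big_cons.
  by apply: diff_derivable; exact: Dw_entire.
apply: diff_derivable; elim: r {IHr} => [|k r IHr].
  have -> : (fun y => \sum_(i <- [::]) Dw w (f i) y) = fun=> 0.
    by apply/funext => x; rewrite big_nil.
  exact: differentiable_cst.
have -> : (fun y => \sum_(i <- k :: r) Dw w (f i) y) =
  Dw w (f k) + (fun y => \sum_(i <- r) Dw w (f i) y).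
  by apply/funext => x; rewrite big_cons.
by apply: differentiableD; [apply: Dw_entire; exact: Hf|exact: IHr].
Qed.

Lemma Dw_cst w (c : C) : w != [::] -> Dw w (fun=> c) = fun=> 0.
Proof.
elim: w => [//|j [|k w] IH] _ /=; apply/funext => y.
  by rewrite -[LHS]/('D_(dir j) (cst c) y) derive_cst.
have -> : 'D_(dir k) (Dw w (fun=> c)) = cst 0 by exact: IH.
by rewrite derive_cst.
Qed.

Lemma Dw_scale w (f : V -> C) (z0 : V) (r : C) (y : V) :
  (forall y, differentiable f y) ->
  Dw w (fun y => f (z0 + r *: y)) y = r ^+ size w * Dw w f (z0 + r *: y).
Proof.
move=> Hf; elim: w y => [|j w IH] y /=; first by rewrite mul1r.
have -> : Dw w (fun y => f (z0 + r *: y)) = fun y => r ^+ size w * Dw w f (z0 + r *: y).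
  by apply/funext.
set h := Dw w f; have dh : forall y, differentiable h y by exact: Dw_entire.
have L : is_derive (z0 + r *: y) (r *: dir j) h (r * 'D_(dir j) h (z0 + r *: y)).
  apply: DeriveDef; first exact: diff_derivable.
  by rewrite !deriveE// linearZ.
have L2 : is_derive y (dir j) (fun y => h (z0 + r *: y)) (r * 'D_(dir j) h (z0 + r *: y)).
  apply/is_derive_cder; move/is_derive_cder : L.
  have -> // : (fun t => h (t *: (r *: dir j) + (z0 + r *: y))) =
    (fun t => h (z0 + r *: (t *: dir j + y))).
  apply/funext => t; congr h.
  by rewrite scalerDr !scalerA [t * r]mulrC addrCA.
have L3 : is_derive y (dir j) (r ^+ size w \*: (fun y => h (z0 + r *: y)))
  (r ^+ size w *: (r * 'D_(dir j) h (z0 + r *: y))) by exact: is_deriveZ.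
have -> : (fun y => r ^+ size w * h (z0 + r *: y)) =
  (r ^+ size w \*: (fun y => h (z0 + r *: y))) by [].
by rewrite (@derive_val _ _ _ _ _ _ _ L3) exprSr -mulrA.
Qed.

End Partials.

Section DiffDet.
Variable R : realType.
Notation C := (Cplx R).
Variable V : normedModType C.

Lemma differentiable_bigsum (I : Type) (r : seq I) (f : I -> V -> C) (z : V) :
  (forall i, differentiable (f i) z) -> differentiable (fun y => \sum_(i <- r) f i y) z.
Proof.
move=> Hf; elim: r => [|i r IH].
  have -> : (fun y => \sum_(i <- [::]) f i y) = fun=> 0 by apply/funext => y; rewrite big_nil.
  exact: differentiable_cst.
have -> : (fun y => \sum_(i <- i :: r) f i y) = f i + (fun y => \sum_(i <- r) f i y).
  by apply/funext => y; rewrite big_cons.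
by apply: differentiableD; [exact: Hf|exact: IH].
Qed.

Lemma differentiable_bigprod (I : Type) (r : seq I) (f : I -> V -> C) (z : V) :
  (forall i, differentiable (f i) z) -> differentiable (fun y => \prod_(i <- r) f i y) z.
Proof.
move=> Hf; elim: r => [|i r IH].
  have -> : (fun y => \prod_(i <- [::]) f i y) = fun=> 1 by apply/funext => y; rewrite big_nil.
  exact: differentiable_cst.
have -> : (fun y => \prod_(i <- i :: r) f i y) = f i * (fun y => \prod_(i <- r) f i y).
  by apply/funext => y; rewrite big_cons.
by apply: differentiableM; [exact: Hf|exact: IH].
Qed.

Lemma differentiable_det n (M : V -> 'M[C]_n) (z : V) :
  (forall a i, differentiable (fun y => M y a i) z) -> differentiable (fun y => \det (M y)) z.
Proof.
move=> HM.
apply: (@differentiable_bigsum _ _ (fun (s : {perm 'I_n}) y => (-1) ^+ s * \prod_i M y i (s i))) => s.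
apply: differentiableM; first exact: differentiable_cst.
exact: (@differentiable_bigprod _ _ (fun i y => M y i (s i))).
Qed.

Lemma continuous_bigsum (I : Type) (r : seq I) (f : I -> V -> R) (z : V) :
  (forall i, {for z, continuous (f i)}) -> {for z, continuous (fun y => \sum_(i <- r) f i y)}.
Proof.
move=> Hf; elim: r => [|i r IH].
  have -> : (fun y => \sum_(i <- [::]) f i y) = fun=> 0 by apply/funext => y; rewrite big_nil.
  exact: cst_continuous.
have -> : (fun y => \sum_(i <- i :: r) f i y) = f i + (fun y => \sum_(i <- r) f i y).
  by apply/funext => y; rewrite big_cons.
exact: (@continuousD R R V (f i) _ z (Hf i) IH).
Qed.

Lemma continuous_bigprod (I : Type) (r : seq I) (f : I -> V -> R) (z : V) :
  (forall i, {for z, continuous (f i)}) -> {for z, continuous (fun y => \prod_(i <- r) f i y)}.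
Proof.
move=> Hf; elim: r => [|i r IH].
  have -> : (fun y => \prod_(i <- [::]) f i y) = fun=> 1 by apply/funext => y; rewrite big_nil.
  exact: cst_continuous.
have -> : (fun y => \prod_(i <- i :: r) f i y) = f i \* (fun y => \prod_(i <- r) f i y).
  by apply/funext => y; rewrite big_cons.
exact: (@continuousM R V (f i) _ z (Hf i) IH).
Qed.

Lemma continuous_ln_comp (f : V -> R) (z : V) : 0 < f z ->
  {for z, continuous f} -> {for z, continuous (fun y => ln (f y))}.
Proof. by move=> f0 fc; apply: (continuous_comp fc); exact: continuous_ln. Qed.

Lemma continuous_exp_comp (f : V -> R) (z : V) :
  {for z, continuous f} -> {for z, continuous (fun y => expR (f y))}.
Proof. by move=> fc; apply: (continuous_comp fc); exact: continuous_expR. Qed.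

Lemma continuous_rn_comp (f : V -> C) (z : V) :
  differentiable f z -> {for z, continuous (fun y => rn (f y))}.
Proof.
move=> /differentiable_continuous fc; apply: (continuous_comp fc).
exact: rn_continuous.
Qed.

Lemma continuous_lin (f : V -> R) (z : V) (k : R) :
  {for z, continuous f} -> {for z, continuous (fun y => k * f y)}.
Proof.
by move=> fc; apply: (fun h => @continuousM R V (fun=> k) f z h fc); exact: cst_continuous.
Qed.

Lemma continuous_addl (f : V -> R) (z : V) (k : R) :
  {for z, continuous f} -> {for z, continuous (fun y => k + f y)}.
Proof.
by move=> fc; apply: (fun h => @continuousD R R V (fun=> k) f z h fc); exact: cst_continuous.
Qed.

End DiffDet.

(** * The jet metric and its continuity *)

Section Metric.
Variables (R : realType) (n p kap d : nat).
Notation C := (Cplx R).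
Notation V := 'rV[C]_p.
Implicit Types (g : 'I_n.+1 -> V -> C) (ws : 'I_n.+1 -> seq 'I_p).

(* The third clause records that the components of [g] are locally [d]-th powers
   up to a nonvanishing factor. *)
Definition admissible g := [/\ forall i y, differentiable (g i) y,
  forall y, \sum_i g i y = 1 &
  forall z0, exists r Cc : R, 0 < r /\ forall i w y, (size w <= kap)%N ->
    rn (y - z0) < r -> rn (Dw w (g i) y) ^+ d <= Cc * rn (g i y) ^+ (d - kap)].

(** Words of length at most [kap - 1] suffice, because the maximum principle bounds one further
    derivative of each quotient D^w g / g. *)
Definition word := {bseq kap.-1 of 'I_p}.

Variables (s th eps : R).

Definition lam g (i : 'I_n.+1) (z : V) : R := ln (rn (g i z)).

Definition qf g (w : seq 'I_p) i z : C := Dw w (g i) z / g i z.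

Definition log_density_at g i z : R := (th - 1) * lam g i z + ln (1 + expR (2 * s * lam g i z)) +
  \sum_(t : word) eps * ln (1 + rn (qf g t i z) ^+ 2).

Definition log_density g z : R := \sum_i log_density_at g i z.

Definition Wr g ws z : C := \det (\matrix_(a, i) Dw (ws a) (g i) z).

(* The jet metric [|W| prod_i |g_i|^(th-1) (1 + |g_i|^(2s))
   prod_w (1 + |D^w g_i / g_i|^2)^eps]. For kap/d < th and small [eps] it extends
   continuously by zero to the zeros of the [g_i]. *)
Definition metric g ws z : R :=
  if [forall i, g i z != 0] then rn (Wr g ws z) * expR (log_density g z) else 0.

Lemma Wr_differentiable g ws z : (forall i y, differentiable (g i) y) ->
  differentiable (Wr g ws) z.
Proof.
move=> Hg; apply: (@differentiable_det _ _ _ (fun z => \matrix_(a, i) Dw (ws a) (g i) z)).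
move=> a i; have -> : (fun y => (\matrix_(a, i) Dw (ws a) (g i) y) a i) = Dw (ws a) (g i).
  by apply/funext => y; rewrite mxE.
by apply: Dw_entire; exact: Hg.
Qed.

Lemma qf_differentiable g w i z : (forall i y, differentiable (g i) y) ->
  g i z != 0 -> differentiable (qf g w i) z.
Proof.
move=> Hg gz; have dV : differentiable (fun y => (g i y)^-1) z.
  by apply: differentiableV gz; exact: Hg.
apply: (@differentiableM _ _ (Dw w (g i)) _ z _ dV).
by apply: Dw_entire; exact: Hg.
Qed.

Lemma nonzero_near g z : (forall i y, differentiable (g i) y) ->
  (forall i, g i z != 0) -> \forall y \near z, forall i, g i y != 0.
Proof.
move=> Hg gz.
have H i : \forall y \near z, g i y != 0.
  have /continuous_rnP fc := differentiable_continuous (Hg i z).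
  have n0 : 0 < rn (g i z) by rewrite rn_gt0.
  have [r r0 rH] := fc _ n0; apply/nbhs_rnP; exists r => // y /rH.
  by apply: contraTneq => ->; rewrite sub0r rnN -leNgt.
exact: (@filter_forall _ _ (fun i y => g i y != 0) (nbhs z) _ H).
Qed.

Lemma log_density_at_continuous g i z : (forall i y, differentiable (g i) y) ->
  g i z != 0 -> {for z, continuous (log_density_at g i)}.
Proof.
move=> Hg gz; have lc : {for z, continuous (lam g i)}.
  apply: continuous_ln_comp; first by rewrite rn_gt0.
  exact/continuous_rn_comp/Hg.
have c1 := continuous_lin (k := th - 1) lc.
have c2 : {for z, continuous (fun z => ln (1 + expR (2 * s * lam g i z)))}.
  apply: continuous_ln_comp; first by rewrite addr_gt0// expR_gt0.
  by apply: continuous_addl; apply: continuous_exp_comp; exact: continuous_lin.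
have c3 : {for z, continuous (fun z => \sum_(t : word) eps * ln (1 + rn (qf g t i z) ^+ 2))}.
  apply: continuous_bigsum => t; apply: continuous_lin.
  apply: continuous_ln_comp; first by rewrite ltr_wpDr// sqr_ge0.
  apply: (@continuous_addl _ _ (fun z => rn (qf g t i z) ^+ 2) z 1).
  have cq := continuous_rn_comp (qf_differentiable t Hg gz).
  exact: (@continuousM R V _ _ z cq cq).
exact: (@continuousD R R V _ _ z (@continuousD R R V _ _ z c1 c2) c3).
Qed.

Lemma metric_continuous_nonzero g ws z : (forall i y, differentiable (g i) y) ->
  (forall i, g i z != 0) -> {for z, continuous (metric g ws)}.
Proof.
move=> Hg gz.
have cF : {for z, continuous (fun z => rn (Wr g ws z) * expR (log_density g z))}.
  have c1 := continuous_rn_comp (Wr_differentiable ws z Hg).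
  have c2 : {for z, continuous (fun z => expR (log_density g z))}.
    apply: continuous_exp_comp; apply: continuous_bigsum => i.
    by apply: log_density_at_continuous.
  exact: (@continuousM R V _ _ z c1 c2).
have [r r0 rH] := (nbhs_rnP _ _).1 (nonzero_near Hg gz).
apply/continuous_rn_real => e e0.
have [r' r'0 r'H] := (continuous_rn_real _ _).1 cF e e0.
exists (Num.min r r') => [|y]; first by rewrite lt_min r0.
rewrite lt_min => /andP[/rH gy /r'H]; rewrite /metric.
by rewrite (introT forallP gy) (introT forallP gz).
Qed.

Lemma row_sum_bound g ws y a : admissible g -> rn (\sum_k Dw (ws a) (g k) y) <= 1.
Proof.
move=> [Hg g1 _]; have := Dw_sum (ws a) (index_enum _) Hg.
have -> : (fun y => \sum_i g i y) = fun=> 1 by apply/funext.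
move=> /(congr1 (fun h => h y)) <-; have [->|w0] := eqVneq (ws a) [::].
  by rewrite /= rn1.
by rewrite Dw_cst// rn0.
Qed.

(** Near a zero of some g_i, admissibility gives |D^w g_i| <= C1 |g_i|^(1 - rho) with rho = kap/d.
    Collecting exponents, every |g_i| occurs to the power (1 - rho) + (th - 1) - 2 rho eps #|word| =
    [sig] > 0, so the metric tends to 0. *)
Lemma metric_continuous g ws : (0 < kap)%N -> (kap <= d)%N -> (0 < d)%N ->
  0 <= eps <= 1 -> 0 <= s ->
  0 < th - kap%:R / d%:R - 2 * (kap%:R / d%:R) * eps * #|word|%:R ->
  admissible g -> (forall a, (size (ws a) <= kap)%N) -> continuous (metric g ws).
Proof.
move=> kap0 kd d0 /andP[eps0 eps1] s0; set rho := kap%:R / d%:R => sig0 adm wsk z0.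
have [Hg g1 gord] := adm.
have [gz|] := boolP [forall i, g i z0 != 0].
  by apply: metric_continuous_nonzero => //; exact/forallP.
rewrite negb_forall => /existsP[i0]; rewrite negbK => /eqP gi0.
have [j gj] : exists j, g j z0 != 0.
  apply/existsP; apply: contraT; rewrite negb_exists => /forallP H.
  have := g1 z0; rewrite big1 => [/esym/eqP|i _]; first by rewrite oner_eq0.
  by apply/eqP; have := H i; rewrite negbK.
have [r [Cc [r0 rH]]] := gord z0.
have d0r : 0 < d%:R :> R by rewrite ltr0n.
have rho0 : 0 < rho by rewrite divr_gt0// ltr0n.
pose C1 : R := Num.max 1 Cc.
have C11 : 1 <= C1 by rewrite le_max lexx.
have B1 i w y : (size w <= kap)%N -> rn (y - z0) < r -> g i y != 0 ->
    rn (Dw w (g i) y) <= C1 * expR ((1 - rho) * lam g i y).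
  move=> wk yr gy.
  have e1 : 0 <= C1 * expR ((1 - rho) * lam g i y) by rewrite mulr_ge0 ?expR_ge0//; lra.
  rewrite -(@ler_pXn2r _ d)// ?nnegrE ?rn_ge0//; apply: le_trans (rH i w y wk yr) _.
  rewrite exprMn -expRM_natl.
  have -> : d%:R * ((1 - rho) * lam g i y) = lam g i y *+ (d - kap).
    by rewrite -[RHS]mulr_natl natrB// /rho; field; rewrite gt_eqF.
  rewrite -[lam g i y *+ _]mulr_natl expRM_natl lnK ?posrE ?rn_gt0//.
  rewrite ler_wpM2r ?exprn_ge0 ?rn_ge0//.
  apply: le_trans (_ : C1 <= _); first by rewrite le_max lexx orbT.
  by rewrite ler_eXnr.
have LB i y : rn (y - z0) < r -> g i y != 0 -> rho * lam g i y <= ln C1.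
  move=> yr gy; have := B1 i [::] y isT yr gy; rewrite /=.
  rewrite -{1}[rn _]lnK ?posrE ?rn_gt0// -/(lam g i y) -ler_pdivrMr ?expR_gt0//.
  rewrite -expRN -expRD => h; rewrite -ler_expR lnK ?posrE; last lra.
  by apply: le_trans h; rewrite ler_expR; lra.
pose Lm := ln C1 / rho.
have LB' i y : rn (y - z0) < r -> g i y != 0 -> lam g i y <= Lm.
  by move=> yr gy; rewrite /Lm ler_pdivlMr// mulrC LB.
have Lm0 : 0 <= Lm by rewrite divr_ge0 ?(ltW rho0)// ln_ge0.
have gj0 : 0 < rn (g j z0) by rewrite rn_gt0.
have [r1 r10 r1H] := (continuous_rnP _ _).1 (differentiable_continuous (Hg j z0))
  (rn (g j z0) / 2) (divr_gt0 gj0 (ltr0n _ 2)).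
have gjB y : rn (y - z0) < r1 -> ln (rn (g j z0) / 2) <= lam g j y.
  move=> /r1H h; have h2 : rn (g j z0) / 2 <= rn (g j y).
    by have := rn_dist (g j z0) (g j y) 0; rewrite !subr0 (rn_distC (g j z0)); lra.
  by rewrite ler_ln ?posrE// ?divr_gt0//; lra.
pose sig := th - rho - 2 * rho * eps * #|word|%:R.
pose K1 := n.+1`!%:R * C1 ^+ n.+1 * expR (`|1 - rho| * (`|ln (rn (g j z0) / 2)| + Lm)).
pose K2 := ln (1 + expR (2 * s * Lm)) + #|word|%:R * (eps * ln (2 * C1 ^+ 2)).
have main y : rn (y - z0) < r -> rn (y - z0) < r1 -> (forall i, g i y != 0) ->
    metric g ws y <= K1 * expR (n.+1%:R * K2 + sig * (n%:R * Lm) + sig * lam g i0 y).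
  move=> yr yr1 gy; rewrite /metric (introT forallP gy).
  have W1 : rn (Wr g ws y) <= K1 * expR ((1 - rho) * \sum_i lam g i y).
    apply: le_trans (@det_col_bound _ _ _ (fun i => C1 * expR ((1 - rho) * lam g i y)) j _ _) _.
    - by move=> a i; rewrite mxE B1.
    - move=> a; under eq_bigr do rewrite mxE.
      exact: row_sum_bound.
    rewrite /K1 -!mulrA ler_wpM2l//.
    have -> : (1 - rho) * \sum_i lam g i y = (1 - rho) * lam g j y +
        \sum_(i | i != j) (1 - rho) * lam g i y.
      by rewrite (bigD1 j)//= mulrDr mulr_sumr.
    rewrite expRD expR_sum big_split /=.
    have p0 : 0 <= \prod_(i | i != j) expR ((1 - rho) * lam g i y).
      by apply: prodr_ge0 => i _; exact: expR_ge0.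
    rewrite [X in _ <= X]mulrA [X in _ <= X]mulrA ler_wpM2r//.
    apply: le_trans (_ : C1 ^+ n.+1 * 1 <= _); last first.
      rewrite -mulrA ler_wpM2l ?exprn_ge0//; first lra.
      rewrite -expRD -[X in X <= _]expR0 ler_expR.
      have a1 : `|lam g j y| <= `|ln (rn (g j z0) / 2)| + Lm.
        rewrite ler_norml; apply/andP; split.
          by have := gjB y yr1; have := ler_norm (- ln (rn (g j z0) / 2)); rewrite normrN; lra.
        by have := LB' j y yr (gy j); have := normr_ge0 (ln (rn (g j z0) / 2)); lra.
      have a2 : `|(1 - rho) * lam g j y| <= `|1 - rho| * (`|ln (rn (g j z0) / 2)| + Lm).
        by rewrite normrM ler_wpM2l.
      by move: a2; rewrite ler_norml => /andP[]; lra.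
    rewrite mulr1 prodr_const; apply: ler_weXn2l => //.
    by rewrite -[X in (_ <= X)%N](card_ord n.+1) max_card.
  have L1 i : log_density_at g i y <= K2 + (th - 1 - 2 * rho * eps * #|word|%:R) * lam g i y.
    have t2 : ln (1 + expR (2 * s * lam g i y)) <= ln (1 + expR (2 * s * Lm)).
      rewrite ler_ln ?posrE ?addr_gt0 ?expR_gt0// lerD2l ler_expR.
      by rewrite ler_wpM2l ?LB'// mulr_ge0.
    have t3 : \sum_(t : word) eps * ln (1 + rn (qf g t i y) ^+ 2) <=
        #|word|%:R * (eps * (ln (2 * C1 ^+ 2) - 2 * rho * lam g i y)).
      apply: le_trans (_ : \sum_(t : word) eps * (ln (2 * C1 ^+ 2) - 2 * rho * lam g i y) <= _).
        apply: ler_sum => t _; rewrite ler_wpM2l//.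
        have q1 : rn (qf g t i y) <= C1 * expR (- (rho * lam g i y)).
          rewrite /qf rnM rnV ler_pdivrMr ?rn_gt0//.
          apply: le_trans (B1 i t y _ yr (gy i)) _.
            by apply: leq_trans (size_bseq t) (leq_pred _).
          rewrite -mulrA ler_wpM2l//; first lra.
          rewrite -[X in _ <= _ * X]lnK ?posrE ?rn_gt0// -expRD ler_expR /lam; lra.
        have q2 : rn (qf g t i y) ^+ 2 <= C1 ^+ 2 * expR (- (2 * rho * lam g i y)).
          have -> : - (2 * rho * lam g i y) = 2%:R * - (rho * lam g i y) by ring.
          by rewrite expRM_natl -exprMn lerXn2r ?nnegrE ?rn_ge0// mulr_ge0 ?expR_ge0//; lra.
        have q3 : 1 <= C1 ^+ 2 * expR (- (2 * rho * lam g i y)).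
          have -> : - (2 * rho * lam g i y) = 2%:R * - (rho * lam g i y) by ring.
          rewrite expRM_natl -exprMn exprn_ege1//.
          rewrite expRN -[X in _ <= X / _](@lnK _ C1) ?posrE; last lra.
          by rewrite -expRN -expRD -[X in X <= _]expR0 ler_expR subr_ge0 LB.
        have -> : ln (2 * C1 ^+ 2) - 2 * rho * lam g i y =
            ln (2 * C1 ^+ 2 * expR (- (2 * rho * lam g i y))).
          rewrite [RHS]lnM ?posrE ?expR_gt0// ?expRK//.
          by apply: mulr_gt0 => //; apply: exprn_gt0; lra.
        rewrite ler_ln ?posrE; last 2 first.
        - by rewrite ltr_wpDr// sqr_ge0.
        - apply: mulr_gt0; last exact: expR_gt0.
          by apply: mulr_gt0 => //; apply: exprn_gt0; lra.
        lra.
      by rewrite sumr_const [X in _ <= X]mulr_natl.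
    rewrite /log_density_at; move: t2 t3; set u := ln (1 + expR (2 * s * lam g i y)).
    set v := \sum_(t : word) _ => t2 t3; apply: le_trans (lerD (lerD (lexx _) t2) t3) _.
    by rewrite /K2 le_eqVlt; apply/orP; left; apply/eqP; ring.
  apply: le_trans (_ : K1 * expR ((1 - rho) * \sum_i lam g i y) *
      expR (\sum_i (K2 + (th - 1 - 2 * rho * eps * #|word|%:R) * lam g i y)) <= _).
    by apply: ler_pM; rewrite ?rn_ge0 ?expR_ge0// ler_expR; apply: ler_sum => i _; exact: L1.
  have K10 : 0 <= K1 by rewrite !mulr_ge0 ?expR_ge0 ?exprn_ge0//; lra.
  rewrite -mulrA -expRD ler_wpM2l// ler_expR big_split /= sumr_const card_ord -mulr_sumr.
  rewrite -[K2 *+ _]mulr_natl.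
  have S : \sum_i lam g i y <= n%:R * Lm + lam g i0 y.
    rewrite (bigD1 i0)//= addrC lerD2r.
    apply: le_trans (_ : \sum_(i < n.+1 | i != i0) Lm <= _).
      by apply: ler_sum => i _; exact: LB'.
    rewrite sumr_const -[X in X <= _]mulr_natl ler_wpM2r// ler_nat.
    by rewrite cardC1 card_ord.
  have -> : (1 - rho) * (\sum_i lam g i y) + (n.+1%:R * K2 +
      (th - 1 - 2 * rho * eps * #|word|%:R) * \sum_i lam g i y) =
      n.+1%:R * K2 + sig * \sum_i lam g i y by rewrite /sig; ring.
  rewrite -addrA lerD2l -mulrDr ler_wpM2l//.
  exact: ltW.
have K10 : 0 < K1 by rewrite !mulr_gt0 ?expR_gt0 ?exprn_gt0 ?ltr0n ?fact_gt0//; lra.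
apply/continuous_rn_real => e e0.
pose K3 := n.+1%:R * K2 + sig * (n%:R * Lm).
(* The value of |g_i0| at which the bound in [main] equals [e / 2]. *)
pose del := expR ((ln (e / (2 * K1)) - K3) / sig).
have del0 : 0 < del by exact: expR_gt0.
have [r2 r20 r2H] := (continuous_rnP _ _).1 (differentiable_continuous (Hg i0 z0)) del del0.
exists (Num.min (Num.min r r1) r2); first by rewrite !lt_min r0 r10.
move=> y; rewrite !lt_min => /andP[/andP[yr yr1] /r2H]; rewrite gi0 subr0 => hd.
have -> : metric g ws z0 = 0.
  rewrite /metric; case: ifP => // /forallP /(_ i0).
  by rewrite gi0 eqxx.
rewrite subr0.
have [gy|ngy] := boolP [forall i, g i y != 0]; last first.
  by rewrite /metric (negbTE ngy) normr0.
move/forallP in gy.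
have M0 : 0 <= metric g ws y.
  by rewrite /metric (introT forallP gy) mulr_ge0 ?rn_ge0 ?expR_ge0.
rewrite ger0_norm//; apply: le_lt_trans (main y yr yr1 gy) _; rewrite -/K3.
have ek : 0 < e / (2 * K1) by rewrite divr_gt0// mulr_gt0.
apply: le_lt_trans (_ : K1 * expR (ln (e / (2 * K1))) < _); last first.
  rewrite lnK ?posrE//; have -> : K1 * (e / (2 * K1)) = e / 2 by field; rewrite gt_eqF.
  lra.
rewrite ler_wpM2l ?(ltW K10)// ler_expR.
have : lam g i0 y <= (ln (e / (2 * K1)) - K3) / sig.
  by rewrite -ler_expR lnK ?posrE ?rn_gt0//; exact: ltW.
by rewrite ler_pdivlMr//; lra.
Qed.

End Metric.

(** * The maximum principle on the polydisc *)

Section MetricBound.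
Variables (R : realType) (n p kap d : nat).
Notation C := (Cplx R).
Notation V := 'rV[C]_p.
Implicit Types (g : 'I_n.+1 -> V -> C) (ws : 'I_n.+1 -> seq 'I_p).
Notation word := (word p kap).

Variables (s th eps : R).

Lemma jet_log_density_at g i (z : V) (j : 'I_p) : (forall i y, differentiable (g i) y) ->
  g i z != 0 ->
  exists a b : C, jet (fun t => log_density_at kap s th eps g i (z + t *: dir R j))
    (log_density_at kap s th eps g i z) a b
    (s ^+ 2 * rn (qf g [:: j] i z) ^+ 2 * expR (2 * s * lam g i z) /
       (1 + expR (2 * s * lam g i z)) ^+ 2 +
     \sum_(t : word) eps * (rn ('D_(dir R j) (qf g t i) z) ^+ 2 /
       (1 + rn (qf g t i z) ^+ 2) ^+ 2)).
Proof.
move=> Hg gz.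
have near_g : \forall y \near z, differentiable (g i) y by apply/nbhs_rnP; exists 1 => // y _; exact: Hg.
have [b0 cj] := cjet_line (dir R j) near_g.
have [a1 [b1 [ra1 J1]]] := jet_ln_norm cj gz.
have [a2 [b2 J2]] := jet_softplus s J1.
have gz_near : \forall y \near z, g i y != 0.
  have /continuous_rnP fc := differentiable_continuous (Hg i z).
  have n0 : 0 < rn (g i z) by rewrite rn_gt0.
  have [r r0 rH] := fc _ n0; apply/nbhs_rnP; exists r => // y /rH.
  by apply: contraTneq => ->; rewrite sub0r rnN -leNgt.
have J3 (t : word) : exists ab : C * C,
    jet (fun u => eps * ln (1 + rn (qf g t i (z + u *: dir R j)) ^+ 2))
      (eps * ln (1 + rn (qf g t i z) ^+ 2)) ab.1 ab.2
      (eps * (rn ('D_(dir R j) (qf g t i) z) ^+ 2 / (1 + rn (qf g t i z) ^+ 2) ^+ 2)).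
  have near_q : \forall y \near z, differentiable (qf g t i) y.
    have /nbhs_rnP[r r0 rH] := gz_near; apply/nbhs_rnP; exists r => // y yz.
    exact: qf_differentiable Hg (rH y yz).
  have [b3 cq] := cjet_line (dir R j) near_q.
  have [a4 [b4 J4]] := jet_ln1p_norm2 cq.
  by exists (((eps%:C)%C * a4), ((eps%:C)%C * b4)); exact: jetZ.
have /choice[ab JS] := J3.
have J5 := jet_sum (index_enum word) JS.
have J6 := jetD (jetD (jetZ (th - 1) J1) J2) J5.
do 2 eexists; rewrite mulr0 add0r in J6; rewrite /qf /= -/(dir R j).
have rq : rn (Dw [:: j] (g i) z / g i z) = rn a1 by rewrite rnM rnV ra1.
rewrite rq; exact: J6.
Qed.

(** Turns a bound on the derivative of a quotient into one on the quotient of the next order, as the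
    recursion in [core_ineq] requires. *)
Lemma qf_derive g i (z : V) (j : 'I_p) w : (forall i y, differentiable (g i) y) ->
  g i z != 0 ->
  qf g (j :: w) i z = 'D_(dir R j) (qf g w i) z + qf g w i z * qf g [:: j] i z.
Proof.
move=> Hg gz; have dw : derivable (Dw w (g i)) z (dir R j).
  by apply: diff_derivable; apply: Dw_entire; exact: Hg.
have dg : derivable (g i) z (dir R j) by apply: diff_derivable; exact: Hg.
have -> : qf g w i = Dw w (g i) * (fun y => (g i y)^-1) by [].
rewrite (deriveM dw (derivableV gz dg)) (deriveV gz dg) /qf /=.
set A := 'D_(dir R j) (Dw w (g i)) z; set B := 'D_(dir R j) (g i) z.
rewrite -[_ *: (_ *: B)]/(Dw w (g i) z * (- (g i z) ^- 2 * B)) -[_ *: A]/((g i z)^-1 * A).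
rewrite -[(_ * _) z]/(Dw w (g i) z * (g i z)^-1).
by field.
Qed.

Lemma admissible_max g (z : V) : admissible kap d g ->
  exists j, (forall i, lam g i z <= lam g j z) /\
    ((forall i, g i z != 0) -> n.+1%:R^-1 <= expR (lam g j z)).
Proof.
move=> [_ g1 _].
have [j _ jm] := arg_maxP (fun i => lam g i z) (isT : xpredT (ord0 : 'I_n.+1)).
exists j; split=> [i|gz]; first exact: jm.
have S : 1 <= \sum_i rn (g i z) by rewrite -(rn1 R) -(g1 z); exact: rn_sum.
have {}S : 1 <= \sum_(i < n.+1) expR (lam g j z).
  apply: le_trans S _; apply: ler_sum => i _.
  by rewrite -[rn _]lnK ?posrE ?rn_gt0// ler_expR; exact: jm.
rewrite sumr_const card_ord -mulr_natl in S.
by rewrite -[_^-1]mulr1 ler_pdivrMl// ltr0n.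
Qed.

Definition metric_const (k : nat) : R :=
  (n.+1)`!%:R * 3 ^+ k * (2 ^+ (k * n.+1) * n.+1%:R) * ((k.+1)%:R / (s * eps)) ^+ k.

(** On the closed polydisc the truncation changes nothing; it keeps the factors nonnegative
    elsewhere. *)
Definition barrier (z : V) : R := \prod_j Num.max 0 (1 - rn (z 0 j) ^+ 2).

Lemma barrier_continuous : continuous barrier.
Proof.
move=> z; apply: continuous_bigprod => j.
have c1 : {for z, continuous (fun y : V => rn (y 0 j))}.
  by apply: continuous_rn_comp; exact: differentiable_coord.
have c2 : {for z, continuous (fun y : V => 1 - rn (y 0 j) ^+ 2)}.
  apply: (fun h => @continuousB R R V (fun=> 1) _ z h (@continuousM R V _ _ z c1 c1)).
  exact: cst_continuous.
by apply: (fun h => @continuous_max R V (fun=> 0) _ z h c2); exact: cst_continuous.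
Qed.

Lemma compact_polydisc : compact [set z : V | forall j, rn (z 0 j) <= 1].
Proof. by apply: (@rV_compact C p (fun=> [set x | rn x <= 1])) => j; exact: compact_disc. Qed.

Lemma sqr_le_div (x K B : R) : 0 < B -> x ^+ 2 <= K / B ^+ 2 -> 0 <= K -> 0 <= x ->
  x <= (K + 1) / B.
Proof.
move=> B0 h K0 x0; rewrite -(@ler_pXn2r _ 2)// ?nnegrE ?divr_ge0 ?addr_ge0// ?(ltW B0)//.
apply: le_trans h _; rewrite expr_div_n ler_wpM2r ?invr_ge0 ?exprn_ge0 ?(ltW B0)//.
by have := sqr_ge0 K; rewrite !expr2; lra.
Qed.

(** The barrier is raised to the same power [k] that [H] has in [core_ineq], and [H] is a constant
    over the barrier; so the product of the two is a constant. *)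
Lemma metric_bound g ws (k : nat) :
  (0 < kap)%N -> (kap <= d)%N -> (0 < d)%N ->
  k = (2 ^ kap * n.+1 + 2 * n.+1 + (2 * 2 ^ kap + 1) * (#|word| * n.+1))%N ->
  0 < s <= 1 -> s * k%:R <= th -> n.+1%:R * (th + s * k%:R) <= 1 -> 0 < eps <= 1 ->
  0 < th - kap%:R / d%:R - 2 * (kap%:R / d%:R) * eps * #|word|%:R ->
  admissible kap d g -> (forall a, (size (ws a) <= kap)%N) ->
  metric kap s th eps g ws 0 <= metric_const k.
Proof.
move=> kap0 kd d0 kE /andP[s0 s1] sk nth /andP[eps0 eps1] sig0 adm wsk.
have [Hg g1 _] := adm.
pose X := metric kap s th eps g ws.
have Xc : continuous X.
  by apply: metric_continuous sig0 adm wsk => //; rewrite ?(ltW eps0) ?(ltW s0).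
pose Y z := X z * barrier z ^+ k.
have Yc : continuous Y.
  move=> z; apply: (@continuousM R V _ _ z (Xc z)).
  have cb : {for z, continuous barrier} by exact: barrier_continuous.
  have ce : {for barrier z, continuous (fun x : R => x ^+ k)} by exact: exprn_continuous.
  exact: (@continuous_comp _ _ _ barrier (fun x : R => x ^+ k) z cb ce).
pose A := [set z : V | forall j, rn (z 0 j) <= 1].
have A0 : A 0 by move=> j; rewrite mxE rn0.
have An0 : A !=set0 by exists 0.
have [c cA cM] := compact_EVT_max An0 compact_polydisc (continuous_subspaceT Yc).
have cA' : A c by rewrite inE in cA.
have X0 z : 0 <= X z.
  by rewrite /X /metric; case: ifP => // _; rewrite mulr_ge0 ?rn_ge0 ?expR_ge0.
have mc0 : 0 <= metric_const k.
  rewrite /metric_const !mulr_ge0 ?exprn_ge0 ?divr_ge0 ?mulr_ge0 ?ltW//.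
have Y0 : Y 0 = X 0.
  by rewrite /Y /barrier big1 ?expr1n ?mulr1// => j _; rewrite mxE rn0 expr0n subr0 max_r.
rewrite -/(X 0) -Y0; apply: le_trans (cM 0 (mem_set A0)) _.
have [Yc0|Yc0] := leP (Y c) 0; first exact: le_trans Yc0 mc0.
have k0 : (0 < k)%N by rewrite kE addn_gt0 addn_gt0 muln_gt0 expn_gt0.
have [Xc0 Bc0] : 0 < X c /\ 0 < barrier c.
  have B0 : 0 <= barrier c by apply: prodr_ge0 => j _; rewrite le_max lexx.
  split; rewrite lt_neqAle ?X0 ?B0 andbT; apply: contraTneq Yc0 => e.
    by rewrite /Y -e mul0r ltxx.
  by rewrite /Y -e expr0n -(prednK k0) /= mulr0 ltxx.
have u0 j : 0 < 1 - rn (c 0 j) ^+ 2.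
  rewrite ltNge; apply/negP => h; move: Bc0.
  by rewrite /barrier (bigD1 j)//= max_l// mul0r ltxx.
have rc j : rn (c 0 j) < 1.
  by have := u0 j; rewrite subr_gt0 expr_lt1// rn_ge0.
have Fl l : 0 <= Num.max 0 (1 - rn (c 0 l) ^+ 2) <= 1.
  by rewrite le_max lexx /= ge_max ler01 lerBlDr lerDl sqr_ge0.
have F1 (P : pred 'I_p) : \prod_(l | P l) Num.max 0 (1 - rn (c 0 l) ^+ 2) <= 1.
  rewrite -[leRHS](@big1 R 1 *%R _ (index_enum 'I_p) P (fun=> 1))//.
  by apply: ler_prod => l _; exact: Fl.
have Bu j : barrier c <= 1 - rn (c 0 j) ^+ 2.
  rewrite /barrier (bigD1 j)//= max_r ?(ltW (u0 j))// ler_piMr ?(ltW (u0 j))//.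
have B1 : barrier c <= 1 by exact: F1.
have gc i : g i c != 0.
  by move: Xc0; rewrite /X /metric; case: ifP => [/forallP|_]; [exact|rewrite ltxx].
have XE z : (forall i, g i z != 0) -> X z = rn (Wr g ws z) * expR (log_density kap s th eps g z).
  by move=> gz; rewrite /X /metric (introT forallP gz).
have Wc : Wr g ws c != 0.
  by apply: contraTneq Xc0 => W0; rewrite XE// W0 rn0 mul0r ltxx.
(* The second derivative test at [c] in direction [j]. The logarithms of |W| and of the |g_i| are
   harmonic near [c], so only the positive terms and the barrier contribute. *)
have key j : \sum_i (s ^+ 2 * rn (qf g [:: j] i c) ^+ 2 * expR (2 * s * lam g i c) /
       (1 + expR (2 * s * lam g i c)) ^+ 2 +
     \sum_(t : word) eps * (rn ('D_(dir R j) (qf g t i) c) ^+ 2 /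
       (1 + rn (qf g t i c) ^+ 2) ^+ 2)) <= k%:R / (1 - rn (c 0 j) ^+ 2) ^+ 2.
  pose e := dir R j.
  have [r [r0 rH]] : exists r : R, 0 < r /\ forall t : C, rn t < r ->
      [/\ forall i, g i (c + t *: e) != 0, Wr g ws (c + t *: e) != 0 & rn (c 0 j + t) < 1].
    have /nbhs_rnP[r1 r10 r1H] := nonzero_near Hg gc.
    have /continuous_rnP Wcont := differentiable_continuous (Wr_differentiable ws c Hg).
    have nW : 0 < rn (Wr g ws c) by rewrite rn_gt0.
    have [r2 r20 r2H] := Wcont _ nW.
    have e1 : 0 < rn e + 1 by rewrite ltr_wpDl// rn_ge0.
    exists (Num.min (Num.min (r1 / (rn e + 1)) (r2 / (rn e + 1))) (1 - rn (c 0 j))).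
    rewrite !lt_min !divr_gt0// subr_gt0 rc; split => // t.
    rewrite !lt_min !ltr_pdivlMr// => /andP[/andP[t1 t2] t3].
    have te : rn (c + t *: e - c) <= rn t * (rn e + 1).
      by rewrite addrAC subrr add0r rnZ ler_wpM2l ?rn_ge0// lerDl.
    split; first exact: r1H (le_lt_trans te t1).
      have := r2H _ (le_lt_trans te t2).
      by apply: contraTneq => ->; rewrite sub0r rnN -leNgt.
    by have := rnD (c 0 j) t; lra.
  have coord (t : C) l : (c + t *: e) 0 l = c 0 l + t * (l == j)%:R.
    by rewrite !mxE eqxx.
  pose U (t : C) := ln (rn (Wr g ws (c + t *: e))) + log_density kap s th eps g (c + t *: e) +
    k%:R * ln (1 - rn (c 0 j + t) ^+ 2).
  (* The barrier factors of the other coordinates, constant along the line. *)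
  pose Rest := \prod_(l | l != j) Num.max 0 (1 - rn (c 0 l) ^+ 2) ^+ k.
  have R0 : 0 < Rest.
    by apply: prodr_gt0 => l _; rewrite exprn_gt0// lt_max u0 orbT.
  have YU (t : C) : rn t < r -> Y (c + t *: e) = expR (U t) * Rest.
    move=> tr; have [gt Wt ct] := rH t tr.
    have ut : 0 < 1 - rn (c 0 j + t) ^+ 2 by rewrite subr_gt0 expr_lt1// rn_ge0.
    rewrite /Y XE// /barrier -prodrXl (bigD1 j)//= coord eqxx mulr1 max_r ?(ltW ut)//.
    have -> : \prod_(l < p | l != j) Num.max 0 (1 - rn ((c + t *: e) 0 l) ^+ 2) ^+ k = Rest.
      by apply: eq_bigr => l /negbTE lj; rewrite coord lj mulr0 addr0.
    rewrite /U !expRD lnK ?posrE ?rn_gt0// expRM_natl lnK ?posrE//.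
    by rewrite !mulrA.
  have Um (t : C) : rn t < r -> U t <= U 0.
    move=> tr; have [_ _ ct] := rH t tr.
    have tA : A (c + t *: e).
      move=> l; rewrite coord; have [->|lj] := eqVneq l j; first by rewrite mulr1 ltW.
      by rewrite mulr0 addr0; exact: cA'.
    have := cM _ (mem_set tA); rewrite YU//.
    have -> : Y c = expR (U 0) * Rest by rewrite -YU ?rn0// scale0r addr0.
    by rewrite ler_pM2r// ler_expR.
  have nearW' : \forall y \near c, differentiable (Wr g ws) y.
    by apply/nbhs_rnP; exists 1 => // y _; exact: Wr_differentiable.
  have [b0 cW] := cjet_line e nearW'.
  have [a1 [b1 [_ JW]]] := jet_ln_norm cW Wc.
  have JLi i : exists ab : C * C, jet (fun t => log_density_at kap s th eps g i (c + t *: e))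
      (log_density_at kap s th eps g i c) ab.1 ab.2
      (s ^+ 2 * rn (qf g [:: j] i c) ^+ 2 * expR (2 * s * lam g i c) /
       (1 + expR (2 * s * lam g i c)) ^+ 2 +
     \sum_(t : word) eps * (rn ('D_(dir R j) (qf g t i) c) ^+ 2 /
       (1 + rn (qf g t i c) ^+ 2) ^+ 2)).
    by have [a [b J]] := jet_log_density_at j Hg (gc i); exists (a, b).
  have /choice[ab JL] := JLi.
  have [a4 [b4 JB]] := jet_ln_disc (rc j).
  have JU := jetD (jetD JW (jet_sum (index_enum _) JL)) (jetZ k%:R JB).
  have U0 : U 0 = ln (rn (Wr g ws c)) + \sum_i log_density_at kap s th eps g i c +
      k%:R * ln (1 - rn (c 0 j) ^+ 2).
    by rewrite /U scale0r !addr0.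
  have := jet_max r0 U0 Um JU.
  by rewrite add0r mulrN subr_le0.
have [j [jm jn]] := admissible_max c adm.
(* The numerator k + 1 comes from taking square roots with [sqr_le_div]. Division by [s] serves the
   bound [h1], division by [eps] the bound [h2]. *)
pose K := (k.+1)%:R / (s * eps); pose H := K / barrier c.
have se : 0 < s * eps by rewrite mulr_gt0.
have k1 : (k.+1)%:R = k%:R + 1 :> R by rewrite -natr1.
have se1 : s * eps <= 1 by rewrite -[1]mulr1 ler_pM// ltW.
have K1 : 1 <= K.
  by rewrite /K ler_pdivlMr// mul1r; apply: le_trans se1 _; rewrite ler1n.
have H1 : 1 <= H by rewrite /H ler_pdivlMr// mul1r; exact: le_trans B1 K1.
have kB l : k%:R / (1 - rn (c 0 l) ^+ 2) ^+ 2 <= k%:R / barrier c ^+ 2.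
  rewrite ler_wpM2l// lef_pV2 ?posrE ?exprn_gt0//.
  by rewrite lerXn2r ?nnegrE ?(ltW Bc0) ?(ltW (u0 l)).
have T0 i l : 0 <= s ^+ 2 * rn (qf g [:: l] i c) ^+ 2 * expR (2 * s * lam g i c) /
       (1 + expR (2 * s * lam g i c)) ^+ 2.
  apply: divr_ge0; last exact: sqr_ge0.
  by apply: mulr_ge0; [apply: mulr_ge0; exact: sqr_ge0|exact: expR_ge0].
have S0 i l (t : word) : 0 <= eps * (rn ('D_(dir R l) (qf g t i) c) ^+ 2 /
       (1 + rn (qf g t i c) ^+ 2) ^+ 2).
  by apply: mulr_ge0; [exact: ltW|apply: divr_ge0; exact: sqr_ge0].
have term i l : s ^+ 2 * rn (qf g [:: l] i c) ^+ 2 * expR (2 * s * lam g i c) /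
       (1 + expR (2 * s * lam g i c)) ^+ 2 +
     \sum_(t : word) eps * (rn ('D_(dir R l) (qf g t i) c) ^+ 2 /
       (1 + rn (qf g t i c) ^+ 2) ^+ 2) <= k%:R / barrier c ^+ 2.
  apply: le_trans (kB l); apply: le_trans (key l); rewrite [leRHS](bigD1 i)//= lerDl.
  by apply: sumr_ge0 => i' _; rewrite addr_ge0 ?T0// sumr_ge0.
have h1 i l : rn (qf g [:: l] i c) * expR (s * lam g i c) <=
    H * (1 + expR (2 * s * lam g i c)).
  set E := expR (s * lam g i c); have E0 : 0 < E by exact: expR_gt0.
  have EE : expR (2 * s * lam g i c) = E ^+ 2.
    by rewrite -expRM_natl; congr expR; ring.
  set q := rn _; have q0 : 0 <= q by exact: rn_ge0.
  have p1 : 0 < 1 + E ^+ 2 by rewrite ltr_wpDr// sqr_ge0.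
  have a1 : (s * q * E / (1 + E ^+ 2)) ^+ 2 <= k%:R / barrier c ^+ 2.
    apply: le_trans (term i l); rewrite EE -/q.
    have -> : (s * q * E / (1 + E ^+ 2)) ^+ 2 = s ^+ 2 * q ^+ 2 * E ^+ 2 / (1 + E ^+ 2) ^+ 2.
      by rewrite !exprMn exprVn.
    by rewrite lerDl sumr_ge0.
  have a2 := sqr_le_div Bc0 a1 (ler0n _ k).
  have {}a2 : s * q * E / (1 + E ^+ 2) <= (k%:R + 1) / barrier c.
    by apply: a2; rewrite divr_ge0 ?mulr_ge0 ?(ltW E0) ?(ltW s0) ?(ltW p1).
  rewrite EE; move: a2; rewrite ler_pdivrMr// => a2.
  rewrite -(ler_pM2l s0) mulrA; apply: le_trans a2 _.
  rewrite mulrA ler_wpM2r ?(ltW p1)// /H /K k1 !mulrA ler_wpM2r ?invr_ge0 ?(ltW Bc0)//.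
  have -> : s * (k%:R + 1) / (s * eps) = (k%:R + 1) / eps by field; rewrite !gt_eqF.
  by rewrite ler_pdivlMr// ler_piMr// -k1.
have h2 i l w : (size w < kap)%N -> rn (qf g (l :: w) i c) <=
    H * (1 + rn (qf g w i c) ^+ 2) + rn (qf g w i c) * rn (qf g [:: l] i c).
  move=> wk; rewrite (qf_derive l w Hg (gc i)); apply: le_trans (rnD _ _) _.
  rewrite rnM lerD2r.
  have [t tw] : exists t : word, t = w :> seq _.
    have wk' : (size w <= kap.-1)%N by rewrite -ltnS prednK.
    by exists (Bseq wk').
  rewrite -tw; set z := rn ('D_ _ _ _); set q := rn _.
  have z0 : 0 <= z by exact: rn_ge0.
  have p1 : 0 < 1 + q ^+ 2 by rewrite ltr_wpDr// sqr_ge0.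
  have a1 : (eps * (z / (1 + q ^+ 2))) ^+ 2 <= k%:R / barrier c ^+ 2.
    apply: le_trans (term i l); apply: le_trans (_ : eps * (z ^+ 2 / (1 + q ^+ 2) ^+ 2) <= _).
      rewrite exprMn expr_div_n ler_wpM2r ?divr_ge0 ?sqr_ge0//.
      by rewrite expr2 ler_piMl// ltW.
    rewrite [X in _ <= _ + X](bigD1 t)//= addrCA lerDl addr_ge0 ?T0// sumr_ge0//.
  have a2 := sqr_le_div Bc0 a1 (ler0n _ k).
  have {}a2 : eps * (z / (1 + q ^+ 2)) <= (k%:R + 1) / barrier c.
    by apply: a2; rewrite mulr_ge0 ?(ltW eps0)// divr_ge0 ?(ltW p1).
  move: a2; rewrite mulrA ler_pdivrMr// => a2.
  rewrite -(ler_pM2l eps0); apply: le_trans a2 _.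
  rewrite mulrA ler_wpM2r ?(ltW p1)// /H /K k1 !mulrA ler_wpM2r ?invr_ge0 ?(ltW Bc0)//.
  have -> : eps * (k%:R + 1) / (s * eps) = (k%:R + 1) / s by field; rewrite !gt_eqF.
  by rewrite ler_pdivlMr// ler_piMr// -k1.
have P0 : 0 <= rn (Wr g ws c) by exact: rn_ge0.
have PM M : 1 <= M -> (forall w i, (size w <= kap)%N -> rn (qf g w i c) <= M) ->
    rn (Wr g ws c) <= (n.+1)`!%:R * (M ^+ n.+1 *
      (expR (\sum_i lam g i c) / expR (lam g j c))).
  move=> M1 QM.
  apply: le_trans (@det_col_bound _ _ _ (fun i => M * expR (lam g i c)) j _ _) _.
  - move=> a i; rewrite mxE lnK ?posrE ?rn_gt0// -ler_pdivrMr ?rn_gt0//.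
    by rewrite -rnV -rnM; exact: QM.
  - move=> a; under eq_bigr do rewrite mxE.
    exact: row_sum_bound adm.
  rewrite ler_wpM2l// expR_sum big_split /=.
  rewrite [X in _ <= _ * (X / _)](bigD1 j)//= mulrAC divff ?gt_eqF ?expR_gt0// mul1r.
  apply: ler_wpM2r; first by apply: prodr_ge0 => i _; exact: expR_ge0.
  rewrite prodr_const; apply: ler_weXn2l => //.
  by rewrite -[X in (_ <= X)%N](card_ord n.+1) max_card.
have Q0 i : rn (qf g [::] i c) = 1 by rewrite /qf /= divff ?rn1.
have CI := @core_ineq R n p kap s th eps H (rn (Wr g ws c)) (fun i => lam g i c)
  (fun w i => rn (qf g w i c)) word (fun t => t) k j kE (ltW s0) sk nth _ H1 Q0
  (fun w i => rn_ge0 _) h1 h2 _ jm (jn gc) P0 PM.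
have {}CI : X c <= (n.+1)`!%:R * 3 ^+ k * (2 ^+ (k * n.+1) * n.+1%:R) * H ^+ k.
  rewrite XE//; apply: CI; first by rewrite eps1 ltW.
  by move=> t; apply: leq_trans (size_bseq t) (leq_pred _).
rewrite /Y; apply: le_trans (ler_wpM2r (exprn_ge0 k (ltW Bc0)) CI) _.
have HB : H ^+ k * barrier c ^+ k = K ^+ k by rewrite -exprMn /H divfK// gt_eqF.
by rewrite -[leLHS]mulrA HB.
Qed.

End MetricBound.

(** * Rescaling, and the vanishing of Wronskians *)

Section Scaling.
Variables (R : realType) (n p kap d : nat).
Notation C := (Cplx R).
Notation V := 'rV[C]_p.
Implicit Types (g : 'I_n.+1 -> V -> C) (ws : 'I_n.+1 -> seq 'I_p).

(** Induction on the list: near a point where the earlier functions do not vanish they stay nonzero,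
    and by the identity theorem the next one cannot vanish on that whole neighbourhood. *)
Lemma common_nonzero (I : eqType) (r : seq I) (f : I -> V -> C) (z : V) (e : R) : 0 < e ->
  (forall i y, differentiable (f i) y) -> (forall i, i \in r -> exists y, f i y != 0) ->
  exists2 y, rn (y - z) < e & forall i, i \in r -> f i y != 0.
Proof.
move=> e0 Hf; elim: r => [_|i r IH H].
  by exists z => //; rewrite subrr rn0.
have [|y yz Hy] := IH; first by move=> k kr; apply: H; rewrite in_cons kr orbT.
have nearr : exists2 d' : R, 0 < d' & forall x, rn (x - y) < d' ->
    forall k, k \in r -> f k x != 0.
  elim: r Hy {IH H} => [_|k r IHr Hk]; first by exists 1.
  have [|d1 d10 H1] := IHr; first by move=> l lr; apply: Hk; rewrite in_cons lr orbT.
  have /continuous_rnP fc := differentiable_continuous (Hf k y).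
  have n0 : 0 < rn (f k y) by rewrite rn_gt0 Hk// mem_head.
  have [d2 d20 H2] := fc _ n0.
  exists (Num.min d1 d2); first by rewrite lt_min d10.
  move=> x; rewrite lt_min => /andP[x1 x2] l; rewrite in_cons => /orP[/eqP->|lr].
    by have := H2 x x2; apply: contraTneq => ->; rewrite sub0r rnN -leNgt.
  exact: H1 x x1 l lr.
have [d' d'0 Hd] := nearr.
pose del := Num.min d' (e - rn (y - z)).
have del0 : 0 < del by rewrite lt_min d'0 subr_gt0.
have [x xy fx] : exists2 x, rn (x - y) < del & f i x != 0.
  apply: contrapT => nx; have [y0] := H i (mem_head _ _); apply/negP; rewrite negbK; apply/eqP.
  apply: (@identity_theorem R V (f i) y (Hf i)); apply/nbhs_rnP; exists del => // x xy.
  by apply/eqP; apply: contraPT nx => fx; apply; exists x.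
move: xy; rewrite lt_min => /andP[xy1 xy2].
exists x; first by have := rn_dist x y z; lra.
move=> k; rewrite in_cons => /orP[/eqP->//|kr].
exact: Hd x xy1 k kr.
Qed.

Definition rescale (z1 : V) (r : R) g : 'I_n.+1 -> V -> C :=
  fun i y => g i (z1 + (r%:C)%C *: y).

Lemma Dw_rescale (z1 : V) (r : R) g w i y : (forall i y, differentiable (g i) y) ->
  Dw w (rescale z1 r g i) y = (r%:C)%C ^+ size w * Dw w (g i) (z1 + (r%:C)%C *: y).
Proof. by move=> Hg; apply: Dw_scale; exact: Hg. Qed.

Lemma admissible_rescale (z1 : V) (r : R) g : 1 <= r ->
  admissible kap d g -> admissible kap d (rescale z1 r g).
Proof.
move=> r1 [Hg g1 gord]; have r0 : 0 < r := lt_le_trans ltr01 r1.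
split.
- move=> i y; have da : differentiable (fun y : V => z1 + (r%:C)%C *: y) y.
    have -> : (fun y : V => z1 + (r%:C)%C *: y) = (fun=> z1) + ((r%:C)%C \*: id) by [].
    apply: differentiableD; first exact: differentiable_cst.
    by apply: differentiableZ; exact: ex_diff.
  exact: (@differentiable_comp _ _ _ _ (fun y : V => z1 + (r%:C)%C *: y) (g i) y da (Hg i _)).
- by move=> y; exact: g1.
move=> z0; have [e [Cc [e0 H]]] := gord (z1 + (r%:C)%C *: z0).
(* At most [kap] derivatives, each giving a factor [r], are raised to the power [d]. The sign of
   [Cc] is unknown, hence the absolute value. *)
exists (e / r), (r ^+ (kap * d) * `|Cc|); split; first exact: divr_gt0.
move=> i w y wk; rewrite ltr_pdivlMr// => yz.
rewrite Dw_rescale// rnM rnX rn_real ger0_norm ?(ltW r0)// exprMn -exprM.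
have h : rn (z1 + (r%:C)%C *: y - (z1 + (r%:C)%C *: z0)) < e.
  rewrite opprD addrACA subrr add0r -scalerBr rnZ rn_real ger0_norm ?(ltW r0)//.
  by rewrite mulrC.
have := H i w _ wk h; set x := rn (Dw w (g i) _) ^+ d; set y' := rn (g i _) ^+ _ => xy.
have y'0 : 0 <= y' by rewrite exprn_ge0 ?rn_ge0.
rewrite -mulrA; apply: ler_pM; rewrite ?exprn_ge0 ?rn_ge0 ?(ltW r0)//.
  by apply: ler_weXn2l => //; rewrite leq_mul2r wk orbT.
by apply: le_trans xy _; rewrite ler_wpM2r// ler_norm.
Qed.

Lemma Wr_rescale (z1 : V) (r : R) g ws : (forall i y, differentiable (g i) y) ->
  rn (Wr (rescale z1 r g) ws 0) = `|r| ^+ (\sum_a size (ws a)) * rn (Wr g ws z1).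
Proof.
move=> Hg; rewrite /Wr.
have -> : \matrix_(a, i) Dw (ws a) (rescale z1 r g i) 0 =
  diag_mx (\row_a (r%:C)%C ^+ size (ws a)) *m \matrix_(a, i) Dw (ws a) (g i) z1.
  apply/matrixP => a i; rewrite mul_diag_mx !mxE Dw_rescale//.
  by rewrite scaler0 addr0.
rewrite det_mulmx det_diag rnM rn_prod; congr (_ * _).
rewrite -prodrXr; apply: eq_bigr => a _.
by rewrite mxE rnX rn_real.
Qed.

(** If all words were empty the rows would coincide. This makes the power of [r] in [Wr_rescale]
    positive. *)
Lemma Wr_words g ws z : (0 < n)%N -> Wr g ws z != 0 -> (0 < \sum_a size (ws a))%N.
Proof.
move=> n0; apply: contraNT; rewrite -eqn0Ngt sum_nat_eq0 => /forallP H.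
have E a : ws a = [::] by apply/eqP; rewrite -size_eq0; have := H a.
rewrite /Wr (@determinant_alternate _ _ _ ord0 (inord 1))//.
  by rewrite -val_eqE /= inordK// ltnS.
by move=> i; rewrite !mxE !E.
Qed.

(* Replacing [g] by [y |-> g (z + r y)] multiplies the Wronskian at the origin by a
   positive power of [r], whereas [metric_bound] is uniform in [g]. *)
Theorem Wronskian_vanishes g ws z : (0 < n)%N -> (0 < kap)%N -> (n.+1 * kap < d)%N ->
  admissible kap d g -> (forall a, (size (ws a) <= kap)%N) -> Wr g ws z = 0.
Proof.
move=> n0 kap0 kd adm wsk; apply/eqP; apply: contraT => Wz; exfalso.
have [Hg g1 gord] := adm.
have gnz i : exists y, g i y != 0.
  apply: contrapT => H; move: Wz; rewrite /Wr (expand_det_col _ i) big1 ?eqxx// => a _.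
  rewrite mxE; have -> : g i = fun=> 0.
    by apply/funext => y; apply/eqP; apply: contraPT H => gy; apply; exists y.
  case: (eqVneq (ws a) [::]) => [->|w0] /=; first by rewrite mul0r.
  by rewrite Dw_cst// mul0r.
have /continuous_rnP Wc := differentiable_continuous (Wr_differentiable ws z Hg).
have nW : 0 < rn (Wr g ws z) by rewrite rn_gt0.
have [e e0 eH] := Wc _ nW.
(* [metric] is 0 by definition where some g_i vanishes, so the argument is moved to a nearby point
   where none does. *)
have [z1 z1z gz1] := @common_nonzero _ (index_enum 'I_n.+1) g z e e0 Hg (fun i _ => gnz i).
have {}gz1 i : g i z1 != 0 by apply: gz1; rewrite mem_index_enum.
have Wz1 : Wr g ws z1 != 0.
  by have := eH z1 z1z; apply: contraTneq => ->; rewrite sub0r rnN -leNgt.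
have d0 : (0 < d)%N by apply: leq_ltn_trans kd.
have kd' : (kap <= d)%N by apply: leq_trans (ltnW kd); rewrite leq_pmull.
have N10 : 0 < n.+1%:R :> R by rewrite ltr0n.
have dr : 0 < d%:R :> R by rewrite ltr0n.
have [rho rhoE] : exists x : R, x = kap%:R / d%:R by eexists.
have [iN iNE] : exists x : R, x = n.+1%:R^-1 by eexists.
have rho0 : 0 < rho by rewrite rhoE divr_gt0// ltr0n.
have rho1 : rho < iN.
  by rewrite rhoE iNE ltr_pdivrMr// mulrC ltr_pdivlMr// -natrM ltr_nat mulnC.
have [th [th1 th2]] : exists th : R, rho < th /\ th < iN.
  by exists ((rho + iN) / 2); split; lra.
pose k := (2 ^ kap * n.+1 + 2 * n.+1 + (2 * 2 ^ kap + 1) * (#|word p kap| * n.+1))%N.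
have k0 : (0 < k)%N by rewrite /k addn_gt0 addn_gt0 muln_gt0 expn_gt0.
have kr : 0 < k%:R :> R by rewrite ltr0n.
have k1 : 1 <= k%:R :> R by rewrite ler1n.
(* The three entries yield [s <= 1], [s * k <= th] and [(n + 1) * (th + s * k) <= 1]. *)
pose s := Num.min (Num.min 1 th) (iN - th) / k%:R.
have m0 : 0 < Num.min (Num.min 1 th) (iN - th) by rewrite !lt_min ltr01 subr_gt0 th2 (lt_trans rho0 th1).
have sk : s * k%:R = Num.min (Num.min 1 th) (iN - th) by rewrite /s divfK// gt_eqF.
have [s1 s2 s3] : [/\ s * k%:R <= 1, s * k%:R <= th & s * k%:R <= iN - th].
  by rewrite sk; split; rewrite !ge_min lexx ?orbT.
have s0 : 0 < s by exact: divr_gt0.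
have s4 : s <= 1 by apply: le_trans s1; rewrite ler_peMr// ltW.
pose q := 2 * rho * #|word p kap|%:R.
have q0 : 0 <= q by rewrite /q !mulr_ge0// ltW.
(* Leaves at least half of [th - rho] in the positivity condition of [metric_bound]. *)
pose eps := Num.min 1 ((th - rho) / (2 * (q + 1))).
have q1 : 0 < 2 * (q + 1) by lra.
have tr : 0 < th - rho by lra.
have eps0 : 0 < eps by rewrite lt_min ltr01 divr_gt0.
have [eps1 eps2] : eps <= 1 /\ eps * (2 * (q + 1)) <= th - rho.
  split; first by rewrite ge_min lexx.
  by rewrite -ler_pdivlMr// ge_min lexx orbT.
have sig : 0 < th - kap%:R / d%:R - 2 * (kap%:R / d%:R) * eps * #|word p kap|%:R.
  have -> : 2 * (kap%:R / d%:R) * eps * #|word p kap|%:R = eps * q by rewrite /q rhoE; ring.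
  have : 0 <= eps * q by rewrite mulr_ge0// ltW.
  rewrite -rhoE; lra.
have nth : n.+1%:R * (th + s * k%:R) <= 1.
  by rewrite -ler_pdivlMl// mulr1 -iNE; lra.
(* The metric without its factors that are at least 1; [r * m] bounds the rescaled metric at the
   origin from below. *)
pose m := rn (Wr g ws z1) * expR (\sum_i (th - 1) * lam g i z1).
have m10 : 0 < m by rewrite mulr_gt0 ?expR_gt0 ?rn_gt0.
have B (r : R) : 1 <= r -> r * m <= metric_const n s eps k.
  move=> r1; have r0 := lt_le_trans ltr01 r1.
  have adm' := admissible_rescale z1 r1 adm.
  apply: le_trans (@metric_bound R n p kap d s th eps (rescale z1 r g) ws k kap0 kd' d0
    erefl _ s2 nth _ sig adm' wsk); rewrite ?s0 ?eps0//.
  have g0 i : rescale z1 r g i 0 = g i z1 by rewrite /rescale scaler0 addr0.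
  have L i : lam (rescale z1 r g) i 0 = lam g i z1 by rewrite /lam g0.
  rewrite /metric ifT; last by apply/forallP => i; rewrite g0.
  rewrite Wr_rescale// ger0_norm ?(ltW r0)// /m mulrA.
  apply: ler_pM; rewrite ?mulr_ge0 ?rn_ge0 ?expR_ge0 ?(ltW r0)//.
    rewrite ler_wpM2r ?rn_ge0// ler_eXnr//.
    exact: Wr_words n0 Wz1.
  rewrite ler_expR; apply: ler_sum => i _; rewrite /log_density_at L -addrA lerDl addr_ge0//.
    by rewrite ln_ge0// lerDl expR_ge0.
  apply: sumr_ge0 => t _; rewrite mulr_ge0 ?(ltW eps0)// ln_ge0// lerDl sqr_ge0//.
have c0 : 0 <= metric_const n s eps k.
  by apply: le_trans (B 1 (lexx _)); rewrite mul1r ltW.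
have := B (metric_const n s eps k / m + 1).
rewrite mulrDl divfK ?gt_eqF// mul1r => H.
have : 1 <= metric_const n s eps k / m + 1 by rewrite lerDr divr_ge0// ltW.
by move=> /H; lra.
Qed.

End Scaling.

(** * Wronskians of linearly independent functions *)

Section LocallyConstant.
Variable R : realType.
Notation C := (Cplx R).

Lemma derive0_const (V : normedModType C) (f : V -> C) (z : V) (r : R) :
  (forall y, rn (y - z) < r -> differentiable f y /\ 'd f y = 0 :> (V -> C)) ->
  forall y, rn (y - z) < r -> f y = f z.
Proof.
move=> H y yz; pose v := y - z.
have G (x : R) : 0 <= x <= 1 -> rder (fun x : R => f (z + (0 + (x%:C)%C * 1 : C) *: v)) x 0.
  move=> /andP[x0 x1].
  have xz : rn (z + (0 + (x%:C)%C * 1 : C) *: v - z) < r.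
    rewrite addrAC subrr add0r rnZ add0r mulr1 rn_real ger0_norm//.
    by apply: le_lt_trans yz; rewrite ler_piMl ?rn_ge0.
  have [df d0] := H _ xz.
  have := differentiable_cder df; rewrite deriveE// d0 => c.
  by have := cder_path c; rewrite mulr0.
have := rder_const ler01 G.
rewrite add0r mulr1 scale1r add0r mul0r scale0r addr0 => <-.
by rewrite /v addrC subrK.
Qed.

Lemma derive_bigsum (V : normedModType C) (I : Type) (r : seq I) (f : I -> V -> C) (y v : V) :
  (forall i, differentiable (f i) y) ->
  'D_v (fun y => \sum_(i <- r) f i y) y = \sum_(i <- r) 'D_v (f i) y.
Proof.
move=> Hf; elim: r => [|i r IH].
  have -> : (fun y => \sum_(i <- [::]) f i y) = cst 0 by apply/funext => x; rewrite big_nil.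
  by rewrite derive_cst big_nil.
have -> : (fun y => \sum_(i <- i :: r) f i y) = f i + (fun y => \sum_(i <- r) f i y).
  by apply/funext => x; rewrite big_cons.
rewrite deriveD; first by rewrite IH big_cons.
  exact/diff_derivable/Hf.
by apply: diff_derivable; exact: differentiable_bigsum.
Qed.

Lemma derive_mulr (V : normedModType C) (f : V -> C) (y v : V) (c : C) :
  differentiable f y -> 'D_v (fun y => f y * c) y = 'D_v f y * c.
Proof.
move=> df; have -> : (fun y => f y * c) = c \*: f by apply/funext => x; rewrite mulrC.
rewrite (deriveZ c (diff_derivable (v := v) df)).
exact: (mulrC c ('D_v f y)).
Qed.

Variable p : nat.
Notation V := 'rV[C]_p.

Lemma diff0_partials (f : V -> C) (y : V) : differentiable f y ->
  (forall j, 'D_(dir R j) f y = 0) -> 'd f y = 0 :> (V -> C).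
Proof.
move=> df H; apply/funext => v; rewrite [v]row_sum_delta linear_sum big1// => j _.
by rewrite linearZ /= -deriveE// H scaler0.
Qed.

End LocallyConstant.

Section Nondegenerate.
Variables (R : realType) (n p : nat).
Notation C := (Cplx R).
Notation V := 'rV[C]_p.
Variable g : 'I_n.+1 -> V -> C.
Hypothesis Hg : forall i y, differentiable (g i) y.

Definition jet_mx (k : nat) (z : V) : 'M[C]_(#|{bseq k of 'I_p}|, n.+1) :=
  \matrix_(a, i) Dw (enum_val a : {bseq k of 'I_p}) (g i) z.

Definition jet_row (w : seq 'I_p) (z : V) : 'rV[C]_n.+1 := \row_i Dw w (g i) z.

Lemma jet_row_mx k w z : (size w <= k)%N -> exists a, jet_row w z = row a (jet_mx k z).
Proof.
move=> wk; exists (enum_rank (Bseq wk)); apply/rowP => i.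
by rewrite !mxE enum_rankK.
Qed.

Lemma jet_mx_mono k z : (jet_mx k z <= jet_mx k.+1 z)%MS.
Proof.
apply/row_subP => a; have ak : (size (enum_val a : {bseq k of 'I_p}) <= k.+1)%N.
  by apply: leq_trans (leqnSn k); exact: size_bseq.
have [b bE] := jet_row_mx z ak.
have -> : row a (jet_mx k z) = jet_row (enum_val a) z by apply/rowP => i; rewrite !mxE.
by rewrite bE row_sub.
Qed.

(* If passing from order [k] to [k + 1] does not raise the rank near [z], then the
   solution [x] of [B x = 0] on a row basis [B] of the [k]-jets is also killed by
   the derivatives of these rows, so [B dx = 0]; with [x] normalised by [N] this
   forces [dx = 0]. *)
Lemma rank_stationary k (z : V) : (\rank (jet_mx k z) <= n)%N ->
  (forall y, (\rank (jet_mx k.+1 y) <= \rank (jet_mx k z))%N) ->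
  exists2 c : 'I_n.+1 -> C, exists i, c i != 0 & forall y, \sum_i c i * g i y = 0.
Proof.
move=> rn_ Hmax; set r := \rank (jet_mx k z) in rn_ Hmax.
pose f : 'I_r -> 'I_#|{bseq k of 'I_p}| := maxrankfun (jet_mx k z).
pose B y : 'M[C]_(r, n.+1) := rowsub f (jet_mx k y).
have Bfree : row_free (B z) by exact: maxrowsub_free.
pose N : 'M[C]_(n.+1, r) := pinvmx (B z).
have BN : B z *m N = 1%:M by exact: mulmxVp.
pose E y : 'M[C]_r := B y *m N.
pose wd a : seq 'I_p := (enum_val (f a) : {bseq k of 'I_p}).
have wdk a : (size (wd a) <= k)%N by exact: size_bseq.
have BE y a i : B y a i = Dw (wd a) (g i) y by rewrite !mxE.
have dB a i y : differentiable (fun y => B y a i) y.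
  have -> : (fun y => B y a i) = Dw (wd a) (g i) by apply/funext => x; rewrite BE.
  by apply: Dw_entire; exact: Hg.
have dmulr (h : V -> C) (c : C) y : differentiable h y -> differentiable (fun y => h y * c) y.
  move=> dh; apply: (@differentiableM _ _ h (fun=> c) y dh).
  exact: differentiable_cst.
have dE a b y : differentiable (fun y => E y a b) y.
  have -> : (fun y => E y a b) = fun y => \sum_i B y a i * N i b.
    by apply/funext => x; rewrite mxE.
  by apply: differentiable_bigsum => i; apply: dmulr; exact: dB.
have dDet y : differentiable (fun y => \det (E y)) y by apply: differentiable_det => a b.
have [e e0 eH] : exists2 e : R, 0 < e & forall y, rn (y - z) < e -> \det (E y) != 0.
  have /continuous_rnP dc := differentiable_continuous (dDet z).
  have n1 : 0 < rn (\det (E z)) by rewrite /E BN det1 rn1.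
  have [e e0 eH] := dc _ n1; exists e => // y /eH.
  by apply: contraTneq => ->; rewrite sub0r rnN -leNgt.
have Eu y : rn (y - z) < e -> E y \in unitmx by move=> /eH h; rewrite unitmxE unitfE.
(* Near [z] the rows of [B y] keep rank [r], the largest rank of (k+1)-jets at any point, so they
   span all (k+1)-jets. *)
have wB w y : (size w <= k.+1)%N -> rn (y - z) < e -> exists u, jet_row w y = u *m B y.
  move=> wk yz; have BM : (B y <= jet_mx k.+1 y)%MS.
    by apply: submx_trans (jet_mx_mono k y); exact: rowsub_sub.
  have rB : (r <= \rank (B y))%N.
    by have := mxrankM_maxl (B y) N; rewrite -/(E y) (mxrank_unit (Eu y yz)).
  have MB : (jet_mx k.+1 y <= B y)%MS.
    by rewrite -(geq_leqif (mxrank_leqif_sup BM)); apply: leq_trans rB; exact: Hmax.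
  have [a aE] := jet_row_mx y wk.
  apply/submxP; rewrite aE; exact: submx_trans (row_sub a _) MB.
have [i0 [j0 ij0]] : exists i j, cokermx (B z) i j != 0.
  apply/matrix0Pn; rewrite -mxrank_eq0 mxrank_coker (eqP Bfree) subn_eq0 -ltnNge.
  by rewrite ltnS.
pose c0 : 'cV[C]_n.+1 := col j0 (cokermx (B z)).
have Bc0 : B z *m c0 = 0 by rewrite /c0 colE mulmxA mulmx_coker mul0mx.
(* The inverse of [E y] is spelled out by the adjugate to make differentiability of the entries
   visible. *)
pose yv y : 'cV[C]_r := (\det (E y))^-1 *: (\adj (E y) *m (B y *m c0)).
pose xv y : 'cV[C]_n.+1 := c0 - N *m yv y.
have Bx y : rn (y - z) < e -> B y *m xv y = 0.
  move=> /eH det0; rewrite /xv mulmxBr mulmxA -/(E y) /yv -scalemxAr mulmxA mul_mx_adj.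
  by rewrite mul_scalar_mx scalerA mulVf// scale1r subrr.
have xz : xv z = c0 by rewrite /xv /yv Bc0 mulmx0 scaler0 mulmx0 subr0.
have wx w y : (size w <= k.+1)%N -> rn (y - z) < e -> jet_row w y *m xv y = 0.
  by move=> wk yz; have [u ->] := wB w y wk yz; rewrite -mulmxA Bx// mulmx0.
have dyv b y : rn (y - z) < e -> differentiable (fun y => yv y b 0) y.
  move=> yz; have dV : differentiable (fun y => (\det (E y))^-1) y.
    exact: (differentiableV (dDet y) (eH y yz)).
  have -> : (fun y => yv y b 0) = fun y => (\det (E y))^-1 *
      \sum_c (cofactor (E y) c b * \sum_i B y c i * c0 i 0).
    apply/funext => x; rewrite /yv mxE [in LHS]mxE; congr (_ * _).
    by apply: eq_bigr => c _; rewrite !mxE; congr (_ * _); apply: eq_bigr => i _; rewrite !mxE.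
  apply: (differentiableM dV); apply: differentiable_bigsum => c; apply: differentiableM.
    apply: differentiableM; first exact: differentiable_cst.
    apply: differentiable_det => a a'.
    have -> : (fun y => row' c (col' b (E y)) a a') = fun y => E y (lift c a) (lift b a').
      by apply/funext => x; rewrite !mxE.
    exact: dE.
  by apply: differentiable_bigsum => i; apply: dmulr; exact: dB.
have xvE i : (fun y => xv y i 0) = fun y => c0 i 0 - \sum_b yv y b 0 * N i b.
  apply/funext => x; rewrite !mxE; congr (_ - _).
  by apply: eq_bigr => b _; rewrite mulrC.
have dxv i y : rn (y - z) < e -> differentiable (fun y => xv y i 0) y.
  move=> yz; rewrite xvE; apply: differentiableB; first exact: differentiable_cst.
  by apply: differentiable_bigsum => b; apply: dmulr; exact: dyv.
have px i j y : rn (y - z) < e -> 'D_(dir R j) (fun y => xv y i 0) y = 0.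
  move=> yz.
  pose dy : 'cV[C]_r := \col_b 'D_(dir R j) (fun y => yv y b 0) y.
  have dxE i' : 'D_(dir R j) (fun y => xv y i' 0) y = - (N *m dy) i' 0.
    rewrite xvE.
    have dsum : differentiable (fun y => \sum_b yv y b 0 * N i' b) y.
      by apply: differentiable_bigsum => b; apply: dmulr; exact: dyv.
    rewrite (@deriveB _ _ _ (fun=> c0 i' 0) (fun y => \sum_b yv y b 0 * N i' b)); last 2 first.
    - exact: derivable_cst.
    - exact: diff_derivable.
    rewrite [X in X - _](_ : _ = 0) ?sub0r; last exact: derive_cst.
    congr (- _).
    rewrite derive_bigsum => [|b]; last by apply: dmulr; exact: dyv.
    rewrite mxE; apply: eq_bigr => b _; rewrite derive_mulr; last exact: dyv.
    by rewrite !mxE mulrC.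
  (* Differentiating B x = 0 gives B dx + (dB) x = 0, and (dB) x = 0 because the rows of dB are
     (k+1)-jets. *)
  have Bd a : \sum_i' B y a i' * 'D_(dir R j) (fun y => xv y i' 0) y = 0.
    have Z : 'D_(dir R j) (fun y => \sum_i' B y a i' * xv y i' 0) y = 0.
      have -> : 'D_(dir R j) (fun y => \sum_i' B y a i' * xv y i' 0) y =
          'D_(dir R j) (cst (0 : C)) y.
        apply: near_eq_derive; apply/nbhs_rnP; exists (e - rn (y - z)).
          by rewrite subr_gt0.
        move=> x xy; have xz' : rn (x - z) < e by have := rn_dist x y z; lra.
        by have := congr1 (fun A : 'cV[C]_r => A a 0) (Bx x xz'); rewrite !mxE.
      by rewrite derive_cst.
    move: Z; rewrite derive_bigsum => [|i']; last first.
      by apply: differentiableM; [exact: dB|exact: dxv].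
    have W := congr1 (fun A : 'M[C]_1 => A 0 0) (wx (j :: wd a) y (wdk a) yz).
    rewrite !mxE in W.
    have -> : \sum_i' 'D_(dir R j) (fun y => B y a i' * xv y i' 0) y =
       \sum_i' (B y a i' * 'D_(dir R j) (fun y => xv y i' 0) y) +
       \sum_i' jet_row (j :: wd a) y 0 i' * xv y i' 0.
      rewrite -big_split /=; apply: eq_bigr => i' _.
      have -> : (fun y => B y a i' * xv y i' 0) =
         Dw (wd a) (g i') * (fun y => xv y i' 0).
        by apply/funext => x; rewrite BE.
      rewrite deriveM; last 2 first.
      - by apply: diff_derivable; apply: Dw_entire; exact: Hg.
      - by apply: diff_derivable; exact: dxv.
      by rewrite BE [jet_row _ _ _ _]mxE /= [X in _ = _ + X]mulrC.
    by rewrite W addr0.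
  have Ed : E y *m dy = 0.
    apply/matrixP => a b; rewrite [b]ord1 [RHS]mxE /E -mulmxA mxE.
    transitivity (- \sum_i' B y a i' * 'D_(dir R j) (fun y => xv y i' 0) y).
      by rewrite -sumrN; apply: eq_bigr => i' _; rewrite dxE mulrN opprK.
    by rewrite Bd oppr0.
  have dy0 : dy = 0 by rewrite -(mulKmx (Eu y yz) dy) Ed mulmx0.
  by rewrite dxE dy0 mulmx0 mxE oppr0.
have xc i y : rn (y - z) < e -> xv y i 0 = c0 i 0.
  move=> yz; rewrite -xz.
  apply: (@derive0_const R V (fun y => xv y i 0) z e _ y yz) => x xz'.
  have dx := dxv i x xz'; split => //.
  by apply: diff0_partials dx _ => j; exact: px.
exists (fun i => c0 i 0); first by exists i0; rewrite mxE.
apply: (@identity_theorem R V (fun y => \sum_i c0 i 0 * g i y) z).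
  move=> y; apply: differentiable_bigsum => i.
  by apply: (differentiableM (f := fun=> c0 i 0)); [exact: differentiable_cst|exact: Hg].
apply/nbhs_rnP; exists e => // y yz.
have W := congr1 (fun A : 'M[C]_1 => A 0 0) (wx [::] y isT yz).
rewrite mxE [RHS]mxE in W; rewrite -[RHS]W.
by apply: eq_bigr => i _; rewrite [jet_row _ _ _ _]mxE xc// mulrC.
Qed.

End Nondegenerate.

Section Words.
Variables (R : realType) (n p : nat).
Notation C := (Cplx R).
Notation V := 'rV[C]_p.
Variable g : 'I_n.+1 -> V -> C.
Hypothesis Hg : forall i y, differentiable (g i) y.
Hypothesis Hindep : forall c : 'I_n.+1 -> C,
  (forall y, \sum_i c i * g i y = 0) -> forall i, c i = 0.

(** The extra rank comes from sum g_i = 1: pairing with the all-ones vector gives 1 on the row of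
    order 0 and 0 on the rows of first derivatives, so the former is independent of the latter. *)
Lemma rank_jet_mx1 (z : V) (m : nat) : (forall y, \sum_i g i y = 1) ->
  (m <= \rank (\matrix_(j < p, i < n.+1) 'D_(dir R j) (g i) z))%N ->
  (m < \rank (jet_mx g 1 z))%N.
Proof.
move=> gs; set J := (X in \rank X) => mJ.
have rowE (w : seq 'I_p) (i : 'I_1) : (jet_row g w z *m const_mx 1 : 'cV[C]_1) i 0 =
    \sum_i Dw w (g i) z.
  by rewrite mxE; apply: eq_bigr => k _; rewrite !mxE mulr1.
have JE j : row j J = jet_row g [:: j] z by apply/rowP => i; rewrite !mxE.
have J1 : J *m (const_mx 1 : 'cV[C]_n.+1) = 0.
  apply/row_matrixP => j; rewrite row_mul row0 JE; apply/rowP => k.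
  rewrite [k]ord1 rowE mxE.
  have /(congr1 (fun h => h z)) <- := Dw_sum [:: j] (index_enum 'I_n.+1) Hg.
  rewrite /=; have -> : (fun y => \sum_i g i y) = cst 1 by apply/funext.
  by rewrite derive_cst.
have GJ : (jet_row g [::] z :&: J)%MS = 0.
  apply/eqP; rewrite -submx0; apply/row_subP => k; set v := row _ _.
  have vG : (v <= jet_row g [::] z)%MS by apply: submx_trans (row_sub _ _) (capmxSl _ _).
  have vJ : (v <= J)%MS by apply: submx_trans (row_sub _ _) (capmxSr _ _).
  have [a va] := submxP vG; have [b vb] := submxP vJ.
  have : v *m (const_mx 1 : 'cV[C]_n.+1) = 0 by rewrite vb -mulmxA J1 mulmx0.
  rewrite va -mulmxA.
  have -> : jet_row g [::] z *m (const_mx 1 : 'cV[C]_n.+1) = 1%:M.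
    by apply/matrixP => i j; rewrite (ord1 i) (ord1 j) rowE /= gs mxE.
  by rewrite mulmx1 => ->; rewrite mul0mx sub0mx.
have GM : (jet_row g [::] z + J <= jet_mx g 1 z)%MS.
  rewrite addsmx_sub; apply/andP; split.
    by have [a ->] := @jet_row_mx R n p g 1 [::] z isT; exact: row_sub.
  apply/row_subP => j; rewrite JE.
  by have [a ->] := @jet_row_mx R n p g 1 [:: j] z isT; exact: row_sub.
apply: leq_trans (mxrankS GM); rewrite mxrank_disjoint_sum// -add1n leq_add//.
rewrite lt0n mxrank_eq0; apply/eqP => G0.
have := rowE [::] 0; rewrite G0 mul0mx mxE /= gs => /eqP.
by rewrite eq_sym oner_eq0.
Qed.

Lemma Wronskian_nonzero (z : V) (m k : nat) : (forall y, \sum_i g i y = 1) ->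
  (m <= \rank (\matrix_(j < p, i < n.+1) 'D_(dir R j) (g i) z))%N ->
  (0 < k)%N -> (n < m + k)%N ->
  exists ws : 'I_n.+1 -> seq 'I_p,
    (forall a, (size (ws a) <= k)%N) /\ exists y, Wr g ws y != 0.
Proof.
move=> gs mJ k0 nmk.
(* The point may change with [j], since [rank_stationary] only yields a larger rank somewhere. *)
have grow j : exists y, (minn n.+1 (m + j.+1) <= \rank (jet_mx g j.+1 y))%N.
  elim: j => [|j [y IH]].
    by exists z; apply: leq_trans (geq_minr _ _) _; rewrite addn1; exact: rank_jet_mx1 gs mJ.
  have [rn_|rn_] := leqP (\rank (jet_mx g j.+1 y)) n; last first.
    exists y; apply: leq_trans (geq_minl _ _) _.
    by apply: leq_trans rn_ _; exact: mxrankS (jet_mx_mono g j.+1 y).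
  have [[x Hx]|/forallNP Hx] := pselect (exists x, (\rank (jet_mx g j.+1 y) < \rank (jet_mx g j.+2 x))%N).
    exists x; apply: leq_trans (geq_minr _ _) _; rewrite addnS; apply: leq_trans Hx; rewrite ltnS.
    by move: IH; rewrite geq_min ltnNge rn_.
  have [x|c [i ci] cg] := rank_stationary Hg rn_.
    by rewrite leqNgt; apply/negP; exact: Hx.
  by rewrite (Hindep cg) eqxx in ci.
have [y] := grow k.-1; rewrite prednK// (minn_idPl nmk) => rk.
have full : row_full (jet_mx g k y) by rewrite /row_full eqn_leq rank_leq_col.
pose f := fullrankfun full.
exists (fun a => (enum_val (f a) : {bseq k of 'I_p})); split.
  by move=> a; exact: size_bseq.
exists y; have := fullrowsub_unit full; rewrite unitmxE unitfE; congr (_ != 0).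
by rewrite /Wr; congr (\det _); apply/matrixP => a i; rewrite !mxE.
Qed.

End Words.

(** * Maps omitting the Fermat hypersurface *)

Section PowerJets.
Variables (R : realType) (p : nat).
Notation C := (Cplx R).
Notation V := 'rV[C]_p.

Lemma derive_powM (a u : V -> C) (y v : V) (m : nat) :
  differentiable a y -> differentiable u y ->
  'D_v (fun y => a y ^+ m.+1 * u y) y =
    a y ^+ m * (a y * 'D_v u y + m.+1%:R * 'D_v a y * u y).
Proof.
move=> da du; have dv := diff_derivable (v := v) da.
have E : (fun y => a y ^+ m.+1) = a ^+ m.+1 by apply/funext => x; rewrite exprfctE.
have dX : 'D_v (fun y => a y ^+ m.+1) y = (m.+1%:R * a y ^+ m) * 'D_v a y.
  rewrite E; exact: deriveX dv.
have dpow := diff_derivable (v := v) (differentiable_pow m.+1 da).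
have := deriveM dpow (diff_derivable (v := v) du) => /= H.
rewrite [LHS]H dX /GRing.scale /=.
move: (a y) (u y) ('D_v a y) ('D_v u y) => A u0 da' du'.
by rewrite exprS; ring.
Qed.

(** Each derivative costs one power of [a]. *)
Lemma Dw_power (U : set V) (a u g : V -> C) (k : nat) (w : seq 'I_p) : open U ->
  (forall y, U y -> differentiable a y) -> (forall y, U y -> differentiable u y) ->
  (forall y, U y -> g y = a y ^+ k * u y) -> (size w <= k)%N ->
  exists2 h : V -> C, forall y, U y -> differentiable h y &
    forall y, U y -> Dw w g y = a y ^+ (k - size w) * h y.
Proof.
move=> Uo da du gE; elim: w => [_|j w IH wk]; first by exists u => // y /gE; rewrite subn0.
have [h dh hE] := IH (ltnW wk).
pose m := (k - (size w).+1)%N.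
have mE : (k - size w = m.+1)%N by rewrite /m subnSK.
exists (fun y => a y * 'D_(dir R j) h y + m.+1%:R * 'D_(dir R j) a y * h y).
  move=> y Uy.
  have da' := @Dw_differentiable R p [:: j] a U Uo da y Uy.
  have dh' := @Dw_differentiable R p [:: j] h U Uo dh y Uy.
  have dc : differentiable (fun=> m.+1%:R : C) y by exact: differentiable_cst.
  exact: (differentiableD (differentiableM (da y Uy) dh')
    (differentiableM (differentiableM dc da') (dh y Uy))).
move=> y Uy; rewrite -[LHS]/('D_(dir R j) (Dw w g) y) -/m.
have -> : 'D_(dir R j) (Dw w g) y = 'D_(dir R j) (fun y => a y ^+ m.+1 * h y) y.
  apply: near_eq_derive; apply: filterS (open_nbhs_nbhs (conj Uo Uy)) => x Ux.
  by rewrite hE// mE.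
exact: derive_powM (da y Uy) (dh y Uy).
Qed.

(** From D^w g = a^(d - |w|) h, the d-th power contains a^(d(d - kap)), which is g^(d - kap) up to a
    unit. Taking d-th powers avoids fractional exponents. *)
Lemma power_jet_bound (U : set V) (a u g : V -> C) (d kap : nat) (w : seq 'I_p) (z : V) :
  open U -> U z -> (kap <= d)%N -> (size w <= kap)%N ->
  (forall y, U y -> differentiable a y) -> (forall y, U y -> differentiable u y) ->
  (forall y, U y -> u y != 0) -> (forall y, U y -> g y = a y ^+ d * u y) ->
  exists Cc r : R, [/\ 0 < r, 0 <= Cc & forall y, rn (y - z) < r ->
    rn (Dw w g y) ^+ d <= Cc * rn (g y) ^+ (d - kap)].
Proof.
move=> Uo Uz kd wk da du u0 gE.
have [h dh hE] := Dw_power Uo da du gE (leq_trans wk kd).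
(* The quotient of (D^w g)^d by g^(d - kap), written without dividing by [a]. *)
pose q y := a y ^+ (d * (kap - size w)) * (h y ^+ d * (u y)^-1 ^+ (d - kap)).
have dq : differentiable q z.
  apply: (differentiableM (differentiable_pow _ (da z Uz))).
  apply: (differentiableM (differentiable_pow _ (dh z Uz))).
  by apply: differentiable_pow; apply: (differentiableV (du z Uz) (u0 z Uz)).
have /continuous_rnP/(_ 1 ltr01)[e e0 eH] := differentiable_continuous dq.
have /nbhs_rnP[r r0 rU] := open_nbhs_nbhs (conj Uo Uz).
exists (rn (q z) + 1), (Num.min e r); split; first by rewrite lt_min e0.
  by rewrite addr_ge0 ?rn_ge0.
move=> y; rewrite lt_min => /andP[ye yr]; have Uy := rU y yr.
have -> : rn (Dw w g y) ^+ d = rn (q y) * rn (g y) ^+ (d - kap).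
  rewrite -!rnX -rnM; congr rn; rewrite hE// gE// /q.
  have -> : (d - size w = (d - kap) + (kap - size w))%N by rewrite addnBA// subnK.
  have := u0 y Uy; move: (a y) (h y) (u y) => A H u' uy.
  move: (d - kap)%N (kap - size w)%N => m l.
  have key (P L K S : C) : S != 0 -> P * L * K = L * (K * S^-1) * (P * S).
    by move=> S0; field.
  rewrite !exprMn exprVn -!exprM mulnDl exprD (mulnC m) (mulnC l).
  exact: (key _ _ _ _ (expf_neq0 m uy)).
apply: ler_wpM2r; first by rewrite exprn_ge0 ?rn_ge0.
have := rn_dist (q y) (q z) 0; rewrite !subr0 addrC => /le_trans; apply.
by rewrite lerD2l; exact: ltW (eH y ye).
Qed.

End PowerJets.

Section Fermat.
Variables (R : realType) (p n d : nat).
Notation C := (Cplx R).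
Notation V := 'rV[C]_p.
Variable f : V -> projSpace C n.
Hypothesis f_holo : holoMap f.
Hypothesis f_omits : range f `&` fermat C n d = set0.

(** The chosen coordinates need not depend continuously on [z]; only expressions of degree 0 in them
    are differentiated. *)
Definition hc (i : 'I_n.+1) (z : V) : C := hcoord (f z) 0 i.
Definition fermat_sum (z : V) : C := \sum_k hc k z ^+ d.
Definition fermat_ratio (i : 'I_n.+1) (z : V) : C := hc i z ^+ d / fermat_sum z.

Lemma meval_pow (v : 'I_n.+1 -> C) i : meval v (mpolyX C (mnm1 i) ^+ d) = v i ^+ d.
Proof. by rewrite rmorphXn /= mevalXU. Qed.

Lemma meval_fermat (c : 'I_n.+1 -> C) (v : 'I_n.+1 -> C) :
  meval v (\sum_i c i *: mpolyX C (mnm1 i) ^+ d) = \sum_i c i * v i ^+ d.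
Proof.
rewrite raddf_sum; apply: eq_bigr => i _.
transitivity (c i * meval v (mpolyX C (mnm1 i) ^+ d)); first exact: mevalZ.
by rewrite meval_pow.
Qed.

Lemma fermat_sum_neq0 z : fermat_sum z != 0.
Proof.
apply/eqP => Q0; have : (range f `&` fermat C n d) (f z).
  split; first by exists z.
  rewrite /fermat /zeroLocus /=.
  rewrite -[RHS]Q0 raddf_sum; apply: eq_bigr => i _.
  exact: meval_pow.
by rewrite f_omits.
Qed.

Lemma hc_neq0 z : exists j, hc j z != 0.
Proof.
have : hcoord (f z) != 0.
  rewrite /hcoord vpick0 -dimv_eq0; case: (f z) => L /= /eqP hL.
  by rewrite hL.
move=> /rV0Pn[j hj]; by exists j.
Qed.

Lemma fermat_ratio_sum z : \sum_i fermat_ratio i z = 1.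
Proof. by rewrite -mulr_suml divff// fermat_sum_neq0. Qed.

Definition chart j : set V := [set z | hc j z != 0].

Lemma chart_open j : open (chart j).
Proof. exact: (f_holo j).1. Qed.

Lemma chart_near j z : chart j z ->
  exists2 r : R, 0 < r & forall y, rn (y - z) < r -> chart j y.
Proof.
move=> jz; have H : nbhs z (chart j) := open_nbhs_nbhs (conj (@chart_open j) jz).
by have /nbhs_rnP := H.
Qed.

Definition acoord j k z : C := hc k z / hc j z.

Lemma acoord_differentiable j k z : chart j z -> differentiable (acoord j k) z.
Proof.
move=> jz; have [kj|] := unliftP j k; last first.
  move=> ->; apply: (@near_eq_differentiable R _ (fun=> 1)); last exact: differentiable_cst.
  have [r r0 rj] := chart_near jz; apply/nbhs_rnP; exists r => // y /rj jy.
  by rewrite /acoord divff.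
move=> ->; have -> : acoord j (lift j kj) = (fun N : 'rV[C]_n => N 0 kj) \o (affChart j \o f).
  by apply/funext => y; rewrite /= mxE.
apply: differentiable_comp; first exact: (f_holo j).2.
exact: differentiable_coord.
Qed.

Definition aunit j z : C := (\sum_k acoord j k z ^+ d)^-1.

Lemma aunitE j z : chart j z -> \sum_k acoord j k z ^+ d = fermat_sum z / hc j z ^+ d.
Proof.
by move=> jz; rewrite mulr_suml; apply: eq_bigr => k _; rewrite expr_div_n.
Qed.

Lemma acoord_sum_neq0 j z : chart j z -> \sum_k acoord j k z ^+ d != 0.
Proof.
move=> jz; rewrite aunitE// mulf_neq0 ?fermat_sum_neq0// invr_eq0.
exact: expf_neq0.
Qed.

Lemma aunit_differentiable j z : chart j z -> differentiable (aunit j) z.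
Proof.
move=> jz; apply: differentiableV; last exact: acoord_sum_neq0.
apply: differentiable_bigsum => k; apply: differentiable_pow.
exact: acoord_differentiable.
Qed.

Lemma fermat_ratio_chart j i z : chart j z ->
  fermat_ratio i z = acoord j i z ^+ d * aunit j z.
Proof.
move=> jz; rewrite /aunit aunitE// /acoord expr_div_n /fermat_ratio invf_div.
by rewrite mulrA divfK// expf_neq0.
Qed.

Lemma fermat_ratio_differentiable i z : differentiable (fermat_ratio i) z.
Proof.
have [j jz] := hc_neq0 z.
apply: (@near_eq_differentiable R _ (fun y => acoord j i y ^+ d * aunit j y)).
  have [r r0 rj] := chart_near jz; apply/nbhs_rnP; exists r => // y /rj jy.
  by rewrite (fermat_ratio_chart i jy).
apply: (differentiableM (differentiable_pow d (acoord_differentiable i jz))).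
exact: aunit_differentiable.
Qed.

(** There are finitely many pairs of an index and a word, so the local bounds merge into one: the
    least radius and the sum of the constants. *)
Lemma fermat_ratio_admissible kap : (kap <= d)%N -> admissible kap d fermat_ratio.
Proof.
move=> kd; split; [exact: fermat_ratio_differentiable|exact: fermat_ratio_sum|].
move=> z0; have [j jz] := hc_neq0 z0.
pose P (t : 'I_n.+1 * {bseq kap of 'I_p}) (c : R * R) := [/\ 0 < c.2, 0 <= c.1 &
  forall y, rn (y - z0) < c.2 ->
    rn (Dw t.2 (fermat_ratio t.1) y) ^+ d <= c.1 * rn (fermat_ratio t.1 y) ^+ (d - kap)].
have /choice[F FP] t : exists c, P t c.
  have [||||Cc [r H]] := @power_jet_bound R p (chart j) (acoord j t.1) (aunit j)
      (fermat_ratio t.1) d kap t.2 z0 (@chart_open j) jz kd (size_bseq _).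
  - by move=> y; exact: acoord_differentiable.
  - by move=> y; exact: aunit_differentiable.
  - by move=> y jy; rewrite invr_eq0; exact: acoord_sum_neq0.
  - by move=> y; exact: fermat_ratio_chart.
  by exists (Cc, r).
exists (\big[Num.min/1]_t (F t).2), (\sum_t (F t).1); split.
  by elim/big_ind: _ => // [x y x0 y0|t _]; [rewrite lt_min x0|have [] := FP t].
move=> i w y wk yz; pose t := (i, Bseq wk).
have [t1 t2 tH] := FP t.
have yt : rn (y - z0) < (F t).2 by apply: lt_le_trans yz _; exact: bigmin_le.
apply: le_trans (tH y yt) _; apply: ler_wpM2r; first by rewrite exprn_ge0 ?rn_ge0.
rewrite (bigD1 t)//= lerDl; apply: sumr_ge0 => s _; by have [] := FP s.
Qed.

Lemma fermat_dep (c : 'I_n.+1 -> C) i0 : (0 < d)%N -> c i0 != 0 ->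
  (forall z, \sum_i c i * fermat_ratio i z = 0) -> algDegenerate f.
Proof.
move=> d0 ci Hc; pose Q : mpoly.mpoly n.+1 C := \sum_i c i *: mpolyX C (mnm1 i) ^+ d.
exists (zeroLocus Q).
  exists d, Q; split=> //.
  (* Evaluation at the basis vector of index [i0] recovers [c i0]. *)
  - apply: contraNneq ci => Q0.
    have := meval_fermat c (fun k => (k == i0)%:R); rewrite -/Q Q0 meval0.
    rewrite (bigD1 i0)//= eqxx expr1n mulr1 big1 ?addr0 => [->//|k /negPf ->].
    by rewrite expr0n (gtn_eqF d0) mulr0.
  - rewrite /Q; apply: rpred_sum => i _; apply: rpredZ.
    have h : mpolyX C (mnm1 i) \is ishomog1 1 mdeg by rewrite dhomogX /= mdeg1.
    by have := dhomogMn d h; rewrite mul1n.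
move=> _ [z _ <-]; rewrite /zeroLocus /= /Q meval_fermat.
have := Hc z; rewrite -[X in X = 0]/(\sum_i c i * (hc i z ^+ d / fermat_sum z)).
rewrite (eq_bigr (fun i => (c i * hc i z ^+ d) / fermat_sum z)) => [|i _]; last exact: mulrA.
rewrite -mulr_suml => /eqP; rewrite mulf_eq0 invr_eq0 (negPf (fermat_sum_neq0 z)) orbF.
by move/eqP.
Qed.

End Fermat.

(** * From the rank of the Jacobian of [f] to that of the derivatives of the ratios *)

Section Rank.
Variable R : realType.
Notation C := (Cplx R).

(** With [minor_rank], expresses a lower bound on the rank by a nonzero minor, a condition that
    persists at nearby points. *)
Lemma rank_minor (F : fieldType) (p n : nat) (A : 'M[F]_(p, n)) :
  exists (u : 'I_(\rank A) -> 'I_p) (v : 'I_(\rank A) -> 'I_n),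
    \det (\matrix_(s, t) A (u s) (v t)) != 0.
Proof.
pose u := maxrankfun A; have Bf : row_free (rowsub u A) by exact: maxrowsub_free.
have Bt : row_full (rowsub u A)^T by rewrite /row_full mxrank_tr.
exists u, (fullrankfun Bt); have := fullrowsub_unit Bt; rewrite -unitmx_tr unitmxE unitfE.
by congr (\det _ != 0); apply/matrixP => s t; rewrite !mxE.
Qed.

Lemma minor_rank (F : fieldType) (p n r : nat) (A : 'M[F]_(p, n)) u v :
  \det (\matrix_(s < r, t < r) A (u s) (v t)) != 0 -> (r <= \rank A)%N.
Proof.
move=> D0; have U : rowsub v (rowsub u A)^T \in unitmx.
  rewrite -unitmx_tr unitmxE unitfE; apply: contraNneq D0 => <-.
  by apply/eqP; congr (\det _); apply/matrixP => s t; rewrite !mxE.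
rewrite -(mxrank_unit U); apply: leq_trans (mxrankS (rowsub_sub _ _)) _.
by rewrite mxrank_tr; exact: mxrankS (rowsub_sub _ _).
Qed.

Lemma diff_coord n (l : 'I_n) (x : 'rV[C]_n) :
  'd (fun N : 'rV[C]_n => N 0 l : C) x = (fun N => N 0 l) :> ('rV[C]_n -> C).
Proof.
have lin : linear (fun N : 'rV[C]_n => N 0 l : C) by move=> c u v; rewrite !mxE.
pose h := GRing.isLinear.Build _ _ _ _ _ lin.
pose H : {linear 'rV[C]_n -> C} := HB.pack (fun N : 'rV[C]_n => N 0 l : C) h.
by have := @diff_lin _ _ _ H x (@coord_continuous _ _ _ 0 l).
Qed.

Variables (p n d : nat) (f : 'rV[C]_p -> projSpace C n).
Notation V := 'rV[C]_p.
Hypothesis f_holo : holoMap f.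
Hypothesis f_omits : range f `&` fermat C n d = set0.
Hypothesis d0 : (0 < d)%N.

Definition Jac i (y : V) : 'M[C]_(p, n) :=
  \matrix_(j, l) 'D_(dir R j) (acoord f i (lift i l)) y.

Lemma jacobianE i y : chart f i y -> jacobian (affChart i \o f) y = Jac i y.
Proof.
move=> iy; have dF := (f_holo i).2 y iy.
apply/matrixP => j l; rewrite !mxE.
have -> : acoord f i (lift i l) = (fun N : 'rV[C]_n => N 0 l) \o (affChart i \o f).
  by apply/funext => x; rewrite /= mxE.
have dc : differentiable (fun N : 'rV[C]_n => N 0 l : C) (affChart i (f y)).
  exact: differentiable_coord.
rewrite deriveE; last exact: differentiable_comp.
by rewrite diff_comp//= diff_coord.
Qed.

(** Write g_k = a^d g_i with a = w_k / w_i. Differentiating expresses da through dg_k and dg_i after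
    division by d a^(d-1) g_i, which is nonzero as no coordinate vanishes. *)
Lemma rank_fermat_ratio i y : chart f i y -> (forall k, hc f k y != 0) ->
  (\rank (Jac i y) <= \rank (\matrix_(j < p, k < n.+1) 'D_(dir R j) (fermat_ratio d f k) y))%N.
Proof.
move=> iy hy; set J := (X in (_ <= \rank X)%N).
have gn0 k : fermat_ratio d f k y != 0.
  by rewrite mulf_neq0 ?expf_neq0// invr_eq0 (fermat_sum_neq0 f_omits).
rewrite -(mxrank_tr (Jac i y)) -(mxrank_tr J); apply: mxrankS.
apply/row_subP => l; set k := lift i l.
pose a := acoord f i k.
have da : differentiable a y := acoord_differentiable f_holo k iy.
have a0 : a y != 0 by rewrite mulf_neq0 ?invr_eq0.
have dg k' := fermat_ratio_differentiable f_holo f_omits k' y.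
pose s := d%:R * a y ^+ d.-1 * fermat_ratio d f i y.
have s0 : s != 0.
  have dn0 : d%:R != 0 :> C by rewrite pnatr_eq0 -lt0n.
  exact: mulf_neq0 (mulf_neq0 dn0 (expf_neq0 _ a0)) (gn0 i).
have E v : s * 'D_v a y = 'D_v (fermat_ratio d f k) y - a y ^+ d * 'D_v (fermat_ratio d f i) y.
  have -> : 'D_v (fermat_ratio d f k) y = 'D_v (fun y => a y ^+ d.-1.+1 * fermat_ratio d f i y) y.
    apply: near_eq_derive; have [r r0 rj] := chart_near f_holo iy.
    apply/nbhs_rnP; exists r => // x /rj ix.
    rewrite prednK// /a /acoord /fermat_ratio expr_div_n mulrA divfK//.
    exact: expf_neq0.
  have := derive_powM v d.-1 da (dg i) => ->.
  rewrite /s prednK//; have -> : a y ^+ d = a y * a y ^+ d.-1 by rewrite -exprS prednK.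
  by move: ('D_v _ _) ('D_v _ _) (a y) (fermat_ratio _ _ _ _) => *; ring.
have -> : row l (Jac i y)^T = s^-1 *: (row k J^T - a y ^+ d *: row i J^T).
  apply/rowP => j; rewrite !mxE -E mulKf//.
apply: scalemx_sub; apply: addmx_sub; first exact: row_sub.
by rewrite -scaleNr; apply: scalemx_sub; exact: row_sub.
Qed.

(** A coordinate may vanish at [z] itself; a nonzero minor survives at a nearby point where none
    does. *)
Lemma full_rank_point z i : (forall k, exists y, hc f k y != 0) -> chart f i z ->
  exists y, (\rank (Jac i z) <= \rank (\matrix_(j < p, k < n.+1) 'D_(dir R j) (fermat_ratio d f k) y))%N.
Proof.
move=> hk iz; have [u [v]] := rank_minor (Jac i z); move: (\rank _) u v => m u v D0.
pose D y := \det (\matrix_(s < m, t < m) Jac i y (u s) (v t)).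
have dD : differentiable D z.
  apply: differentiable_det => s t.
  have -> : (fun y => (\matrix_(s < m, t < m) Jac i y (u s) (v t)) s t) =
     'D_(dir R (u s)) (acoord f i (lift i (v t))).
    by apply/funext => y; rewrite !mxE.
  apply: (@Dw_differentiable R p [:: u s] _ (chart f i)) => //; first exact: chart_open.
  by move=> y; exact: acoord_differentiable.
have /continuous_rnP dc := differentiable_continuous dD.
have D1 : 0 < rn (D z) by rewrite rn_gt0.
have [e e0 eH] := dc _ D1; have [r r0 rj] := chart_near f_holo iz.
have [|||y] := @common_nonzero R p _ (enum 'I_n.+1) (fermat_ratio d f) z (Num.min e r).
- by rewrite lt_min e0.
- by move=> k y; exact: fermat_ratio_differentiable.
- move=> k _; have [y ky] := hk k; exists y.
  by rewrite mulf_neq0 ?expf_neq0// invr_eq0 (fermat_sum_neq0 f_omits).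
rewrite lt_min => /andP[ye yr] gy; exists y.
have hy k : hc f k y != 0.
  by have := gy k (mem_enum _ _); rewrite mulf_eq0 negb_or expf_eq0 d0 => /andP[].
apply: leq_trans (rank_fermat_ratio (rj y yr) hy).
apply: (@minor_rank _ _ _ _ _ u v); move: (eH y ye).
by apply: contraTneq; rewrite -/(D y) => ->; rewrite sub0r rnN ltxx.
Qed.

End Rank.

(** * Conclusion: without degeneracy some Wronskian would both vanish and not vanish *)

Theorem theoremB (R : realType) (p n d : nat) (hp : (1 <= p)%N) (hn : (2 <= n)%N)
    (hd : ((n + 1) * kappa p n < d)%N)
    (f : 'rV[Cplx R]_p -> projSpace (Cplx R) n)
    (f_holo : holoMap f) (f_rank : maximalRank f)
    (f_omits : range f `&` fermat (Cplx R) n d = set0) :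
  algDegenerate f.
Proof.
have kap0 : (0 < kappa p n)%N := leq_maxr _ _.
have kd : (n.+1 * kappa p n < d)%N by rewrite -(addn1 n).
have d0 : (0 < d)%N by exact: leq_ltn_trans (leq0n _) kd.
have n0 : (0 < n)%N by exact: ltnW.
have gdiff i y : differentiable (fermat_ratio d f i) y by exact: fermat_ratio_differentiable.
apply: contrapT => ndeg.
have indep c : (forall y, \sum_i c i * fermat_ratio d f i y = 0) -> forall i, c i = 0.
  move=> Hc i; apply: contrapT => /eqP ci; apply: ndeg; exact: (fermat_dep f_omits d0 ci Hc).
have [z [i [iz rz]]] := f_rank.
(* A coordinate that vanishes identically would already be a linear relation between the ratios. *)
have hk k : exists y, hc f k y != 0.
  apply: contrapT => /forallNP H; suff /(indep (fun l => (l == k)%:R))/(_ k)/eqP :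
      forall y, \sum_l (l == k)%:R * fermat_ratio d f l y = 0.
    by rewrite eqxx oner_eq0.
  move=> y; apply: big1 => l _.
  have [->|_] := eqVneq l k; last by rewrite mul0r.
  have /negP := H y; rewrite negbK => /eqP h.
  by rewrite /fermat_ratio h expr0n (gtn_eqF d0) mul0r mulr0.
have [y] := full_rank_point f_holo f_omits d0 hk iz.
rewrite -(jacobianE f_holo iz) rz => ry.
have [|ws [wsk [z1 /eqP]]] := Wronskian_nonzero gdiff indep (fermat_ratio_sum f_omits) ry kap0.
  (* This is n < min(p, n) + kappa(p, n): the sum is at least p + (n + 1 - p) if p <= n, and at
     least n + 1 otherwise. *)
  rewrite /kappa; have [pn|np] := leqP p n.
    by rewrite (leq_trans _ (leq_add (leqnn _) (leq_maxl _ _)))// addn1 subnKC// leqW.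
  by rewrite (leq_trans _ (leq_add (leqnn _) (leq_maxr _ _)))// addn1.
apply; apply: (Wronskian_vanishes z1 n0 kap0 kd _ wsk).
apply: fermat_ratio_admissible => //; apply: leq_trans (ltnW kd).
by rewrite leq_pmull.
Qed.
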